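(* Let $A\in\mathbb{R}^{n\times d}$ have full column rank, $b\in\mathbb{R}^n$, $x^*:=\arg\min_{x\in\mathbb{R}^d}\|Ax-b\|_2^2$ with $Ax^*\ne0$, $q\ge1$ and $m>d+3$. Define $$\theta_1:=\frac{m}{m-d-1},\qquad \theta_2:=\frac{m^2(m-1)}{(m-d)(m-d-1)(m-d-3)}.$$ Let $x_0=0$ and run the distributed iterative Hessian sketch $$x_{t+1}=x_t-\mu\,\frac1q\sum_{k=1}^q\big(A^TS_{t,k}^TS_{t,k}A\big)^{-1}A^T(Ax_t-b)$$ with $\mu=1/\theta_1$ and i.i.d. Gaussian sketches $S_{t,k}\in\mathbb{R}^{m\times n}$; in each iteration each worker $k$ sketches $A$, computes the gradient $g_t=A^T(Ax_t-b)$, solves for its direction $-(A^TS_{t,k}^TS_{t,k}A)^{-1}g_t\in\mathbb{R}^d$ and sends it to the master node, which averages. Let $e^A_t:=A(x_t-x^* )$. Then for $\epsilon>0$ the output after $T$ iterations is $\epsilon$-accurate with respect to the initial error in expectation, that is, $$\frac{\mathbb{E}\big[\|e_T^A\|_2^2\big]}{\|Ax^*\|_2^2}=\epsilon,$$ where $T$ (assumed to be a positive integer) is given by $$T=\frac{\log(1/\epsilon)}{\log(q)-\log\left(\frac{\theta_2}{\theta_1^2}-1\right)}.$$ The overall required communication is $Tqd$ real numbers, and the computational complexity per worker is $O(Tmnd+Tmd^2+Td^3)$.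
   Context: A Gaussian sketch is a random matrix $S\in\mathbb{R}^{m\times n}$ with i.i.d. entries distributed as $\mathcal{N}(0,1/m)$, so that $\mathbb{E}[S^TS]=I_n$. The expectation is over all sketches. Communication counts the real numbers sent by the workers to the master node; computational complexity counts arithmetic operations. *)

(* Defs.v *)
From HB Require Import structures.
From mathcomp Require Import all_boot all_order all_algebra finmap.
From mathcomp Require Import all_classical all_reals all_analysis.

Set Implicit Arguments.
Unset Strict Implicit.
Unset Printing Implicit Defensive.

Import Order.TTheory GRing.Theory Num.Theory.
Import numFieldNormedType.Exports.

Local Open Scope classical_set_scope.
Local Open Scope ring_scope.

(* The library norm `|v| on matrices is the sup norm, hence this definition of
   the Euclidean one. *)
Definition norm2 (R : realType) (n : nat) (v : 'cV[R]_n) : R :=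
  Num.sqrt (\sum_(i < n) v i 0 ^+ 2).

(* [xs] minimizes x |-> ||A x - b||_2^2; unique when A has full column rank. *)
Definition is_least_squares (R : realType) (n d : nat)
    (A : 'M[R]_(n, d)) (b : 'cV[R]_n) (xs : 'cV[R]_d) : Prop :=
  forall x : 'cV[R]_d, norm2 (A *m xs - b) ^+ 2 <= norm2 (A *m x - b) ^+ 2.

(* All subtractions take place in R, not in nat. *)
Definition theta1 (R : realType) (m d : nat) : R :=
  m%:R / (m%:R - d%:R - 1).

Definition theta2 (R : realType) (m d : nat) : R :=
  (m%:R ^+ 2 * (m%:R - 1)) /
  ((m%:R - d%:R) * (m%:R - d%:R - 1) * (m%:R - d%:R - 3)).

Definition mutually_independent (disp : measure_display)
    (Omega : measurableType disp) (R : realType) (P : probability Omega R)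
    (I : choiceType) (X : I -> {RV P >-> R}) : Prop :=
  forall (J : {fset I}) (B : I -> set R), (forall i, measurable (B i)) ->
    P (\bigcap_(i in [set` J]) (X i @^-1` B i)) =
    (\prod_(i <- J) P (X i @^-1` B i))%E.

(* The second argument of [normal_prob] is the standard deviation. *)
Definition has_normal_law (disp : measure_display)
    (Omega : measurableType disp) (R : realType) (P : probability Omega R)
    (mean variance : R) (X : {RV P >-> R}) : Prop :=
  forall B : set R, measurable B ->
    distribution P X B = normal_prob mean (Num.sqrt variance) B.

(* [S t k i j] is the (i, j) entry of the sketch of worker k at iteration t.
   The sketches are i.i.d. and each of them has i.i.d. N(0, 1/m) entries: the
   whole family of entries is i.i.d. *)
Definition iid_gaussian_sketches (disp : measure_display)
    (Omega : measurableType disp) (R : realType) (P : probability Omega R)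
    (q m n : nat) (S : nat -> 'I_q -> 'I_m -> 'I_n -> {RV P >-> R}) : Prop :=
  (forall t k i j, has_normal_law 0 m%:R^-1 (S t k i j)) /\
  mutually_independent
    (fun a : nat * 'I_q * 'I_m * 'I_n => S a.1.1.1 a.1.1.2 a.1.2 a.2).

Definition sketch_at (disp : measure_display)
    (Omega : measurableType disp) (R : realType) (P : probability Omega R)
    (q m n : nat) (S : nat -> 'I_q -> 'I_m -> 'I_n -> {RV P >-> R})
    (w : Omega) (t : nat) (k : 'I_q) : 'M[R]_(m, n) :=
  \matrix_(i < m, j < n) S t k i j w.

(* Iterates of the distributed iterative Hessian sketch for the sketches
   [S t k].  [invmx M = M] for singular M; for Gaussian sketches with m >= d
   and A of full column rank this concerns a null event only. *)
Fixpoint ihs (R : realType) (q m n d : nat) (A : 'M[R]_(n, d)) (b : 'cV[R]_n)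
    (mu : R) (S : nat -> 'I_q -> 'M[R]_(m, n)) (t : nat) : 'cV[R]_d :=
  if t is s.+1 then
    let x := ihs A b mu S s in
    x - mu *: (q%:R^-1 *: \sum_(k < q)
          invmx (A^T *m (S s k)^T *m S s k *m A) *m (A^T *m (A *m x - b)))
  else 0.

(* Arithmetic complexity is measured on straight-line programs.  An instruction
   applies one operation to two memory cells and appends the result to the
   memory, which initially holds the inputs; cells beyond the end read as 0, and
   x / 0 = 0.  Programs being first-order syntax that does not depend on the
   data, the length of the code is the number of arithmetic operations. *)
Inductive arith_op := Add | Sub | Mul | Div.

Record slp := Slp {
  slp_code : seq (arith_op * nat * nat);
  slp_outputs : seq nat }.

Definition slp_ops (p : slp) : nat := size (slp_code p).

Definition eval_op (R : realType) (o : arith_op) (x y : R) : R :=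
  match o with
  | Add => x + y
  | Sub => x - y
  | Mul => x * y
  | Div => x / y
  end.

Definition slp_step (R : realType) (mem : seq R)
    (c : arith_op * nat * nat) : seq R :=
  rcons mem (eval_op c.1.1 mem`_(c.1.2) mem`_(c.2)).

Definition slp_run (R : realType) (p : slp) (inputs : seq R) : seq R :=
  let mem := foldl (@slp_step R) inputs (slp_code p) in
  [seq mem`_i | i <- slp_outputs p].

(* row-major list of entries *)
Definition entries (R : realType) (m n : nat) (M : 'M[R]_(m, n)) : seq R :=
  [seq M i j | i <- enum 'I_m, j <- enum 'I_n].

(* The three phases of the work of a worker in one iteration. *)
Record worker := Worker {
  sketch_prog : slp;       (* (S, A) |-> S A *)
  gradient_prog : slp;     (* (A, b, x) |-> A^T (A x - b) *)
  direction_prog : slp }.  (* (S A, g) |-> - ((S A)^T S A)^-1 g *)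

Definition worker_ops (W : worker) : nat :=
  (slp_ops (sketch_prog W) + slp_ops (gradient_prog W) +
   slp_ops (direction_prog W))%N.

Definition worker_message (R : realType) (m n d : nat) (W : worker)
    (A : 'M[R]_(n, d)) (b : 'cV[R]_n) (S : 'M[R]_(m, n)) (x : 'cV[R]_d) :
    seq R :=
  slp_run (direction_prog W)
    (slp_run (sketch_prog W) (entries S ++ entries A) ++
     slp_run (gradient_prog W) (entries A ++ entries b ++ entries x)).

Definition worker_correct (R : realType) (m n d : nat) (W : worker) : Prop :=
  [/\ forall (S : 'M[R]_(m, n)) (A : 'M[R]_(n, d)),
        slp_run (sketch_prog W) (entries S ++ entries A) = entries (S *m A),
      forall (A : 'M[R]_(n, d)) (b : 'cV[R]_n) (x : 'cV[R]_d),
        slp_run (gradient_prog W) (entries A ++ entries b ++ entries x) =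
        entries (A^T *m (A *m x - b))
    & forall (SA : 'M[R]_(m, d)) (g : 'cV[R]_d), SA^T *m SA \in unitmx ->
        slp_run (direction_prog W) (entries SA ++ entries g) =
        entries (- (invmx (SA^T *m SA) *m g))].

(* State of the distributed execution: the iterate held by the master node, the
   messages sent so far by the workers, and the number of arithmetic operations
   performed so far by each worker. *)
Record dist_state (R : realType) (q d : nat) := DistState {
  iterate : 'cV[R]_d;
  transcript : seq (seq R);
  ops_of : 'I_q -> nat }.

Fixpoint dist_run (R : realType) (q m n d : nat) (W : worker)
    (A : 'M[R]_(n, d)) (b : 'cV[R]_n) (mu : R)
    (S : nat -> 'I_q -> 'M[R]_(m, n)) (t : nat) : dist_state R q d :=
  if t is s.+1 then
    let st := dist_run W A b mu S s in
    let msg k := worker_message W A b (S s k) (iterate st) in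
    DistState
      (iterate st + mu *: (q%:R^-1 *: \sum_(k < q) \col_(i < d) (msg k)`_i))
      (transcript st ++ [seq msg k | k <- enum 'I_q])
      (fun k => ops_of st k + worker_ops W)%N
  else DistState 0 [::] (fun=> 0%N).

(* number of reals sent by the workers to the master node *)
Definition communication (R : realType) (q d : nat) (st : dist_state R q d) :
    nat :=
  sumn [seq size msg | msg <- transcript st].

(* Main.v *)
Require Import Defs.
From HB Require Import structures.
From mathcomp Require Import all_boot all_order all_algebra finmap.
From mathcomp Require Import all_classical all_reals all_analysis.
From mathcomp Require Import measurable_realfun ring lra zify.

Set Implicit Arguments.
Unset Strict Implicit.
Unset Printing Implicit Defensive.

Import Order.TTheory GRing.Theory Num.Theory.
Import numFieldNormedType.Exports.

Local Open Scope classical_set_scope.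
Local Open Scope ring_scope.

(** Write A = U R0 with U^T U = 1 and R0 invertible.  By the normal equation
    A^T (A xs - b) = 0, the coordinates z_t = R0 (x_t - xs) of the error
    A (x_t - xs) in the basis U satisfy
      z_{t+1} = z_t - mu/q (M_1 + ... + M_q) z_t,
    where M_k is the inverse of the Gram matrix W of the m x d Gaussian matrix
    G = S_{t,k} U ([ihs_step]).  Hence everything follows from the first two
    moments E[M] = theta1 and E[M^2] = theta2 (multiples of the identity) of an
    inverse Wishart matrix: expanding |z_{t+1}|^2 gives
      E|z_{t+1}|^2 =
        (1 - 2 mu theta1 + mu^2 (theta2 + (q - 1) theta1^2) / q) E|z_t|^2,
    which for mu = 1/theta1 is ((theta2/theta1^2 - 1) / q) E|z_t|^2
    ([averaged_moment], [mean_factorE]); the formula for T says that the T-th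
    power of this factor is eps.

    The moments come from Gaussian integration by parts
      E[(G^T F(G))_kb h] = s^2 E[(sum_i dF_ib/dG_ik) h]   ([mx_stein])
    with s^2 = 1/m and weights h that do not depend on G.  It is applied to the
    regularized inverse V = (W + lam)^-1 for lam > 0, which is bounded and smooth,
    with F = G V, G V^2 and tr(V) G V ([stein_id1], [stein_id2], [stein_id3]).  The
    traces of the three identities, in which the terms of order lam have a
    favourable sign, bound E[tr(V^2) h] uniformly in lam ([reg_moment_bound]),
    thanks to m > d + 3.  The bound has two consequences: W is almost surely
    invertible ([singular_null]), since tr(V^2) >= 1/lam^2 at singular W, and
    tr(M^2) h is integrable by Fatou's lemma ([intg_inverse_sq]).  The latter
    dominates the identities, and for lam -> 0 they become a linear system whose
    solution is [inverse_moments].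

    Carrying the weight h through replaces conditional expectations: products of
    entries of z_t, and of other workers' matrices, are weights for M_k.  To make
    sense of functions that do not depend on G, the joint law of the entries of
    all sketches is seen as a measure on the space of real families, where single
    coordinates can be modified and resampled ([resample]).

    The worker's programs are generated by a small library of straight-line code.
    The Gram matrix of a full-rank sketch is positive definite, so the linear
    system is solved by elimination without pivoting ([computes_solve]), and the
    operation count does not depend on the data ([worker_prog_ops]). *)

(** * Families of independent variables *)

Section Configurations.
Context (R : realType) (I : choiceType).

Definition box (J : {fset I}) (B : I -> set R) : set (I -> R) :=
  [set xi | forall i, i \in J -> B i (xi i)].

Definition boxes : set (set (I -> R)) :=
  [set A | exists J B, (forall i, measurable (B i)) /\ A = box J B].

(** The space of real families indexed by [I], with its product sigma-algebra. *)
Definition conf := g_sigma_algebraType boxes.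

Lemma boxesI : setI_closed boxes.
Proof.
move=> _ _ [J1 [B1 [mB1 ->]]] [J2 [B2 [mB2 ->]]].
exists (J1 `|` J2)%fset.
exists (fun i => (if i \in J1 then B1 i else setT) `&`
                 (if i \in J2 then B2 i else setT)); split.
  by move=> i; apply: measurableI; case: ifP.
apply/seteqP; split=> xi /=.
  by move=> [h1 h2] i _; split; case: ifP => // iJ; [exact: h1|exact: h2].
move=> h; split=> i iJ.
  by have [] := h i; rewrite ?inE ?iJ.
by have [] := h i; rewrite ?inE ?iJ ?orbT.
Qed.

Lemma boxesT : boxes setT.
Proof. by exists fset0, (fun=> setT); split=> //; apply/esym/seteqP; split. Qed.

Lemma measurable_box J B : (forall i, measurable (B i)) ->
  measurable (box J B : set conf).
Proof. by move=> mB; apply: sub_sigma_algebra; exists J, B. Qed.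

Lemma measurable_coord i : measurable_fun setT (fun xi : conf => xi i).
Proof.
move=> _ B mB; rewrite setTI.
suff -> : (fun xi : conf => xi i) @^-1` B = box [fset i]%fset (fun=> B).
  exact: measurable_box.
apply/seteqP; split=> xi /=; first by move=> ? j; rewrite inE => /eqP ->.
by apply; rewrite inE.
Qed.

Lemma measurable_to_conf d (T : measurableType d) (f : T -> conf) :
  (forall i, measurable_fun setT (fun t => f t i)) -> measurable_fun setT f.
Proof.
move=> mf; apply: (@measurability _ _ T conf setT f boxes) => //.
move=> _ [_ [J [B [mB ->]]] <-].
rewrite setTI.
have -> : f @^-1` box J B = \bigcap_(i in [set` J]) ((fun t => f t i) @^-1` B i).
  by apply/seteqP; split=> t /= h i iJ; exact: h.
apply: fin_bigcap_measurable => [|i _]; first exact: finite_fset.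
by rewrite -[X in measurable X]setTI; exact: mf.
Qed.

Definition upd (xi : conf) (a : I) (x : R) : conf :=
  fun i => if i == a then x else xi i.

Lemma upd_same xi a x : upd xi a x a = x.
Proof. by rewrite /upd eqxx. Qed.

Lemma measurable_upd a :
  measurable_fun setT (fun p : measurableTypeR R * conf => upd p.2 a p.1).
Proof.
apply: measurable_to_conf => i; rewrite /upd; case: eqP => _.
  exact: measurable_fst.
have := measurable_coord i; move/measurableT_comp; apply.
exact: measurable_snd.
Qed.

(** The infinite product of [N], described by its values on boxes: this is what
    mutual independence provides. *)
Definition iid_law (N : probability (measurableTypeR R) R) (mu : probability conf R) :=
  forall J B, (forall i, measurable (B i)) ->
    mu (box J B) = (\prod_(i <- J) N (B i))%E.

(** Replacing one coordinate by an independent copy preserves an i.i.d. law: both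
    measures agree on boxes, which are stable under intersection and generate the
    sigma-algebra.  Integrals over families thereby acquire an inner integral
    over a single variable. *)
Lemma resample (N : probability (measurableTypeR R) R) (mu : probability conf R) (a : I) :
  iid_law N mu -> forall A : set conf, measurable A ->
  mu A = pushforward (N \x mu)%E (fun p => upd p.2 a p.1) A.
Proof.
move=> iid A mA.
have mU := measurable_upd a.
pose nu : {measure set conf -> \bar R} :=
  pushforward (N \x mu)%E (fun p => upd p.2 a p.1).
rewrite -[RHS]/(nu mU A).
have mE : @measurable _ conf = <<s boxes >> by [].
have := @measure_unique _ R conf boxes (fun=> setT) mE boxesI _ _ mu (nu mU) _ _ A mA.
apply => //.
- by move=> _; exact: boxesT.
- by rewrite bigcup_const//; exists 0%N.
- move=> _ [J [B [mB ->]]].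
  rewrite /nu /= /pushforward /=.
  have -> : (fun p : measurableTypeR R * conf => upd p.2 a p.1) @^-1` box J B =
     (if a \in J then B a else setT) `*` box (J `\ a)%fset B.
    apply/seteqP; split=> [[x xi] /= h|[x xi] /= [ha h] i iJ].
      split; first by case: ifP => // /h; rewrite upd_same.
      by move=> i; rewrite !inE => /andP[ia /h]; rewrite /upd (negbTE ia).
    rewrite /upd; case: eqP => [ia|/eqP ia].
      by move: ha; rewrite -ia iJ.
    by apply: h; rewrite !inE ia.
  rewrite product_measure1E; [|by case: ifP => _; [exact: mB|exact: measurableT]|exact: measurable_box].
  rewrite /= !iid//; case: ifPn => aJ.
    by rewrite (big_fsetD1 a)//=.
  rewrite probability_setT mul1e; congr (\big[_/_]_(i <- _) _).
  by rewrite mem_fsetD1.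
- by move=> k; apply: le_lt_trans (probability_le1 _ _) (ltry 1).
Qed.

Lemma ge0_integral_resample (N : probability (measurableTypeR R) R) (mu : probability conf R)
    (a : I) (F : conf -> \bar R) :
  iid_law N mu -> measurable_fun setT F -> (forall xi, 0 <= F xi)%E ->
  (\int[mu]_xi F xi = \int[mu]_xi \int[N]_x F (upd xi a x))%E.
Proof.
move=> iid mF F0; have mU := measurable_upd a.
transitivity (\int[pushforward (N \x mu)%E (fun p => upd p.2 a p.1)]_xi F xi)%E.
  by apply: eq_measure_integral => A mA _; exact: (resample a iid).
rewrite ge0_integral_pushforward// preimage_setT.
rewrite fubini_tonelli2 //; [exact: measurableT_comp|by move=> p; exact: F0].
Qed.

Lemma integral_resample (N : probability (measurableTypeR R) R) (mu : probability conf R)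
    (a : I) (F : conf -> \bar R) :
  iid_law N mu -> mu.-integrable setT F ->
  (\int[mu]_xi F xi = \int[mu]_xi \int[N]_x F (upd xi a x))%E.
Proof.
move=> iid iF; have mU := measurable_upd a.
have mF : measurable_fun setT F by case/integrableP: iF.
have iFU : (N \x mu)%E.-integrable setT (F \o (fun p => upd p.2 a p.1)).
  apply/integrableP; split; first exact: measurableT_comp.
  rewrite fubini_tonelli2//=; last first.
    by apply: measurableT_comp => //; exact: measurableT_comp.
  rewrite /fubini_G -(ge0_integral_resample a (F := fun xi => `|F xi|%E))//.
    by case/integrableP: iF.
  exact: measurableT_comp.
transitivity (\int[pushforward (N \x mu)%E (fun p => upd p.2 a p.1)]_xi F xi)%E.
  by apply: eq_measure_integral => A mA _; exact: (resample a iid).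
rewrite integral_pushforward// preimage_setT -integral21_prod_meas1//.
Qed.

End Configurations.

(** * Integration by parts against a Gaussian density *)

Section Gaussian.
Context (R : realType) (s : R).
Hypothesis s_gt0 : 0 < s.
Notation lambda := (@lebesgue_measure R).
Notation gauss := (normal_prob 0 s).
Notation p := (normal_pdf 0 s).

Let s_neq0 : s != 0. Proof. by rewrite gt_eqF. Qed.

(** The density agrees almost everywhere with the Radon-Nikodym derivative. *)
Lemma ge0_integral_normal_prob (g : R -> \bar R) :
  measurable_fun setT g -> (forall x, 0 <= g x)%E ->
  (\int[gauss]_x g x = \int[lambda]_x (g x * (p x)%:E))%E.
Proof.
move=> mg g0.
have dom := normal_prob_dominates 0 s.
rewrite -(Radon_Nikodym_SigmaFinite.change_of_variables dom)//.
have imf := Radon_Nikodym_SigmaFinite.f_integrable dom.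
have mp : measurable_fun setT (EFin \o p).
  by apply/measurable_EFinP; exact: measurable_normal_pdf.
apply: ae_eq_integral => //.
- by apply: emeasurable_funM => //; exact: measurable_int imf.
- exact: emeasurable_funM.
- apply: ae_eqe_mul2l.
  apply: integral_ae_eq => //.
  by move=> E _ mE; rewrite -Radon_Nikodym_SigmaFinite.f_integral.
Qed.

Lemma integral_normal_prob (g : R -> \bar R) : measurable_fun setT g ->
  (\int[gauss]_x g x = \int[lambda]_x (g x * (p x)%:E))%E.
Proof.
move=> mg; rewrite integralE [RHS]integralE.
have p0 x : 0 <= p x by exact: normal_pdf_ge0.
rewrite !ge0_integral_normal_prob//; [|exact: measurable_funeneg|exact: measurable_funepos].
congr (_ - _)%E; apply: eq_integral => x _.
  by rewrite !funeposE [in RHS]muleC muleC maxe_pMr ?lee_fin// mule0.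
by rewrite !funenegE [in RHS]muleC -muleN muleC maxe_pMr ?lee_fin// mule0.
Qed.

Lemma normal_pdf_expR x : p x = normal_peak s * expR (- (x ^+ 2 / (s ^+ 2 *+ 2))).
Proof. by rewrite normal_pdfE// /normal_fun subr0 mulNr. Qed.

Lemma is_derive_normal_pdf (x : R) : is_derive x 1 p (- (x / s ^+ 2) * p x).
Proof.
have -> : p = fun x => normal_peak s * expR (- (x ^+ 2 / (s ^+ 2 *+ 2))).
  by apply/funext => y; exact: normal_pdf_expR.
have H : is_derive x 1 (fun x : R => - (x ^+ 2 / (s ^+ 2 *+ 2))) (- (x / s ^+ 2)).
  apply: is_derive_eq.
  rewrite /GRing.scale /= mulr0 add0r mulr1 -mulr_natl; field.
  by rewrite s_neq0.
apply: is_derive_eq.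
rewrite /GRing.scale /=; ring.
Qed.

(** One half of the exponent absorbs the factor |x|; the other half is the
    exponent of a Gaussian of twice the variance.  The bound gives the
    integrability of x as well as the decay of boundary terms. *)
Lemma normal_pdf_tail :
  exists C, 0 < C /\ forall x, `|x| * p x <= C * normal_pdf 0 (Num.sqrt 2 * s) x.
Proof.
have t_neq0 : Num.sqrt 2 * s != 0 by rewrite mulf_neq0// sqrtr_eq0 -ltNge.
have peak_gt0 := normal_peak_gt0 t_neq0.
exists (normal_peak s * (1 + 4 * s ^+ 2) / normal_peak (Num.sqrt 2 * s)); split.
  rewrite divr_gt0// mulr_gt0 ?normal_peak_gt0// ltr_pwDl//.
  by rewrite mulr_ge0// sqr_ge0.
move=> x; rewrite normal_pdf_expR normal_pdfE// /normal_fun subr0.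
rewrite [leRHS]mulrA divfK ?gt_eqF// exprMn sqr_sqrtr// -[(2 * _) *+ 2]mulr_natl.
set u := x ^+ 2 / (4 * s ^+ 2).
have u0 : 0 <= u by rewrite divr_ge0 ?sqr_ge0// mulr_ge0 ?sqr_ge0.
have -> : - (x ^+ 2 / (s ^+ 2 *+ 2)) = - u - u.
  by rewrite /u -mulr_natl; field; rewrite s_neq0.
have -> : - x ^+ 2 / (2%:R * (2 * s ^+ 2)) = - u.
  by rewrite /u; field; rewrite s_neq0.
rewrite expRD mulrCA -!mulrA ler_pM2l ?normal_peak_gt0//.
rewrite !mulrA ler_pM2r ?expR_gt0// expRN ler_pdivrMr ?expR_gt0//.
have x2 : x ^+ 2 = 4 * s ^+ 2 * u by rewrite /u; field; rewrite s_neq0.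
have h1 : `|x| <= 1 + x ^+ 2.
  rewrite -[x ^+ 2]real_normK ?num_real//; set y := `|x|.
  have := sqr_ge0 (y - 2^-1); nra.
apply: (le_trans h1); rewrite x2.
have c0 : 0 <= 4 * s ^+ 2 by rewrite mulr_ge0// sqr_ge0.
have u1 := expR_ge1Dx u.
set e := expR u in u1 *; set c := 4 * s ^+ 2 in c0 *.
have -> : 4 * s * s = c by rewrite /c; ring.
nra.
Qed.

Lemma integrable_normal_id : gauss.-integrable setT (fun x : R => x%:E).
Proof.
have [C [C0 hC]] := normal_pdf_tail.
have mE t : measurable_fun setT (fun x => (normal_pdf 0 t x)%:E).
  by apply/measurable_EFinP; exact: measurable_normal_pdf.
apply/integrableP; split; first exact/measurable_EFinP.
rewrite ge0_integral_normal_prob//; last exact/measurableT_comp/measurable_EFinP.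
apply: (@le_lt_trans _ _
  (\int[lambda]_x (C%:E * (normal_pdf 0 (Num.sqrt 2 * s) x)%:E))%E).
  apply: ge0_le_integral => //=.
  - by move=> x _; rewrite -EFinM lee_fin mulr_ge0// normal_pdf_ge0.
  - apply: emeasurable_funM; first exact/measurable_EFinP.
    exact: mE.
  - by apply: measurable_funeM; exact: mE.
  - by move=> x _; rewrite -!EFinM lee_fin.
rewrite integralZl//; last exact: integrable_normal_pdf.
by rewrite integral_normal_pdf mule1 ltry.
Qed.

(** Since f p has derivative f' p - (x / s^2) f p, it is enough that the integral
    of this derivative over [-N, N], a difference of boundary values, tends to 0. *)
Lemma normal_stein (f f' : R -> R) (C : R) :
  (forall x : R, is_derive x 1 f (f' x)) -> continuous f' ->
  (forall x, `|f x| <= C) -> (forall x, `|f' x| <= C) ->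
  (\int[gauss]_x (x * f x)%:E = (s ^+ 2)%:E * \int[gauss]_x (f' x)%:E)%E.
Proof.
move=> df cf' bf bf'.
have cf : continuous f.
  move=> x; apply: differentiable_continuous; apply/derivable1_diffP.
  exact: ex_derive.
have cp : continuous p by exact: continuous_normal_pdf.
have mp := measurable_normal_pdf 0 s.
have mf : measurable_fun setT f by exact: continuous_measurable_fun.
have mf' : measurable_fun setT f' by exact: continuous_measurable_fun.
have C0 : 0 <= C by exact: le_trans (bf 0).
have [D [D0 hD]] := normal_pdf_tail.
have p0 x : 0 <= p x by exact: normal_pdf_ge0.
pose q := normal_pdf 0 (Num.sqrt 2 * s).
pose g1 x := f' x * p x; pose g2 x := x / s ^+ 2 * f x * p x.
pose g x := g1 x - g2 x.
have dg (x : R) : is_derive x 1 (fun x => f x * p x) (g x).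
  have := is_derive_normal_pdf x; have := df x => dfx dpx.
  apply: is_derive_eq; rewrite /g /g1 /g2 /GRing.scale /=; ring.
have ig1 : lambda.-integrable setT (EFin \o g1).
  apply: (@le_integrable _ _ _ lambda setT measurableT (EFin \o g1)
    (fun x => C%:E * (p x)%:E)%E) => //.
  - by apply/measurable_EFinP; exact: measurable_funM.
  - move=> x _; rewrite -EFinM /= lee_fin !normrM ler_pM//.
    by rewrite (ger0_norm C0).
  - by apply: integrableZl => //; exact: integrable_normal_pdf.
have ig2 : lambda.-integrable setT (EFin \o g2).
  apply: (@le_integrable _ _ _ lambda setT measurableT (EFin \o g2)
    (fun x => (s ^- 2 * C * D)%:E * (q x)%:E)%E) => //.
  - apply/measurable_EFinP; apply: measurable_funM => //.
    apply: measurable_funM => //; exact: measurable_funM.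
  - move=> x _; rewrite -EFinM /= lee_fin !normrM.
    rewrite [in leRHS](ger0_norm (normal_pdf_ge0 _ _ _)).
    rewrite (ger0_norm C0) (gtr0_norm D0).
    rewrite (ger0_norm (p0 x)) (ger0_norm (x := s ^- 2)) ?invr_ge0 ?sqr_ge0//.
    have -> : `|x| * s ^- 2 * `|f x| * p x = s ^- 2 * (`|f x| * (`|x| * p x)).
      ring.
    rewrite -!mulrA ler_pM2l ?invr_gt0 ?exprn_gt0// ler_pM//.
    by rewrite mulr_ge0.
  - by apply: integrableZl => //; exact: integrable_normal_pdf.
have ig : lambda.-integrable setT (EFin \o g).
  by apply: eq_integrable (integrableB _ ig1 ig2).
have cg : continuous g.
  move=> x; apply: cvgB; first by apply: cvgM; [exact: cf'|exact: cp].
  apply: cvgM; last exact: cp.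
  by apply: cvgM; [apply: cvgM; [exact: cvg_id|exact: cvg_cst]|exact: cf].
have int0 : (\int[lambda]_x (g x)%:E = 0)%E.
  pose gn n x := (g x * \1_(`[- n.+1%:R, n.+1%:R]%classic : set R) x)%:E.
  have mg : measurable_fun setT g by exact: continuous_measurable_fun.
  have [] := @dominated_convergence _ _ _ lambda setT measurableT gn
    (EFin \o g) (fun x => `|(g x)%:E|%E).
  - by move=> n; apply/measurable_EFinP; exact: measurable_funM.
  - exact/measurable_EFinP.
  - apply: aeW => x _; apply: cvg_near_cst.
    near=> n; rewrite /gn indicE mem_set ?mulr1//=.
    rewrite in_itv/= -ler_norml.
    apply: (@le_trans _ _ n%:R); last by rewrite ler_nat.
    by near: n; exact: nbhs_infty_ger.
  - exact: integrable_abse ig.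
  - apply: aeW => x n _; rewrite /gn /= lee_fin normrM ler_piMr// indicE.
    by case: (_ \in _); rewrite ?normr1// normr0.
  move=> _ _ /cvg_lim /= H; rewrite -[LHS]H//; apply/cvg_lim => //.
  (* By the tail bound the boundary values at -N and N are at most K / (2 N). *)
  pose K := 2 * (C * (D * normal_peak (Num.sqrt 2 * s))).
  have t_neq0 : Num.sqrt 2 * s != 0 by rewrite mulf_neq0// sqrtr_eq0 -ltNge.
  have bF x n : `|x| = n.+1%:R -> `|f x * p x| <= K / 2 * harmonic n.
    have -> : K / 2 = C * (D * normal_peak (Num.sqrt 2 * s)) by rewrite /K; field.
    move=> xn; rewrite normrM (ger0_norm (p0 x)) -[leRHS]mulrA.
    apply: ler_pM => //; rewrite /harmonic /= ler_pdivlMr// mulrC -xn.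
    apply: (le_trans (hD x)).
    by rewrite ler_pM2l//; exact: normal_pdf_ub.
  under eq_fun => n.
    have -> : (\int[lambda]_x gn n x)%E =
        (f n.+1%:R * p n.+1%:R - f (- n.+1%:R) * p (- n.+1%:R))%:E.
      rewrite EFinB -(@continuous_FTC2 _ g (fun x => f x * p x)).
      + rewrite [RHS]integral_mkcond; apply: eq_integral => x _.
        rewrite /gn patchE indicE; case: ifP => _; rewrite ?mulr1// mulr0//.
      + by rewrite -subr_gt0 opprK addr_gt0.
      + exact: continuous_subspaceT.
      + have cF : continuous (fun x => f x * p x).
          by move=> x; apply: cvgM; [exact: cf|exact: cp].
        split=> [x _||]; first exact: ex_derive.
        * by apply: cvg_at_right_filter; exact: cF.
        * by apply: cvg_at_left_filter; exact: cF.
      + by move=> x _; rewrite derive1E; exact: derive_val.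
    over.
  apply: cvg_EFin; first exact: nearW.
  apply: (@squeeze_cvgr _ _ _ _ (fun n => - (K * harmonic n)) (fun n => K * harmonic n)).
  - apply: nearW => n; rewrite -ler_norml.
    apply: (le_trans (ler_normB _ _)).
    have -> : K * harmonic n = K / 2 * harmonic n + K / 2 * harmonic n by field.
    by apply: lerD; apply: bF; rewrite ?normrN ger0_norm.
  - rewrite -oppr0 -[0](mulr0 K); apply: cvgN; apply: cvgM; first exact: cvg_cst.
    exact: cvg_harmonic.
  - rewrite -[0](mulr0 K); apply: cvgM; first exact: cvg_cst.
    exact: cvg_harmonic.
have : (\int[lambda]_x (g1 x)%:E = \int[lambda]_x (g2 x)%:E)%E.
  have := integralB_EFin measurableT ig1 ig2.
  under [X in X = _ -> _]eq_integral do rewrite -EFinB.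
  rewrite int0 => /esym/eqP.
  have g1fin := integrable_fin_num measurableT ig1.
  have g2fin := integrable_fin_num measurableT ig2.
  by rewrite sube_eq ?add0e ?fin_num_adde_defl// => /eqP.
have m1 : measurable_fun setT (fun x : R => (x * f x)%:E).
  by apply/measurable_EFinP; exact: measurable_funM.
have m2 : measurable_fun setT (fun x : R => (f' x)%:E) by exact/measurable_EFinP.
rewrite (integral_normal_prob m1) (integral_normal_prob m2).
move=> H; rewrite (_ : (\int[lambda]_x ((f' x)%:E * (p x)%:E) = \int[lambda]_x (g1 x)%:E)%E); last first.
  by apply: eq_integral => x _; rewrite -EFinM.
rewrite H -integralZl//; apply: eq_integral => x _.
rewrite -!EFinM /g2; congr EFin; field.
by rewrite s_neq0.
Unshelve. all: by end_near.
Qed.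

End Gaussian.

(** * Expectations, and integration by parts in one coordinate *)

Section Expectation.
Context d (T : measurableType d) (R : realType) (P : probability T R).

Implicit Types f g : T -> R.

(** Integrability and expectation of real-valued functions, as a small calculus
    without extended reals. *)
Definition intg (f : T -> R) := P.-integrable setT (EFin \o f).
Definition Ex (f : T -> R) : R := \int[P]_t f t.

Lemma intg_measurable f : intg f -> measurable_fun setT f.
Proof. by move=> fi; apply/measurable_EFinP; exact: measurable_int fi. Qed.

Lemma intg_eq f g : f =1 g -> intg f -> intg g.
Proof. by move=> /funext ->. Qed.

Lemma Ex_eq f g : f =1 g -> Ex f = Ex g.
Proof. by move=> /funext ->. Qed.

Lemma intgD f g : intg f -> intg g -> intg (fun t => f t + g t).
Proof. by move=> fi gi; apply: eq_integrable (integrableD _ fi gi). Qed.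

Lemma ExD f g : intg f -> intg g -> Ex (fun t => f t + g t) = Ex f + Ex g.
Proof. by move=> fi gi; rewrite /Ex RintegralD. Qed.

Lemma intgZ c f : intg f -> intg (fun t => c * f t).
Proof. by move=> fi; apply: eq_integrable (integrableZl _ c fi). Qed.

Lemma ExZ c f : intg f -> Ex (fun t => c * f t) = c * Ex f.
Proof. by move=> fi; rewrite /Ex RintegralZl. Qed.

Lemma intgB f g : intg f -> intg g -> intg (fun t => f t - g t).
Proof. by move=> fi gi; apply: eq_integrable (integrableB _ fi gi). Qed.

Lemma ExB f g : intg f -> intg g -> Ex (fun t => f t - g t) = Ex f - Ex g.
Proof. by move=> fi gi; rewrite /Ex RintegralB. Qed.

Lemma intg_cst c : intg (fun=> c).
Proof. exact: finite_measure_integrable_cst. Qed.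

Lemma Ex_cst c : Ex (fun=> c) = c.
Proof.
rewrite /Ex Rintegral_cst// (_ : fine _ = 1) ?mulr1//.
have /(congr1 fine) := @probability_setT _ _ _ P; exact.
Qed.

Lemma intg_sum (J : Type) (s : seq J) (f : J -> T -> R) :
  (forall k, intg (f k)) -> intg (fun t => \sum_(k <- s) f k t).
Proof.
move=> fi; elim: s => [|k s IHs].
  by apply: (@intg_eq (fun=> 0)) (intg_cst 0) => t; rewrite big_nil.
by apply: (intg_eq _ (intgD (fi k) IHs)) => t; rewrite big_cons.
Qed.

Lemma Ex_sum (J : Type) (s : seq J) (f : J -> T -> R) :
  (forall k, intg (f k)) ->
  Ex (fun t => \sum_(k <- s) f k t) = \sum_(k <- s) Ex (f k).
Proof.
move=> fi; elim: s => [|k s IHs].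
  by rewrite big_nil -[RHS](Ex_cst 0); apply: Ex_eq => t; rewrite big_nil.
rewrite big_cons -IHs -ExD//; last exact: intg_sum.
by apply: Ex_eq => t; rewrite big_cons.
Qed.

Lemma intg_le f g : measurable_fun setT f -> (forall t, `|f t| <= `|g t|) ->
  intg g -> intg f.
Proof.
move=> mf fg ig; apply: (@le_integrable _ _ _ P setT measurableT _ (EFin \o g)) => //.
- exact/measurable_EFinP.
- by move=> t _; rewrite /= lee_fin.
Qed.

Lemma intg_boundedM f g C : measurable_fun setT f ->
  (forall t, `|f t| <= C) -> intg g -> intg (fun t => f t * g t).
Proof.
move=> mf bf ig; apply: (@intg_le _ (fun t => C * g t)); last exact: intgZ.
- by apply: measurable_funM => //; exact: intg_measurable.
- move=> t; rewrite !normrM ler_wpM2r// (le_trans (bf t))//.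
  by rewrite ler_norm.
Qed.

Lemma le_Ex f g : intg f -> intg g -> (forall t, f t <= g t) -> Ex f <= Ex g.
Proof. by move=> fi gi fg; apply: le_Rintegral. Qed.

Lemma intg_norm f : intg f -> intg (fun t => `|f t|).
Proof. exact: integrable_norm. Qed.

End Expectation.

Section SteinConf.
Context (R : realType) (I : choiceType) (s : R).
Hypothesis s_gt0 : 0 < s.
Notation gauss := (normal_prob 0 s : probability (measurableTypeR R) R).
Variable mu : probability (conf R I) R.
Hypothesis mu_iid : iid_law gauss mu.

Lemma integrable_normal_bounded (f : R -> R) C : measurable_fun setT f ->
  (forall x, `|f x| <= C) -> gauss.-integrable setT (fun x => (f x)%:E).
Proof.
move=> mf bf; have C0 : 0 <= C by exact: le_trans (bf 0).
apply: (@le_integrable _ _ _ gauss setT measurableT _ (fun=> C%:E)) => //.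
- exact/measurable_EFinP.
- by move=> x _; rewrite /= lee_fin (ger0_norm C0).
- exact: finite_measure_integrable_cst.
Qed.

Lemma integrable_normal_id_bounded (f : R -> R) C : measurable_fun setT f ->
  (forall x, `|f x| <= C) -> gauss.-integrable setT (fun x => (x * f x)%:E).
Proof.
move=> mf bf; have C0 : 0 <= C by exact: le_trans (bf 0).
apply: (@le_integrable _ _ _ gauss setT measurableT _
  (fun x => C%:E * x%:E)%E) => //.
- by apply/measurable_EFinP; exact: measurable_funM.
- move=> x _; rewrite -EFinM /= lee_fin !normrM (ger0_norm C0) mulrC.
  by rewrite ler_wpM2r.
- by apply: integrableZl => //; exact: integrable_normal_id.
Qed.

(** As [h] ignores the coordinate [a], resampling [a] factorizes the integral of
    the absolute value. *)
Lemma integrable_coordM (a : I) (h : conf R I -> R) :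
  mu.-integrable setT (EFin \o h) -> (forall xi x, h (upd xi a x) = h xi) ->
  mu.-integrable setT (fun xi => (xi a * h xi)%:E).
Proof.
move=> ih inv; have mh := measurable_int _ ih.
have mEh : measurable_fun setT h by exact/measurable_EFinP.
have mf : measurable_fun setT (fun xi : conf R I => (xi a * h xi)%:E).
  by apply/measurable_EFinP/measurable_funM => //; exact: measurable_coord.
apply/integrableP; split => //.
rewrite (ge0_integral_resample a mu_iid)//; last exact: measurableT_comp.
under eq_integral => xi _.
  under eq_integral => x _ do rewrite upd_same inv EFinM abseM.
  rewrite ge0_integralZr//; last exact/measurableT_comp/measurable_EFinP.
  over.
have /integrableP[_ id_fin] := integrable_normal_id s_gt0.
have id_ge0 : (0 <= \int[gauss]_x `|x%:E|)%E by exact: integral_ge0.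
rewrite ge0_integralZl//; last exact: measurableT_comp.
rewrite lte_mul_pinfty//; first by rewrite ge0_fin_numE.
by case/integrableP: ih.
Qed.

(** Resampling [a] reduces this to one Gaussian variable.  The weight [h] later
    carries the randomness of earlier iterations and of the other workers. *)
Lemma stein_conf (a : I) (F F' h : conf R I -> R) (C : R) :
  measurable_fun setT F -> measurable_fun setT F' ->
  mu.-integrable setT (EFin \o h) -> (forall xi x, h (upd xi a x) = h xi) ->
  (forall xi (x : R),
     is_derive x 1 (fun y => F (upd xi a y)) (F' (upd xi a x))) ->
  (forall xi, continuous (fun x => F' (upd xi a x))) ->
  (forall xi, `|F xi| <= C) -> (forall xi, `|F' xi| <= C) ->
  mu.-integrable setT (fun xi => (xi a * F xi * h xi)%:E) /\
  \int[mu]_xi (xi a * F xi * h xi) = s ^+ 2 * \int[mu]_xi (F' xi * h xi).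
Proof.
move=> mF mF' ih inv dF cF' bF bF'.
have iF'h : mu.-integrable setT (fun xi => (F' xi * h xi)%:E).
  exact: intg_boundedM mF' bF' ih.
have ixFh : mu.-integrable setT (fun xi => (xi a * F xi * h xi)%:E).
  have -> : (fun xi : conf R I => (xi a * F xi * h xi)%:E) =
    (fun xi => (F xi * (xi a * h xi))%:E).
    by apply/funext => xi; rewrite mulrCA mulrA.
  exact: intg_boundedM mF bF (integrable_coordM ih inv).
split=> //; rewrite /Rintegral.
have fin1 := integrable_fin_num measurableT iF'h.
apply: (@EFin_inj R); rewrite EFinM !fineK ?integrable_fin_num//.
rewrite -(integralZl measurableT iF'h).
have isF'h := integrableZl measurableT (s ^+ 2) iF'h.
rewrite (integral_resample a mu_iid ixFh) (integral_resample a mu_iid isF'h).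
have mupd xi : measurable_fun setT (upd xi a : R -> conf R I).
  by apply: measurable_to_conf => i; rewrite /upd; case: eqP.
apply: eq_integral => xi _.
have iF' : gauss.-integrable setT (fun x => (F' (upd xi a x))%:E).
  apply: (integrable_normal_bounded (f := F' \o upd xi a) (C := C)).
    exact: measurableT_comp.
  by move=> x /=.
have iF : gauss.-integrable setT (fun x => (x * F (upd xi a x))%:E).
  apply: (integrable_normal_id_bounded (f := F \o upd xi a) (C := C)).
    exact: measurableT_comp.
  by move=> x /=.
under eq_integral => x _ do rewrite upd_same inv EFinM.
under [in RHS]eq_integral => x _ do rewrite inv [X in (_ * X)%E]EFinM muleA.
rewrite (integralZr measurableT iF) integralZr//; last exact: integrableZl.
congr (_ * _)%E; rewrite integralZl//.
exact: (normal_stein s_gt0 (dF xi) (cF' xi) (fun x => bF _) (fun x => bF' _)).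
Qed.

End SteinConf.

(** * Gram matrices and their regularized inverses *)

Section Gram.
Context (R : realType).

Lemma gram_diag m d (X : 'M[R]_(m, d)) b :
  (X^T *m X) b b = \sum_i X i b ^+ 2.
Proof. by rewrite mxE; apply: eq_bigr => i _; rewrite mxE expr2. Qed.

Lemma gram_diag_ge0 m d (X : 'M[R]_(m, d)) b : 0 <= (X^T *m X) b b.
Proof. by rewrite gram_diag sumr_ge0// => i _; rewrite sqr_ge0. Qed.

Lemma gram_entry_le m d (X : 'M[R]_(m, d)) i b : X i b ^+ 2 <= (X^T *m X) b b.
Proof.
rewrite gram_diag (bigD1 i)//= lerDl sumr_ge0// => j _; exact: sqr_ge0.
Qed.

Lemma gram_tr_ge0 m d (X : 'M[R]_(m, d)) : 0 <= \tr (X^T *m X).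
Proof. by rewrite sumr_ge0// => b _; exact: gram_diag_ge0. Qed.

Lemma gram_eq0 m d (X : 'M[R]_(m, d)) : X^T *m X = 0 -> X = 0.
Proof.
move=> X0; apply/matrixP => i b; rewrite mxE.
have := gram_entry_le X i b; rewrite X0 mxE.
by rewrite le_eqVlt ltNge sqr_ge0 orbF sqrf_eq0 => /eqP.
Qed.

Lemma unitmx_inj d (X : 'M[R]_d) :
  (forall u : 'rV_d, u *m X = 0 -> u = 0) -> X \in unitmx.
Proof.
move=> inj; rewrite -row_free_unit -kermx_eq0; apply/rowV0P => v.
by move/sub_kermxP; exact: inj.
Qed.

Lemma unitmxN d (X : 'M[R]_d) : X \notin unitmx ->
  exists2 u : 'rV_d, u != 0 & u *m X = 0.
Proof.
rewrite -row_free_unit -kermx_eq0 => /rowV0Pn[v].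
by move/sub_kermxP => vX v0; exists v.
Qed.

Context (m d : nat).
Implicit Types (G : 'M[R]_(m, d)) (lam : R).

(** For [lam > 0] this is a bounded smooth function of [G], to which integration
    by parts applies, whereas the inverse of the Gram matrix itself is unbounded
    near rank-deficient [G]. *)
Definition reg lam G : 'M[R]_d := invmx (G^T *m G + lam%:M).

Section Regularized.
Variables (lam : R) (G : 'M[R]_(m, d)).
Hypothesis lam_gt0 : 0 < lam.
Let V := reg lam G.

Lemma reg_unit : G^T *m G + lam%:M \in unitmx.
Proof.
apply: unitmx_inj => u uX.
have : u *m (G^T *m G + lam%:M) *m u^T = 0 by rewrite uX mul0mx.
rewrite mulmxDr mulmxDl mul_mx_scalar -scalemxAl => /matrixP/(_ 0 0).
have -> : u *m (G^T *m G) *m u^T = (G *m u^T)^T *m (G *m u^T).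
  by rewrite trmx_mul trmxK !mulmxA.
have uuE : u *m u^T = u^T^T *m u^T by rewrite trmxK.
rewrite [LHS]mxE [X in _ + X]mxE [RHS]mxE => /eqP.
have lam0 := ltW lam_gt0.
rewrite paddr_eq0; last 2 first.
- exact: gram_diag_ge0.
- by rewrite mulr_ge0// uuE gram_diag_ge0.
rewrite mulf_eq0 (gt_eqF lam_gt0)/= => /andP[_ /eqP u0].
apply: trmx_inj; rewrite trmx0; apply: gram_eq0.
by apply/matrixP => i j; rewrite !ord1 trmxK u0 mxE.
Qed.

Lemma reg_sym : V^T = V.
Proof.
by rewrite /V /reg trmx_inv linearD /= trmx_mul trmxK tr_scalar_mx.
Qed.

(** W V = 1 - lam V for W = G^T G and V = (W + lam)^-1. *)
Lemma reg_resolvent : G^T *m (G *m V) = 1%:M - lam *: V.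
Proof.
apply/eqP; rewrite -subr_eq opprK mulmxA -mul_scalar_mx -mulmxDl.
by rewrite mulmxV// reg_unit.
Qed.

Lemma reg_resolvent' : (G *m V)^T *m G = 1%:M - lam *: V.
Proof.
rewrite -[LHS]trmxK trmx_mul trmxK reg_resolvent linearB linearZ /=.
by rewrite trmx1 reg_sym.
Qed.

Lemma reg_quad : V = (G *m V)^T *m (G *m V) + lam *: (V^T *m V).
Proof.
rewrite mulmxA reg_resolvent' mulmxBl mul1mx reg_sym -scalemxAl.
by rewrite subrK.
Qed.

Lemma reg_diagE b :
  V b b = ((G *m V)^T *m (G *m V)) b b + lam * (V^T *m V) b b.
Proof. by rewrite {1}reg_quad mxE [X in _ + X]mxE. Qed.

(** On the diagonal this gives H^T H <= H, which bounds the entries of H. *)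
Lemma hat_quad : let H := G *m V *m G^T in
  H = H^T *m H + lam *: ((G *m V) *m (G *m V)^T).
Proof.
move=> /=.
have -> : (G *m V *m G^T)^T = G *m V *m G^T.
  by rewrite !trmx_mul trmxK reg_sym mulmxA.
have -> : G *m V *m G^T *m (G *m V *m G^T) =
    G *m V *m (G^T *m (G *m V)) *m G^T by rewrite !mulmxA.
rewrite reg_resolvent mulmxBr mulmxBl mulmx1 trmx_mul reg_sym.
by rewrite -scalemxAr -scalemxAl !mulmxA subrK.
Qed.

(** As M_bb^2 <= (M^T M)_bb, the hypothesis yields M_bb <= 1/c; then
    M_ab^2 <= (M^T M)_bb <= M_bb / c bounds the column b. *)
Lemma sym_entry_bound k (M : 'M[R]_k) c : 0 < c ->
  (forall b, c * (M^T *m M) b b <= M b b) -> forall a b, `|M a b| <= c^-1.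
Proof.
move=> c0 hM a b.
have Mb : M b b <= c^-1.
  have := le_trans (ler_wpM2l (ltW c0) (gram_entry_le M b b)) (hM b).
  have [h|h] := leP (M b b) 0; first by move=> _; rewrite (le_trans h)// invr_ge0 ltW.
  by rewrite expr2 mulrA ger_pMl// mulrC => ?; rewrite -[c^-1]mul1r ler_pdivlMr.
have h := le_trans (le_trans (ler_wpM2l (ltW c0) (gram_entry_le M a b)) (hM b)) Mb.
rewrite -[M a b ^+ 2]real_normK ?num_real// in h.
have r0 : 0 < c^-1 by rewrite invr_gt0.
have cr : c * c^-1 = 1 by rewrite divff ?gt_eqF.
set y := `|M a b| in h *; set r := c^-1 in h r0 cr *.
rewrite leNgt; apply/negP => ry.
have : c * r ^+ 2 < c * y ^+ 2 by rewrite ltr_pM2l// ltr_pXn2r ?nnegrE ?ltW// (lt_trans r0).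
by rewrite ltNge (le_trans h)// expr2 mulrA cr mul1r.
Qed.

Lemma reg_bound a b : `|V a b| <= lam^-1.
Proof.
apply: sym_entry_bound => // c; rewrite reg_diagE lerDr.
exact: gram_diag_ge0.
Qed.

Lemma reg_diag_ge0 b : 0 <= V b b.
Proof.
rewrite reg_diagE addr_ge0 ?mulr_ge0 ?gram_diag_ge0//.
exact: (ltW lam_gt0).
Qed.

Lemma regP_bound i b : `|(G *m V) i b| <= 1 + lam^-1.
Proof.
set P := G *m V.
have h1 : P i b ^+ 2 <= lam^-1.
  apply: (le_trans (gram_entry_le _ _ _)).
  apply: le_trans (le_trans (ler_norm _) (reg_bound b b)).
  rewrite reg_diagE -/P lerDl.
  by rewrite mulr_ge0 ?gram_diag_ge0// (ltW lam_gt0).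
rewrite -[P i b ^+ 2]real_normK ?num_real// in h1.
by have := normr_ge0 (P i b); nra.
Qed.

Lemma hat_bound i j : `|(G *m V *m G^T) i j| <= 1.
Proof.
rewrite -invr1; apply: sym_entry_bound => // c; rewrite mul1r.
have -> : (G *m V *m G^T) c c = ((G *m V *m G^T)^T *m (G *m V *m G^T)) c c +
    lam * ((G *m V) *m (G *m V)^T) c c.
  by rewrite {1}hat_quad mxE [X in _ + X]mxE.
rewrite lerDl mulr_ge0 ?(ltW lam_gt0)//.
by rewrite -[X in X *m _]trmxK gram_diag_ge0.
Qed.

(** A kernel vector u of the Gram matrix is an eigenvector of V with eigenvalue
    1/lam.  In the proof, E is lam V minus the orthogonal projection Q / k on u,
    and tr(E^2) >= 0 is the claim. *)
Lemma reg_singular : G^T *m G \notin unitmx ->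
  1 <= lam ^+ 2 * \tr (V *m V).
Proof.
move=> /unitmxN[u u0 uW].
have uV : lam *: (u *m V) = u.
  have := congr1 (mulmx u) (mulmxV reg_unit).
  rewrite mulmxA mulmxDr uW add0r mul_mx_scalar mulmx1.
  by rewrite -scalemxAl.
have nu : 0 < (u *m u^T) 0 0.
  rewrite -[X in X *m _]trmxK lt_neqAle gram_diag_ge0 andbT eq_sym.
  apply: contra u0 => /eqP h; rewrite -[u]trmxK; apply/eqP/trmx_inj.
  rewrite trmx0 trmxK; apply: gram_eq0.
  by apply/matrixP => i j; rewrite !ord1 h mxE.
set k := (u *m u^T) 0 0 in nu.
have uu : u *m u^T = k%:M by rewrite {1}[u *m u^T]mx11_scalar.
pose Q := u^T *m u.
have uV' : u *m V = lam^-1 *: u by rewrite -[in RHS]uV scalerA mulVf ?scale1r ?gt_eqF.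
have QV : Q *m V = lam^-1 *: Q by rewrite -mulmxA uV' -scalemxAr.
have VQ : V *m Q = lam^-1 *: Q.
  have Qs : Q^T = Q by rewrite trmx_mul trmxK.
  by rewrite -[LHS]trmxK trmx_mul reg_sym Qs QV linearZ /= Qs.
have QQ : Q *m Q = k *: Q.
  by rewrite /Q mulmxA -(mulmxA u^T) uu mul_mx_scalar -scalemxAl.
pose E := lam *: V - k^-1 *: Q.
have Esym : E^T = E.
  by rewrite /E linearB !linearZ /= trmx_mul trmxK reg_sym.
have EE : E *m E = lam ^+ 2 *: (V *m V) - k^-1 *: Q.
  rewrite /E mulmxBl !mulmxBr -!scalemxAl -!scalemxAr QV VQ QQ !scalerA.
  move: (V *m V) (Q) => X Z; apply/matrixP => i j; rewrite !mxE; field.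
  by rewrite !gt_eqF.
have := gram_tr_ge0 E; rewrite Esym EE raddfB /= !mxtraceZ.
have -> : \tr Q = k by rewrite mxtrace_mulC uu mxtrace_scalar mulr1n.
by rewrite mulVf ?gt_eqF// subr_ge0.
Qed.

End Regularized.

(** M = V + lam M V implies V^2 <= M^2 on the diagonal, because the cross term
    V M V is a Gram matrix: M dominates V uniformly in lam. *)
Lemma reg_limit_bound lam G : 0 < lam -> G^T *m G \in unitmx ->
  let M := invmx (G^T *m G) in
  [/\ forall a b, reg lam G a b ^+ 2 <= \tr (M *m M),
      M^T = M & M - reg lam G = lam *: (M *m reg lam G)].
Proof.
move=> lam0 Wu M; set V := reg lam G.
have Msym : M^T = M by rewrite trmx_inv trmx_mul trmxK.
have VM : M - V = lam *: (M *m V).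
  have := congr1 (mulmx M) (reg_resolvent G lam0).
  rewrite (mulmxA G^T) -/V mulKmx// mulmxBr mulmx1 -scalemxAr => {1}->.
  by rewrite opprB addrC subrK.
split=> // a b.
have MM : M = (G *m M)^T *m (G *m M).
  by rewrite trmx_mul Msym !mulmxA -(mulmxA M) mulVmx// mul1mx.
have Vs := reg_sym lam G; rewrite -/V in Vs.
have hb c : (V^T *m V) c c <= (M^T *m M) c c.
  have -> : M^T *m M = V^T *m V + ((2 * lam) *: ((G *m M *m V)^T *m (G *m M *m V))
     + lam ^+ 2 *: ((M *m V)^T *m (M *m V))).
    have ME : M = V + lam *: (M *m V) by rewrite -VM addrC subrK.
    have -> : (G *m M *m V)^T *m (G *m M *m V) = V *m M *m V.
      by rewrite [in RHS]MM !trmx_mul Vs Msym !mulmxA.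
    have -> : M^T *m M = (V + lam *: (M *m V))^T *m (V + lam *: (M *m V)).
      by rewrite -ME.
    have -> : (V + lam *: (M *m V))^T = V + lam *: (V *m M).
      by rewrite linearD linearZ /= trmx_mul Vs Msym.
    rewrite trmx_mul Vs Msym.
    rewrite mulmxDl !mulmxDr -!scalemxAl -!scalemxAr !mulmxA scalerA -expr2.
    by rewrite mulrDl mul1r scalerDl !addrA.
  rewrite [leRHS]mxE lerDl mxE [X in X + _]mxE [X in _ + X]mxE.
  by rewrite addr_ge0// mulr_ge0 ?gram_diag_ge0 ?sqr_ge0// mulr_ge0// ltW.
apply: (le_trans (gram_entry_le _ _ _)); apply: (le_trans (hb b)).
have -> : M *m M = M^T *m M by rewrite Msym.
rewrite /mxtrace [leRHS](bigD1 b)//= lerDl sumr_ge0// => c _.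
exact: gram_diag_ge0.
Qed.
End Gram.

(** * Measurability and continuity of matrix functions *)

Section MatrixFunctions.
Context (R : realType).

(** Inversion is not continuous at 0; 1/x = x (x^2)^(-1) reduces its
    measurability to that of a power function. *)
Lemma measurable_invr d (T : measurableType d) (f : T -> R) :
  measurable_fun setT f -> measurable_fun setT (fun t => (f t)^-1).
Proof.
move=> mf.
have -> : (fun t => (f t)^-1) = fun t => f t * (f t ^+ 2) `^ (-1).
  apply/funext => t; rewrite powR_inv1 ?sqr_ge0//.
  have [->|f0] := eqVneq (f t) 0; first by rewrite invr0 mul0r.
  by rewrite expr2 invfM mulrA divff// mul1r.
apply: measurable_funM => //.
have /measurableT_comp := @measurable_powR R (-1); apply.
exact: measurable_funX.
Qed.

Definition mx_measurable d (T : measurableType d) m n (X : T -> 'M[R]_(m, n)) :=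
  forall i j, measurable_fun setT (fun t => X t i j).

Section Measurability.
Context d (T : measurableType d).

Lemma mx_measurable_cst m n (M : 'M[R]_(m, n)) :
  mx_measurable (fun _ : T => M).
Proof. by move=> i j. Qed.

Lemma mx_measurableM m n p (X : T -> 'M[R]_(m, n)) (Y : T -> 'M[R]_(n, p)) :
  mx_measurable X -> mx_measurable Y -> mx_measurable (fun t => X t *m Y t).
Proof.
move=> mX mY i j.
have -> : (fun t => (X t *m Y t) i j) = fun t => \sum_k X t i k * Y t k j.
  by apply/funext => t; rewrite mxE.
by apply: measurable_sum => k; apply: measurable_funM.
Qed.

Lemma mx_measurableD m n (X Y : T -> 'M[R]_(m, n)) :
  mx_measurable X -> mx_measurable Y -> mx_measurable (fun t => X t + Y t).
Proof.
move=> mX mY i j.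
have -> : (fun t => (X t + Y t) i j) = fun t => X t i j + Y t i j.
  by apply/funext => t; rewrite mxE.
exact: measurable_funD.
Qed.

Lemma mx_measurable_tr m n (X : T -> 'M[R]_(m, n)) :
  mx_measurable X -> mx_measurable (fun t => (X t)^T).
Proof.
move=> mX i j.
have -> : (fun t => (X t)^T i j) = fun t => X t j i.
  by apply/funext => t; rewrite mxE.
exact: mX.
Qed.

Lemma mx_measurableZ m n (c : T -> R) (X : T -> 'M[R]_(m, n)) :
  measurable_fun setT c -> mx_measurable X ->
  mx_measurable (fun t => c t *: X t).
Proof.
move=> mc mX i j.
have -> : (fun t => (c t *: X t) i j) = fun t => c t * X t i j.
  by apply/funext => t; rewrite mxE.
exact: measurable_funM.
Qed.

Lemma mx_measurable_sum m n (J : Type) (s : seq J) (X : J -> T -> 'M[R]_(m, n)) :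
  (forall k, mx_measurable (X k)) -> mx_measurable (fun t => \sum_(k <- s) X k t).
Proof.
move=> mX i j.
have -> : (fun t => (\sum_(k <- s) X k t) i j) = fun t => \sum_(k <- s) X k t i j.
  by apply/funext => t; rewrite summxE.
by apply: measurable_sum => k; exact: mX.
Qed.

Lemma mx_measurable_mxtrace n (X : T -> 'M[R]_n) :
  mx_measurable X -> measurable_fun setT (fun t => \tr (X t)).
Proof. by move=> mX; apply: measurable_sum => k; exact: mX. Qed.

Lemma mx_measurable_det n (X : T -> 'M[R]_n) :
  mx_measurable X -> measurable_fun setT (fun t => \det (X t)).
Proof.
move=> mX; rewrite /determinant; apply: measurable_sum => s.
apply: measurable_funM => //; apply: measurable_prod => i _; exact: mX.
Qed.

(** By Cramer's rule where the determinant is nonzero; elsewhere [invmx] is the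
    identity. *)
Lemma mx_measurable_invmx n (X : T -> 'M[R]_n) :
  mx_measurable X -> mx_measurable (fun t => invmx (X t)).
Proof.
move=> mX i j.
have -> : (fun t => invmx (X t) i j) = fun t =>
    if \det (X t) == 0 then X t i j else (\det (X t))^-1 * cofactor (X t) j i.
  apply/funext => t; rewrite /invmx unitmxE unitfE; case: eqP => //= _.
  by rewrite !mxE.
apply: measurable_fun_ifT; last 2 first.
- exact: mX.
- apply: measurable_funM.
    by apply: measurable_invr; exact: mx_measurable_det.
  apply: measurable_funM => //; apply: mx_measurable_det => a b.
  have -> : (fun t => row' j (col' i (X t)) a b) = fun t => X t (lift j a) (lift i b).
    by apply/funext => t; rewrite !mxE.
  exact: mX.
- by apply: measurable_fun_eqr => //; exact: mx_measurable_det.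
Qed.

End Measurability.

Definition mx_continuous m n (X : R -> 'M[R]_(m, n)) :=
  forall i j, continuous (fun x => X x i j).

Section Continuity.

Lemma mx_continuous_cst m n (M : 'M[R]_(m, n)) : mx_continuous (fun=> M).
Proof. by move=> i j x; exact: cvg_cst. Qed.

Lemma continuous_sumr (J : Type) (s : seq J) (f : J -> R -> R) :
  (forall k, continuous (f k)) -> continuous (fun x => \sum_(k <- s) f k x).
Proof.
move=> cf; apply: (@continuous_big _ _ +%R 0 predT) => //.
exact: add_continuous.
Qed.

Lemma continuous_prodr (J : Type) (s : seq J) (f : J -> R -> R) :
  (forall k, continuous (f k)) -> continuous (fun x => \prod_(k <- s) f k x).
Proof.
move=> cf; elim: s => [|k s IHs].
  have -> : (fun x => \prod_(k <- [::]) f k x) = fun=> 1.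
    by apply/funext => x; rewrite big_nil.
  by move=> x; exact: cvg_cst.
have -> : (fun x => \prod_(k <- k :: s) f k x) =
    fun x => f k x * \prod_(k <- s) f k x.
  by apply/funext => x; rewrite big_cons.
by move=> x; apply: cvgM; [exact: cf|exact: IHs].
Qed.

Lemma mx_continuousM m n p (X : R -> 'M[R]_(m, n)) (Y : R -> 'M[R]_(n, p)) :
  mx_continuous X -> mx_continuous Y -> mx_continuous (fun x => X x *m Y x).
Proof.
move=> cX cY i j.
have -> : (fun t => (X t *m Y t) i j) = fun t => \sum_k X t i k * Y t k j.
  by apply/funext => t; rewrite mxE.
apply: continuous_sumr => k x; apply: cvgM; [exact: cX|exact: cY].
Qed.

Lemma mx_continuousD m n (X Y : R -> 'M[R]_(m, n)) :
  mx_continuous X -> mx_continuous Y -> mx_continuous (fun x => X x + Y x).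
Proof.
move=> cX cY i j.
have -> : (fun t => (X t + Y t) i j) = fun t => X t i j + Y t i j.
  by apply/funext => t; rewrite mxE.
move=> x; apply: cvgD; [exact: cX|exact: cY].
Qed.

Lemma mx_continuous_tr m n (X : R -> 'M[R]_(m, n)) :
  mx_continuous X -> mx_continuous (fun t => (X t)^T).
Proof.
move=> cX i j.
have -> : (fun t => (X t)^T i j) = fun t => X t j i.
  by apply/funext => t; rewrite mxE.
exact: cX.
Qed.

Lemma mx_continuousZ m n (c : R -> R) (X : R -> 'M[R]_(m, n)) :
  continuous c -> mx_continuous X -> mx_continuous (fun t => c t *: X t).
Proof.
move=> cc cX i j.
have -> : (fun t => (c t *: X t) i j) = fun t => c t * X t i j.
  by apply/funext => t; rewrite mxE.
move=> x; apply: cvgM; [exact: cc|exact: cX].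
Qed.

Lemma continuous_mxtrace n (X : R -> 'M[R]_n) :
  mx_continuous X -> continuous (fun t => \tr (X t)).
Proof. by move=> cX; apply: continuous_sumr => k; exact: cX. Qed.

Lemma continuous_det n (X : R -> 'M[R]_n) :
  mx_continuous X -> continuous (fun t => \det (X t)).
Proof.
move=> cX; rewrite /determinant; apply: continuous_sumr => s x.
apply: cvgM; first exact: cvg_cst.
by apply: continuous_prodr => i; exact: cX.
Qed.

Lemma mx_continuous_invmx n (X : R -> 'M[R]_n) :
  mx_continuous X -> (forall t, X t \in unitmx) ->
  mx_continuous (fun t => invmx (X t)).
Proof.
move=> cX uX i j.
have -> : (fun t => invmx (X t) i j) = fun t =>
    (\det (X t))^-1 * cofactor (X t) j i.
  by apply/funext => t; rewrite /invmx uX !mxE.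
move=> x; apply: cvgM.
  apply: cvgV; last exact: continuous_det.
  by have := uX x; rewrite unitmxE unitfE.
apply: cvgM; first exact: cvg_cst.
apply: continuous_det => a b.
have -> : (fun t => row' j (col' i (X t)) a b) = fun t => X t (lift j a) (lift i b).
  by apply/funext => t; rewrite !mxE.
exact: cX.
Qed.

End Continuity.
End MatrixFunctions.

(** * Derivatives of matrix functions *)

Section MatrixDerivatives.
Context (R : realType).

Definition mx_derive m n (x : R) (X : R -> 'M[R]_(m, n)) (X' : 'M[R]_(m, n)) :=
  forall i j, is_derive x 1 (fun y => X y i j) (X' i j).

Lemma is_derive_sumr (x : R) n (f : 'I_n -> R -> R) (f' : 'I_n -> R) :
  (forall k, is_derive x 1 (f k) (f' k)) ->
  is_derive x 1 (fun y => \sum_k f k y) (\sum_k f' k).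
Proof.
move=> df.
have -> : (fun y => \sum_k f k y) = \sum_k f k.
  by apply/funext => y; rewrite fct_sumE.
exact: is_derive_sum.
Qed.

Lemma mx_derive_affine m n (x : R) (G D : 'M[R]_(m, n)) :
  mx_derive x (fun y => G + y *: D) D.
Proof.
move=> i j.
have -> : (fun y => (G + y *: D) i j) = fun y => G i j + y * D i j.
  by apply/funext => y; rewrite !mxE.
apply: is_derive_eq; rewrite /GRing.scale /=; ring.
Qed.

Lemma mx_deriveM m n p (x : R) (X : R -> 'M[R]_(m, n)) (Y : R -> 'M[R]_(n, p))
    X' Y' : mx_derive x X X' -> mx_derive x Y Y' ->
  mx_derive x (fun y => X y *m Y y) (X' *m Y x + X x *m Y').
Proof.
move=> dX dY i j.
have -> : (fun t => (X t *m Y t) i j) = fun t => \sum_k X t i k * Y t k j.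
  by apply/funext => t; rewrite mxE.
rewrite [X in is_derive _ _ _ X]mxE !mxE -big_split /=.
apply: is_derive_sumr => k.
have dXk := dX i k; have dYk := dY k j.
by apply: is_derive_eq; rewrite /GRing.scale /=; ring.
Qed.

Lemma mx_deriveD m n (x : R) (X Y : R -> 'M[R]_(m, n)) X' Y' :
  mx_derive x X X' -> mx_derive x Y Y' ->
  mx_derive x (fun y => X y + Y y) (X' + Y').
Proof.
move=> dX dY i j.
have -> : (fun t => (X t + Y t) i j) = fun t => X t i j + Y t i j.
  by apply/funext => t; rewrite mxE.
rewrite mxE; have dXk := dX i j; have dYk := dY i j.
exact: is_deriveD.
Qed.

Lemma mx_derive_cst m n (x : R) (M : 'M[R]_(m, n)) : mx_derive x (fun=> M) 0.
Proof. by move=> i j; rewrite mxE; exact: is_derive_cst. Qed.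

Lemma mx_derive_tr m n (x : R) (X : R -> 'M[R]_(m, n)) X' :
  mx_derive x X X' -> mx_derive x (fun y => (X y)^T) X'^T.
Proof.
move=> dX i j; rewrite mxE.
have -> : (fun t => (X t)^T i j) = fun t => X t j i.
  by apply/funext => t; rewrite mxE.
exact: dX.
Qed.

Lemma is_derive_mxtrace n (x : R) (X : R -> 'M[R]_n) X' :
  mx_derive x X X' -> is_derive x 1 (fun y => \tr (X y)) (\tr X').
Proof. by move=> dX; apply: is_derive_sumr => k; exact: dX. Qed.

Lemma mx_deriveZ m n (x : R) (c : R -> R) c' (X : R -> 'M[R]_(m, n)) X' :
  is_derive x 1 c c' -> mx_derive x X X' ->
  mx_derive x (fun y => c y *: X y) (c' *: X x + c x *: X').
Proof.
move=> dc dX i j.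
have -> : (fun t => (c t *: X t) i j) = fun t => c t * X t i j.
  by apply/funext => t; rewrite mxE.
rewrite !mxE; have dXk := dX i j.
by apply: is_derive_eq; rewrite /GRing.scale /=; ring.
Qed.

Lemma is_derive_cvg (f : R -> R) (x l : R) :
  (fun h => h^-1 * (f (h + x) - f x)) @ 0^' --> l -> is_derive x 1 f l.
Proof.
move=> H.
have E : (fun h : R => h^-1 *: ((f \o shift x) (h *: (1 : R)) - f x)) =
   fun h => h^-1 * (f (h + x) - f x).
  by apply/funext => h; rewrite /= /GRing.scale /= mulr1.
apply: DeriveDef.
  by apply/cvg_ex; exists l; rewrite E.
by rewrite /derive E; exact/cvg_lim.
Qed.

Lemma is_derive_quotient (f : R -> R) (x l : R) : is_derive x 1 f l ->
  (fun h => h^-1 * (f (h + x) - f x)) @ 0^' --> l.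
Proof.
move=> [/cvg_ex[k fk] <-].
have E : (fun h : R => h^-1 *: ((f \o shift x) (h *: (1 : R)) - f x)) =
   fun h => h^-1 * (f (h + x) - f x).
  by apply/funext => h; rewrite /= /GRing.scale /= mulr1.
rewrite /derive E; rewrite E in fk.
by move/cvg_lim : (fk) => -> //.
Qed.

Lemma cvg_sumr (J T : Type) (F : set_system T) (s : seq J) (f : J -> T -> R)
    (l : J -> R) : Filter F -> (forall k, f k x @[x --> F] --> l k) ->
  \sum_(k <- s) f k x @[x --> F] --> \sum_(k <- s) l k.
Proof.
move=> FF cf; apply: (@cvg_big _ _ +%R 0 predT) => //.
exact: add_continuous.
Qed.

(** From V(y) - V(x) = - V(y) (X(y) - X(x)) V(x), divided by y - x. *)
Lemma mx_derive_invmx n (x : R) (X : R -> 'M[R]_n) X' :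
  mx_continuous X -> (forall t, X t \in unitmx) -> mx_derive x X X' ->
  mx_derive x (fun y => invmx (X y)) (- (invmx (X x) *m X' *m invmx (X x))).
Proof.
move=> cX uX dX i j; apply: is_derive_cvg.
set V := fun y => invmx (X y).
have cV : mx_continuous V by exact: mx_continuous_invmx.
have -> : (fun h => h^-1 * (V (h + x) i j - V x i j)) = fun h =>
    - \sum_k (\sum_l V (h + x) i l * (h^-1 * (X (h + x) l k - X x l k))) * V x k j.
  apply/funext => h.
  have VE : V (h + x) - V x = - (V (h + x) *m (X (h + x) - X x) *m V x).
    rewrite mulmxBr mulmxBl mulVmx// mul1mx -mulmxA mulmxV// mulmx1.
    by rewrite opprB.
  have -> : V (h + x) i j - V x i j = (V (h + x) - V x) i j by rewrite !mxE.
  rewrite VE mxE mulrN; congr (- _); rewrite mxE mulr_sumr.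
  apply: eq_bigr => k _; rewrite mulrA; congr (_ * _).
  rewrite mxE mulr_sumr; apply: eq_bigr => l _.
  by rewrite mulrCA; congr (_ * (_ * _)); rewrite !mxE.
rewrite mxE; apply: cvgN; rewrite mxE; apply: cvg_sumr => k.
apply: cvgM; last exact: cvg_cst.
rewrite mxE; apply: cvg_sumr => l.
apply: cvgM; last exact: is_derive_quotient (dX l k).
have c : (fun h : R => V (h + x) i l) @ 0 --> V x i l.
  have hx : (fun h : R => h + x) @ 0 --> x.
    by rewrite -[X in _ --> X]add0r; apply: cvgD; [exact: cvg_id|exact: cvg_cst].
  exact: (cvg_comp _ _ hx (cV i l x)).
by move=> A VA; apply: nbhs_dnbhs; exact: c.
Qed.

End MatrixDerivatives.

(** * Integration by parts in a Gaussian matrix *)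

Section MatrixStein.
Context (R : realType) (I : choiceType) (s : R).
Hypothesis s_gt0 : 0 < s.
Variable mu : probability (conf R I) R.
Hypothesis mu_iid :
  iid_law (normal_prob 0 s : probability (measurableTypeR R) R) mu.
Context (m n d : nat) (a : 'I_m -> 'I_n -> I) (U : 'M[R]_(n, d)).
Hypothesis a_inj : forall i j i' j', a i j = a i' j' -> i = i' /\ j = j'.
Hypothesis U_orth : U^T *m U = 1%:M.

(** The sketch stored in the coordinates [a i j] of a family. *)
Definition blk (xi : conf R I) : 'M[R]_(m, n) := \matrix_(i, j) xi (a i j).

Lemma blk_upd xi i j x : blk (upd xi (a i j) x) =
  blk (upd xi (a i j) 0) + x *: delta_mx i j.
Proof.
apply/matrixP => i' j'; rewrite !mxE /upd.
case: eqP => [/a_inj[-> ->]|h]; first by rewrite !eqxx mulr1 add0r.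
case: eqP => [ei|_]; last by rewrite mulr0 addr0.
case: eqP => [ej|_]; last by rewrite mulr0 addr0.
by rewrite ei ej in h.
Qed.

Let G xi := blk xi *m U.

Lemma mx_measurable_blk : mx_measurable blk.
Proof.
move=> i j.
have -> : (fun xi => blk xi i j) = fun xi : conf R I => xi (a i j).
  by apply/funext => xi; rewrite mxE.
exact: measurable_coord.
Qed.

Definition off_block (h : conf R I -> R) :=
  forall i j xi x, h (upd xi (a i j) x) = h xi.

(** The entry (i, j) of the sketch S moves G = S U in the direction delta_ij U,
    and U^T U = 1 recombines these directions into the entries of G:
    delta_ik = sum_j U_jk delta_ij U.  So integration by parts in the entries of
    S sums up to integration by parts in those of G. *)
Lemma mx_stein (F : 'M[R]_(m, d) -> 'M[R]_(m, d))
    (dF : 'M[R]_(m, d) -> 'M[R]_(m, d) -> 'M[R]_(m, d)) (h : conf R I -> R) :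
  mx_measurable (fun xi => F (G xi)) ->
  (forall D, mx_measurable (fun xi => dF (G xi) D)) ->
  (forall X D x, mx_derive x (fun y => F (X + y *: D)) (dF (X + x *: D) D)) ->
  (forall X D, mx_continuous (fun y => dF (X + y *: D) D)) ->
  (exists C, forall X i b, `|F X i b| <= C) ->
  (forall D, exists C, forall X i b, `|dF X D i b| <= C) ->
  (forall X, linear (dF X)) ->
  intg mu h -> off_block h ->
  forall k b,
  intg mu (fun xi => ((G xi)^T *m F (G xi)) k b * h xi) /\
  Ex mu (fun xi => ((G xi)^T *m F (G xi)) k b * h xi) =
  s ^+ 2 * Ex mu (fun xi => (\sum_i dF (G xi) (delta_mx i k) i b) * h xi).
Proof.
move=> mF mdF dFP dFc [C bF] bdF dFlin ih off k b.
pose D i j := delta_mx i j *m U : 'M[R]_(m, d).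
have dFsum X i : dF X (delta_mx i k) = \sum_j U j k *: dF X (D i j).
  have -> : delta_mx i k = \sum_j U j k *: D i j :> 'M[R]_(m, d).
    apply/matrixP => i' c; rewrite summxE mxE.
    have := congr1 (fun M : 'M[R]_d => M k c) U_orth; rewrite !mxE => UU.
    have [ii|ii] := eqVneq i' i; last first.
      rewrite /= big1// => j _; rewrite !mxE big1 ?mulr0// => l _.
      by rewrite mxE (negbTE ii) mul0r.
    rewrite /= eq_sym -UU; apply: eq_bigr => j _.
    rewrite !mxE (bigD1 j)//= mxE ii !eqxx mul1r big1 ?addr0// => l lj.
    by rewrite mxE (negbTE lj) andbF mul0r.
  elim/big_rec2: _ => [|j y1 y2 _ <-].
    have := dFlin X (-1) 0 0; rewrite scaleN1r oppr0 addr0 => /eqP.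
    by rewrite scaleN1r addrC subrr => /eqP.
  exact: dFlin.
have st i j : intg mu (fun xi => xi (a i j) * F (G xi) i b * h xi) /\
    Ex mu (fun xi => xi (a i j) * F (G xi) i b * h xi) =
    s ^+ 2 * Ex mu (fun xi => dF (G xi) (D i j) i b * h xi).
  have [C' bdF'] := bdF (D i j).
  have Gupd xi x : G (upd xi (a i j) x) = G (upd xi (a i j) 0) + x *: D i j.
    by rewrite /G blk_upd mulmxDl -scalemxAl.
  have := stein_conf s_gt0 mu_iid (C := Num.max C C') (mF i b) (mdF (D i j) i b)
    ih (off i j).
  apply.
  - move=> xi x; rewrite Gupd.
    have -> : (fun y => F (G (upd xi (a i j) y)) i b) =
        fun y => F (G (upd xi (a i j) 0) + y *: D i j) i b.
      by apply/funext => y; rewrite Gupd.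
    exact: dFP.
  - move=> xi.
    have -> : (fun y => dF (G (upd xi (a i j) y)) (D i j) i b) =
        fun y => dF (G (upd xi (a i j) 0) + y *: D i j) (D i j) i b.
      by apply/funext => y; rewrite Gupd.
    exact: dFc.
  - by move=> xi; rewrite le_max bF.
  - by move=> xi; rewrite le_max bdF' orbT.
have iD i j : intg mu (fun xi => dF (G xi) (D i j) i b * h xi).
  have [C' bdF'] := bdF (D i j).
  by apply: (intg_boundedM (C := C')) => //; exact: mdF.
have LE xi : ((G xi)^T *m F (G xi)) k b * h xi =
    \sum_i \sum_j U j k * (xi (a i j) * F (G xi) i b * h xi).
  rewrite mxE mulr_suml; apply: eq_bigr => i _.
  rewrite mxE [in LHS]/G mxE !mulr_suml; apply: eq_bigr => j _.
  by rewrite mxE; ring.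
have RE xi : (\sum_i dF (G xi) (delta_mx i k) i b) * h xi =
    \sum_i \sum_j U j k * (dF (G xi) (D i j) i b * h xi).
  rewrite mulr_suml; apply: eq_bigr => i _.
  rewrite dFsum summxE mulr_suml; apply: eq_bigr => j _.
  by rewrite mxE mulrA.
have iL i j : intg mu (fun xi => U j k * (xi (a i j) * F (G xi) i b * h xi)).
  by apply: intgZ; have [] := st i j.
have iR i j : intg mu (fun xi => U j k * (dF (G xi) (D i j) i b * h xi)).
  exact: intgZ.
split.
  apply: (@intg_eq _ _ _ _ _ _ (fun xi => esym (LE xi))).
  by apply: intg_sum => i; exact: intg_sum.
rewrite (Ex_eq _ LE) (Ex_eq _ RE).
rewrite !Ex_sum; [|by move=> i; exact: intg_sum..].
rewrite mulr_sumr; apply: eq_bigr => i _.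
rewrite !Ex_sum// mulr_sumr; apply: eq_bigr => j _.
by have [iS e] := st i j; rewrite !ExZ// e mulrCA.
Qed.

End MatrixStein.

(** * Derivatives and divergences of the regularized inverse *)

Section Bounded.
Context (R : realType) (T : Type).

Definition mx_bounded m n (F : T -> 'M[R]_(m, n)) :=
  exists C, forall t i j, `|F t i j| <= C.

Lemma mx_bounded_ge0 m n (F : T -> 'M[R]_(m, n)) : mx_bounded F ->
  exists2 C, 0 <= C & forall t i j, `|F t i j| <= C.
Proof.
by move=> [C h]; exists `|C| => // t i j; rewrite (le_trans (h t i j))// ler_norm.
Qed.

Lemma mx_bounded_cst m n (M : 'M[R]_(m, n)) : mx_bounded (fun=> M).
Proof.
exists (\sum_i \sum_j `|M i j|) => _ i j.
rewrite (bigD1 i)//= (bigD1 j)//= -addrA lerDl addr_ge0//.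
  by rewrite sumr_ge0.
by rewrite sumr_ge0// => k _; rewrite sumr_ge0.
Qed.

Lemma mx_boundedM m n p (F : T -> 'M[R]_(m, n)) (H : T -> 'M[R]_(n, p)) :
  mx_bounded F -> mx_bounded H -> mx_bounded (fun t => F t *m H t).
Proof.
move=> /mx_bounded_ge0[C C0 bF] /mx_bounded_ge0[D D0 bH].
exists (\sum_(k < n) C * D) => t i j; rewrite mxE.
apply: (le_trans (ler_norm_sum _ _ _)); apply: ler_sum => k _.
by rewrite normrM ler_pM.
Qed.

Lemma mx_boundedD m n (F H : T -> 'M[R]_(m, n)) :
  mx_bounded F -> mx_bounded H -> mx_bounded (fun t => F t + H t).
Proof.
move=> [C bF] [D bH]; exists (C + D) => t i j; rewrite mxE.
by rewrite (le_trans (ler_normD _ _))// lerD.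
Qed.

Lemma mx_boundedN m n (F : T -> 'M[R]_(m, n)) :
  mx_bounded F -> mx_bounded (fun t => - F t).
Proof. by move=> [C bF]; exists C => t i j; rewrite mxE normrN. Qed.

Lemma mx_bounded_tr m n (F : T -> 'M[R]_(m, n)) :
  mx_bounded F -> mx_bounded (fun t => (F t)^T).
Proof. by move=> [C bF]; exists C => t i j; rewrite mxE. Qed.

Lemma mx_bounded_trZ m n p (F : T -> 'M[R]_p) (H : T -> 'M[R]_(m, n)) :
  mx_bounded F -> mx_bounded H -> mx_bounded (fun t => \tr (F t) *: H t).
Proof.
move=> /mx_bounded_ge0[C C0 bF] /mx_bounded_ge0[D D0 bH].
exists ((\sum_(k < p) C) * D) => t i j; rewrite mxE normrM.
apply: ler_pM => //; apply: (le_trans (ler_norm_sum _ _ _)).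
exact: ler_sum.
Qed.

End Bounded.

Lemma mxBE (R : realType) m n (A B : 'M[R]_(m, n)) i j :
  (A - B) i j = A i j - B i j.
Proof. by rewrite !mxE. Qed.

Lemma mxZE (R : realType) m n c (A : 'M[R]_(m, n)) i j :
  (c *: A) i j = c * A i j.
Proof. by rewrite mxE. Qed.

Lemma mxTE (R : realType) m n (A : 'M[R]_(m, n)) i j : A^T i j = A j i.
Proof. by rewrite mxE. Qed.

Section DeltaProducts.
Context (R : realType) (m d : nat).

Lemma mul_delta_entry p q (A : 'M[R]_(p, m)) i k (B : 'M[R]_(d, q)) c b :
  (A *m delta_mx i k *m B) c b = A c i * B k b.
Proof.
rewrite mxE (bigD1 k)//= [X in _ + X]big1 ?addr0; last first.
  move=> l lk; rewrite mxE big1 ?mul0r// => j _.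
  by rewrite mxE (negbTE lk) andbF mulr0.
congr (_ * _); rewrite mxE (bigD1 i)//= mxE !eqxx mulr1 big1 ?addr0// => l li.
by rewrite mxE (negbTE li) mulr0.
Qed.

End DeltaProducts.

Section RegCalculus.
Context (R : realType) (m d : nat) (lam : R).
Hypothesis lam_gt0 : 0 < lam.
Implicit Types X D : 'M[R]_(m, d).

Let V X := reg lam X.
Let P X := X *m reg lam X.
Let H X := X *m reg lam X *m X^T.

(** The derivatives of V and of P = G V in the direction D, with H = G V G^T. *)
Definition dreg X D : 'M[R]_d := - (V X *m D^T *m P X + (P X)^T *m D *m V X).
Definition dregP X D : 'M[R]_(m, d) :=
  D *m V X - P X *m D^T *m P X - H X *m D *m V X.

Section Paths.
Variables (G D : 'M[R]_(m, d)).
Let path y := G + y *: D.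

Lemma mx_continuous_path : mx_continuous path.
Proof.
apply: mx_continuousD; first exact: mx_continuous_cst.
apply: mx_continuousZ; last exact: mx_continuous_cst.
by move=> x; exact: cvg_id.
Qed.

Let cpath := mx_continuous_path.

Lemma mx_continuous_reg : mx_continuous (fun y => V (path y)).
Proof.
apply: mx_continuous_invmx => [|t]; last exact: reg_unit.
apply: mx_continuousD; last exact: mx_continuous_cst.
by apply: mx_continuousM => //; exact: mx_continuous_tr.
Qed.

Let cV := mx_continuous_reg.

Lemma mx_continuous_regP : mx_continuous (fun y => P (path y)).
Proof. exact: mx_continuousM. Qed.

Let cP := mx_continuous_regP.

Lemma mx_continuous_dreg : mx_continuous (fun y => dreg (path y) D).
Proof.
have -> : (fun y => dreg (path y) D) = fun y => (-1) *:
   (V (path y) *m D^T *m P (path y) + (P (path y))^T *m D *m V (path y)).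
  by apply/funext => y; rewrite scaleN1r.
apply: mx_continuousZ; first by move=> x; exact: cvg_cst.
apply: mx_continuousD; apply: mx_continuousM => //; apply: mx_continuousM => //.
- exact: mx_continuous_cst.
- exact: mx_continuous_tr.
- exact: mx_continuous_cst.
Qed.

Lemma mx_continuous_dregP : mx_continuous (fun y => dregP (path y) D).
Proof.
have -> : (fun y => dregP (path y) D) = fun y => D *m V (path y) +
   (-1) *: (P (path y) *m D^T *m P (path y)) + (-1) *: (H (path y) *m D *m V (path y)).
  by apply/funext => y; rewrite !scaleN1r.
have c1 : continuous (fun _ : R => -1 : R) by move=> x; exact: cvg_cst.
apply: mx_continuousD; [apply: mx_continuousD|].
- by apply: mx_continuousM => //; exact: mx_continuous_cst.
- apply: mx_continuousZ => //; apply: mx_continuousM => //.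
  by apply: mx_continuousM => //; exact: mx_continuous_cst.
- apply: mx_continuousZ => //; apply: mx_continuousM => //.
  apply: mx_continuousM; last exact: mx_continuous_cst.
  by apply: mx_continuousM => //; exact: mx_continuous_tr.
Qed.

Lemma mx_derive_reg x : mx_derive x (fun y => V (path y)) (dreg (path x) D).
Proof.
have dpath : mx_derive x path D by exact: mx_derive_affine.
have dW : mx_derive x (fun y => (path y)^T *m path y + lam%:M)
    (D^T *m path x + (path x)^T *m D).
  rewrite -[X in mx_derive _ _ X]addr0.
  apply: mx_deriveD; last exact: mx_derive_cst.
  by apply: mx_deriveM => //; exact: mx_derive_tr.
have -> : dreg (path x) D =
    - (V (path x) *m (D^T *m path x + (path x)^T *m D) *m V (path x)).
  rewrite /dreg mulmxDr mulmxDl /P trmx_mul reg_sym !mulmxA.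
  by [].
apply: mx_derive_invmx => //; last by move=> t; exact: reg_unit.
apply: mx_continuousD; last exact: mx_continuous_cst.
by apply: mx_continuousM => //; exact: mx_continuous_tr.
Qed.

Lemma mx_derive_regP x : mx_derive x (fun y => P (path y)) (dregP (path x) D).
Proof.
have -> : dregP (path x) D = D *m V (path x) + path x *m dreg (path x) D.
  rewrite /dregP /dreg mulmxN mulmxDr opprD addrA /P /H trmx_mul reg_sym !mulmxA.
  by [].
apply: mx_deriveM; last exact: mx_derive_reg.
exact: mx_derive_affine.
Qed.

End Paths.

Lemma dreg_linear X : linear (dreg X).
Proof.
move=> c D D'; rewrite /dreg linearP /= !mulmxDr !mulmxDl.
rewrite -!scalemxAr -!scalemxAl scalerN scalerDr -opprD; congr (- _).
by rewrite addrACA.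
Qed.

Lemma dregP_linear X : linear (dregP X).
Proof.
move=> c D D'; rewrite /dregP linearP /= !mulmxDr !mulmxDl.
rewrite -!scalemxAr -!scalemxAl !scalerDr !scalerN.
by apply/matrixP => i j; rewrite !mxE; ring.
Qed.

Lemma reg_bounded : mx_bounded V.
Proof. by exists lam^-1 => X i j; exact: reg_bound. Qed.

Lemma regP_bounded : mx_bounded P.
Proof. by exists (1 + lam^-1) => X i j; exact: regP_bound. Qed.

Lemma regH_bounded : mx_bounded H.
Proof. by exists 1 => X i j; exact: hat_bound. Qed.

Lemma dreg_bounded D : mx_bounded (fun X => dreg X D).
Proof.
have [bV bP] := (reg_bounded, regP_bounded).
apply: mx_boundedN; apply: mx_boundedD; apply: mx_boundedM => //;
  apply: mx_boundedM => //.
- exact: mx_bounded_cst.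
- exact: mx_bounded_tr.
- exact: mx_bounded_cst.
Qed.

Lemma dregP_bounded D : mx_bounded (fun X => dregP X D).
Proof.
have [[bV bP] bH] := (reg_bounded, regP_bounded, regH_bounded).
apply: mx_boundedD; [apply: mx_boundedD|]; try apply: mx_boundedN;
  apply: mx_boundedM => //; rewrite ?mx_bounded_cst//.
- exact: mx_bounded_cst.
- by apply: mx_boundedM => //; exact: mx_bounded_cst.
- by apply: mx_boundedM => //; exact: mx_bounded_cst.
Qed.

Section Measurable.
Context d0 (T : measurableType d0) (X : T -> 'M[R]_(m, d)).
Hypothesis mX : mx_measurable X.

Lemma mx_measurable_reg : mx_measurable (fun t => V (X t)).
Proof.
apply: mx_measurable_invmx; apply: mx_measurableD.
  by apply: mx_measurableM => //; exact: mx_measurable_tr.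
exact: mx_measurable_cst.
Qed.

Let mV := mx_measurable_reg.

Lemma mx_measurable_regP : mx_measurable (fun t => P (X t)).
Proof. exact: mx_measurableM. Qed.

Let mP := mx_measurable_regP.

Lemma mx_measurable_dreg D : mx_measurable (fun t => dreg (X t) D).
Proof.
have -> : (fun t => dreg (X t) D) = fun t => (-1) *:
   (V (X t) *m D^T *m P (X t) + (P (X t))^T *m D *m V (X t)).
  by apply/funext => y; rewrite scaleN1r.
apply: mx_measurableZ; first exact: measurable_cst.
apply: mx_measurableD; apply: mx_measurableM => //; apply: mx_measurableM => //.
exact: mx_measurable_tr.
Qed.

Lemma mx_measurable_dregP D : mx_measurable (fun t => dregP (X t) D).
Proof.
have -> : (fun t => dregP (X t) D) = fun t => D *m V (X t) +
   (-1) *: (P (X t) *m D^T *m P (X t)) + (-1) *: (H (X t) *m D *m V (X t)).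
  by apply/funext => y; rewrite !scaleN1r.
apply: mx_measurableD; [apply: mx_measurableD|].
- exact: mx_measurableM.
- apply: mx_measurableZ => //; apply: mx_measurableM => //.
  exact: mx_measurableM.
- apply: mx_measurableZ => //; apply: mx_measurableM => //.
  apply: mx_measurableM => //; apply: mx_measurableM => //.
  exact: mx_measurable_tr.
Qed.

End Measurable.

Lemma dregP_delta X i k b : dregP X (delta_mx i k) i b =
  V X k b - P X i k * P X i b - H X i i * V X k b.
Proof.
rewrite /dregP trmx_delta !mxBE !mul_delta_entry -[delta_mx i k]mul1mx.
by rewrite mul_delta_entry mxE eqxx mul1r.
Qed.

Lemma dreg_delta X i k c b : dreg X (delta_mx i k) c b =
  - (V X c k * P X i b + P X i c * V X k b).
Proof.
rewrite /dreg trmx_delta mxE mxE !mul_delta_entry.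
by congr (- (_ + _ * _)); rewrite mxE.
Qed.

Lemma gramPE X : (P X)^T *m P X = V X *m (1%:M - lam *: V X).
Proof. by rewrite trmx_mul reg_sym -mulmxA reg_resolvent. Qed.

Lemma mxtrace_hat X : \tr (H X) = \tr (1%:M - lam *: V X).
Proof. by rewrite /H mxtrace_mulC reg_resolvent. Qed.

Lemma VPT X : V X *m (P X)^T = (P X *m V X)^T.
Proof. by rewrite [RHS]trmx_mul reg_sym. Qed.

(** The divergence sum_i d(G V)_ib / dG_ik, in terms of V. *)
Definition div1 X : 'M[R]_d := let Y := 1%:M - lam *: V X in
  m%:R *: V X - V X *m Y - \tr Y *: V X.

Lemma div_regP X k b : \sum_i dregP X (delta_mx i k) i b = div1 X k b.
Proof.
rewrite /div1 -gramPE -mxtrace_hat.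
under eq_bigr do rewrite dregP_delta.
rewrite !big_split /= sumr_const card_ord !sumrN -mulr_suml.
rewrite !mxBE !mxZE mulr_natl.
by congr (_ - _ - _); rewrite mxE; apply: eq_bigr => i _; rewrite mxTE.
Qed.

(** The divergence of G V^2. *)
Lemma div_regPM X k b :
  \sum_i (dregP X (delta_mx i k) *m V X + P X *m dreg X (delta_mx i k)) i b =
  (div1 X *m V X - V X *m (V X *m (1%:M - lam *: V X))
    - \tr (V X *m (1%:M - lam *: V X)) *: V X) k b.
Proof.
under eq_bigr do rewrite mxE.
rewrite big_split /= !mxBE -addrA; congr (_ + _).
  under eq_bigr do rewrite mxE.
  rewrite exchange_big mxE /=; apply: eq_bigr => c _.
  by rewrite -mulr_suml div_regP.
rewrite -gramPE mxtrace_mulC.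
have dE i : (P X *m dreg X (delta_mx i k)) i b =
   - ((P X *m V X) i k * P X i b) - (P X *m (P X)^T) i i * V X k b.
  rewrite mxE; under eq_bigr do rewrite dreg_delta mulrN mulrDr !mulrA.
  rewrite sumrN big_split /= opprD -!mulr_suml; congr (- (_ * _) - _ * _).
    by rewrite mxE.
  by rewrite mxE; apply: eq_bigr => c _; rewrite mxTE.
under eq_bigr do rewrite dE.
rewrite big_split /= !sumrN -mulr_suml; congr (- _ - _).
  rewrite mulmxA VPT mxE.
  by apply: eq_bigr => i _; rewrite mxTE.
by rewrite mxZE.
Qed.

(** The divergence of tr(V) G V. *)
Lemma div_trZ X k b :
  \sum_i (\tr (dreg X (delta_mx i k)) *: P X
     + \tr (V X) *: dregP X (delta_mx i k)) i b =
  (\tr (V X) *: div1 X - 2 *: (V X *m (V X *m (1%:M - lam *: V X)))) k b.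
Proof.
under eq_bigr do rewrite mxE.
rewrite big_split /= addrC mxBE !mxZE; congr (_ + _).
  rewrite -div_regP mulr_sumr; apply: eq_bigr => i _.
  by rewrite mxZE.
rewrite -gramPE mulmxA VPT mxE mulr_sumr -sumrN.
apply: eq_bigr => i _; rewrite mxZE mxTE.
have -> : \tr (dreg X (delta_mx i k)) = - (2 * (P X *m V X) i k).
  rewrite /mxtrace; under eq_bigr do rewrite dreg_delta.
  rewrite sumrN big_split /= mulr2n mulrDl !mul1r mxE; congr (- (_ + _)).
    by apply: eq_bigr => c _; rewrite mulrC.
  by apply: eq_bigr => c _; rewrite -{1}[V X](reg_sym lam X) mxTE.
by rewrite mulNr mulrA.
Qed.

End RegCalculus.

(** * Moments of the regularized inverse *)

Section InverseWishartIdentities.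
Context (R : realType) (I : choiceType) (s : R).
Hypothesis s_gt0 : 0 < s.
Variable mu : probability (conf R I) R.
Hypothesis mu_iid :
  iid_law (normal_prob 0 s : probability (measurableTypeR R) R) mu.
Context (m n d : nat) (a : 'I_m -> 'I_n -> I) (U : 'M[R]_(n, d)).
Hypothesis a_inj : forall i j i' j', a i j = a i' j' -> i = i' /\ j = j'.
Hypothesis U_orth : U^T *m U = 1%:M.

Let G xi := blk a xi *m U.

Lemma mx_measurable_G : mx_measurable G.
Proof.
by apply: mx_measurableM; [exact: mx_measurable_blk|exact: mx_measurable_cst].
Qed.

Section Identities.
Variable lam : R.
Hypothesis lam_gt0 : 0 < lam.
Let V xi := reg lam (G xi).
Let Y xi : 'M[R]_d := 1%:M - lam *: V xi.
Let VY xi := V xi *m Y xi.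
Let D1 xi := div1 lam (G xi).
Variable h : conf R I -> R.
Hypotheses (ih : intg mu h) (off : off_block a h).

Let mG := mx_measurable_G.
Let mV : mx_measurable V. Proof. exact: mx_measurable_reg. Qed.
Let mP : mx_measurable (fun xi => G xi *m V xi).
Proof. exact: mx_measurable_regP. Qed.

(** Integration by parts with F = G V; the left-hand side comes from
    G^T G V = 1 - lam V = Y. *)
Lemma stein_id1 k b : Ex mu (fun xi => Y xi k b * h xi) =
  s ^+ 2 * Ex mu (fun xi => D1 xi k b * h xi).
Proof.
have [|||||||_ E] := mx_stein s_gt0 mu_iid a_inj U_orth (F := fun X => X *m reg lam X)
  (dF := dregP lam) (h := h) _ _ _ _ _ _ _ ih off k b.
- exact: mP.
- by move=> D; exact: mx_measurable_dregP.
- by move=> X D x; exact: mx_derive_regP.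
- by move=> X D; exact: mx_continuous_dregP.
- exact: regP_bounded.
- by move=> D; exact: dregP_bounded.
- exact: dregP_linear.
move: E; under Ex_eq do rewrite reg_resolvent//.
by under [X in _ = _ * X -> _]Ex_eq do rewrite div_regP//.
Qed.

(** Integration by parts with F = G V^2. *)
Lemma stein_id2 k b : Ex mu (fun xi => (Y xi *m V xi) k b * h xi) =
  s ^+ 2 * Ex mu (fun xi =>
    (D1 xi *m V xi - V xi *m VY xi - \tr (VY xi) *: V xi) k b * h xi).
Proof.
have [|||||||_ E] := mx_stein s_gt0 mu_iid a_inj U_orth
  (F := fun X => X *m reg lam X *m reg lam X)
  (dF := fun X D => dregP lam X D *m reg lam X + X *m reg lam X *m dreg lam X D)
  (h := h) _ _ _ _ _ _ _ ih off k b.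
- exact: mx_measurableM.
- move=> D; apply: mx_measurableD; apply: mx_measurableM => //.
    exact: mx_measurable_dregP.
  exact: mx_measurable_dreg.
- move=> X D x; apply: mx_deriveM; first exact: mx_derive_regP.
  exact: mx_derive_reg.
- move=> X D; apply: mx_continuousD; apply: mx_continuousM.
  + exact: mx_continuous_dregP.
  + exact: mx_continuous_reg.
  + exact: mx_continuous_regP.
  + exact: mx_continuous_dreg.
- by apply: mx_boundedM; [exact: regP_bounded|exact: reg_bounded].
- move=> D; apply: mx_boundedD; apply: mx_boundedM.
  + exact: dregP_bounded.
  + exact: reg_bounded.
  + exact: regP_bounded.
  + exact: dreg_bounded.
- move=> X c D D'; rewrite dregP_linear// dreg_linear// mulmxDl mulmxDr.
  by rewrite -scalemxAl -scalemxAr scalerDr addrACA.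
move: E; under Ex_eq do rewrite mulmxA reg_resolvent//.
by under [X in _ = _ * X -> _]Ex_eq do rewrite div_regPM//.
Qed.

(** Integration by parts with F = tr(V) G V. *)
Lemma stein_id3 k b : Ex mu (fun xi => (\tr (V xi) *: Y xi) k b * h xi) =
  s ^+ 2 * Ex mu (fun xi =>
    (\tr (V xi) *: D1 xi - 2 *: (V xi *m VY xi)) k b * h xi).
Proof.
have [|||||||_ E] := mx_stein s_gt0 mu_iid a_inj U_orth
  (F := fun X => \tr (reg lam X) *: (X *m reg lam X))
  (dF := fun X D => \tr (dreg lam X D) *: (X *m reg lam X)
     + \tr (reg lam X) *: dregP lam X D)
  (h := h) _ _ _ _ _ _ _ ih off k b.
- by apply: mx_measurableZ => //; exact: mx_measurable_mxtrace.
- move=> D; apply: mx_measurableD; apply: mx_measurableZ => //.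
  + by apply: mx_measurable_mxtrace; exact: mx_measurable_dreg.
  + exact: mx_measurable_mxtrace.
  + exact: mx_measurable_dregP.
- move=> X D x; apply: mx_deriveZ; last exact: mx_derive_regP.
  by apply: is_derive_mxtrace; exact: mx_derive_reg.
- move=> X D; apply: mx_continuousD; apply: mx_continuousZ.
  + by apply: continuous_mxtrace; exact: mx_continuous_dreg.
  + exact: mx_continuous_regP.
  + by apply: continuous_mxtrace; exact: mx_continuous_reg.
  + exact: mx_continuous_dregP.
- by apply: mx_bounded_trZ; [exact: reg_bounded|exact: regP_bounded].
- move=> D; apply: mx_boundedD; apply: mx_bounded_trZ.
  + exact: dreg_bounded.
  + exact: regP_bounded.
  + exact: reg_bounded.
  + exact: dregP_bounded.
- move=> X c D D'; rewrite dregP_linear// dreg_linear// mxtraceD mxtraceZ.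
  rewrite scalerDl !scalerDr !scalerA [\tr (reg lam X) * c]mulrC.
  by rewrite addrACA.
move: E; under Ex_eq do rewrite -scalemxAr reg_resolvent//.
by under [X in _ = _ * X -> _]Ex_eq do rewrite div_trZ//.
Qed.

Lemma Ex_mxtrace (F H : conf R I -> 'M[R]_d) c :
  mx_measurable F -> mx_measurable H -> mx_bounded F -> mx_bounded H ->
  (forall k b, Ex mu (fun xi => F xi k b * h xi) =
     c * Ex mu (fun xi => H xi k b * h xi)) ->
  Ex mu (fun xi => \tr (F xi) * h xi) = c * Ex mu (fun xi => \tr (H xi) * h xi).
Proof.
move=> mF mH [C bF] [C' bH] FH.
have iF k : intg mu (fun xi => F xi k k * h xi).
  by apply: (intg_boundedM (C := C)) => //; exact: mF.
have iH k : intg mu (fun xi => H xi k k * h xi).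
  by apply: (intg_boundedM (C := C')) => //; exact: mH.
have E (Q : conf R I -> 'M[R]_d) xi : \tr (Q xi) * h xi = \sum_k Q xi k k * h xi.
  by rewrite /mxtrace mulr_suml.
rewrite (Ex_eq _ (E F)) (Ex_eq _ (E H)) !Ex_sum// mulr_sumr.
by apply: eq_bigr => k _.
Qed.

Lemma mx_bounded_comp (T T' : Type) p q (F : T -> 'M[R]_(p, q)) (X : T' -> T) :
  mx_bounded F -> mx_bounded (fun t => F (X t)).
Proof. by move=> [C bF]; exists C => t. Qed.

Let bV : mx_bounded V.
Proof. by apply: (mx_bounded_comp G); exact: reg_bounded. Qed.

Let mx_measurableN p q (F : conf R I -> 'M[R]_(p, q)) :
  mx_measurable F -> mx_measurable (fun xi => - F xi).
Proof.
move=> mF; have -> : (fun xi => - F xi) = fun xi => (-1) *: F xi.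
  by apply/funext => xi; rewrite scaleN1r.
exact: mx_measurableZ.
Qed.

Let mx_boundedZ p q c (F : conf R I -> 'M[R]_(p, q)) :
  mx_bounded F -> mx_bounded (fun xi => c *: F xi).
Proof.
move=> [C bF]; exists (`|c| * C) => xi i j.
by rewrite mxE normrM ler_wpM2l.
Qed.

Let mY : mx_measurable Y.
Proof.
apply: mx_measurableD; first exact: mx_measurable_cst.
by apply: mx_measurableN; exact: mx_measurableZ.
Qed.

Let bY : mx_bounded Y.
Proof.
apply: mx_boundedD; first exact: mx_bounded_cst.
by apply: mx_boundedN; exact: mx_boundedZ.
Qed.

Let mVY : mx_measurable VY. Proof. exact: mx_measurableM. Qed.
Let bVY : mx_bounded VY. Proof. exact: mx_boundedM. Qed.

Let mD1 : mx_measurable D1.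
Proof.
apply: mx_measurableD; [apply: mx_measurableD|].
- exact: mx_measurableZ.
- exact: mx_measurableN.
- apply: mx_measurableN; apply: mx_measurableZ; last exact: mV.
  exact: (mx_measurable_mxtrace mY).
Qed.

Let bD1 : mx_bounded D1.
Proof.
apply: mx_boundedD; [apply: mx_boundedD|].
- exact: mx_boundedZ.
- exact: mx_boundedN.
- by apply: mx_boundedN; exact: mx_bounded_trZ.
Qed.

Let v xi := \tr (V xi).
Let w xi := \tr (V xi *m V xi).

Lemma reg_cube_ge0 xi : 0 <= \tr (V xi *m V xi *m V xi).
Proof.
have Vs : (V xi)^T = V xi by exact: reg_sym.
rewrite [X in X *m _ *m _](_ : _ = V xi *m 1%:M); last by rewrite mulmx1.
have -> : V xi *m 1%:M *m V xi *m V xi =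
    (G xi *m V xi *m V xi)^T *m (G xi *m V xi *m V xi) +
    lam *: ((V xi *m V xi)^T *m (V xi *m V xi)).
  rewrite mulmx1 [X in _ *m X *m _](reg_quad _ lam_gt0) -/(V xi).
  rewrite mulmxDr mulmxDl -scalemxAr -scalemxAl.
  by rewrite !trmx_mul Vs !mulmxA.
by rewrite mxtraceD mxtraceZ addr_ge0 ?mulr_ge0 ?gram_tr_ge0// ltW.
Qed.

Lemma reg_tr_ge0 xi : 0 <= v xi.
Proof. by rewrite sumr_ge0// => k _; exact: reg_diag_ge0. Qed.

Lemma reg_sq_ge0 xi : 0 <= w xi.
Proof.
have := gram_tr_ge0 (V xi); by rewrite reg_sym.
Qed.

Let trY xi : \tr (Y xi) = d%:R - lam * v xi.
Proof. by rewrite raddfB /= mxtraceZ mxtrace1. Qed.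

Let trVY xi : \tr (VY xi) = v xi - lam * w xi.
Proof. by rewrite /VY /Y mulmxBr mulmx1 raddfB /= -scalemxAr mxtraceZ. Qed.

Let trYV xi : \tr (Y xi *m V xi) = v xi - lam * w xi.
Proof. by rewrite mxtrace_mulC trVY. Qed.

Let trD1 xi : \tr (D1 xi) =
  (m%:R - d%:R - 1) * v xi + lam * (w xi + v xi ^+ 2).
Proof.
rewrite /D1 /div1 -/(V xi) -/(Y xi) -/(VY xi) 2!raddfB /= !mxtraceZ trY trVY.
by rewrite -/(v xi); ring.
Qed.

Let t3 xi := \tr (V xi *m V xi *m V xi).

Let trD1V xi : \tr (D1 xi *m V xi) = (m%:R - d%:R - 1) * w xi +
  lam * (t3 xi + v xi * w xi).
Proof.
rewrite /D1 /div1 -/(V xi) -/(Y xi) !mulmxBl -!scalemxAl 2!raddfB /= !mxtraceZ trY.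
rewrite /Y mulmxBr mulmx1 mulmxBl -scalemxAr -scalemxAl raddfB /= mxtraceZ.
by rewrite -/(w xi) -/(t3 xi); ring.
Qed.

Let trVVY xi : \tr (V xi *m VY xi) = w xi - lam * t3 xi.
Proof.
rewrite /VY /Y mulmxBr mulmx1 mulmxBr raddfB /= -!scalemxAr mxtraceZ.
by rewrite mulmxA.
Qed.

Hypothesis h_ge0 : forall xi, 0 <= h xi.
Hypothesis md : (d + 3 < m)%N.

Let intg_vh : intg mu (fun xi => v xi * h xi).
Proof.
have [C bF] := bV.
apply: (intg_boundedM (C := \sum_(k < d) C)) => //.
  exact: mx_measurable_mxtrace.
move=> xi; apply: (le_trans (ler_norm_sum _ _ _)); exact: ler_sum.
Qed.

Let intg_trM (F : conf R I -> 'M[R]_d) : mx_measurable F -> mx_bounded F ->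
  intg mu (fun xi => \tr (F xi) * h xi).
Proof.
move=> mF [C bF].
apply: (intg_boundedM (C := \sum_(k < d) C)) => //.
  exact: mx_measurable_mxtrace.
move=> xi; apply: (le_trans (ler_norm_sum _ _ _)); exact: ler_sum.
Qed.

Lemma intg_reg_sq : intg mu (fun xi => w xi * h xi).
Proof. by apply: intg_trM; [exact: mx_measurableM|exact: mx_boundedM]. Qed.

Let intg_v2h : intg mu (fun xi => v xi ^+ 2 * h xi).
Proof.
apply: (@intg_eq _ _ _ mu (fun xi => \tr (v xi *: V xi) * h xi)).
  by move=> xi; rewrite mxtraceZ expr2.
apply: intg_trM; last exact: mx_bounded_trZ.
by apply: mx_measurableZ => //; exact: mx_measurable_mxtrace.
Qed.

(** An identity between matrices turns into an inequality between moments, after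
    bounds on the traces of its two sides that drop terms of known sign. *)
Let trace_compare (F H : conf R I -> 'M[R]_d) (g u : conf R I -> R) :
  mx_measurable F -> mx_measurable H -> mx_bounded F -> mx_bounded H ->
  (forall k b, Ex mu (fun xi => F xi k b * h xi) =
     s ^+ 2 * Ex mu (fun xi => H xi k b * h xi)) ->
  (forall xi, g xi <= \tr (H xi)) -> (forall xi, \tr (F xi) <= u xi) ->
  intg mu (fun xi => g xi * h xi) -> intg mu (fun xi => u xi * h xi) ->
  s ^+ 2 * Ex mu (fun xi => g xi * h xi) <= Ex mu (fun xi => u xi * h xi).
Proof.
move=> mF mH bF bH FH gH Fu ig iu; have s20 : 0 <= s ^+ 2 by rewrite sqr_ge0.
apply: (@le_trans _ _ (s ^+ 2 * Ex mu (fun xi => \tr (H xi) * h xi))).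
  rewrite ler_wpM2l//; apply: le_Ex => //; first exact: intg_trM.
  by move=> xi; rewrite ler_wpM2r.
rewrite -(Ex_mxtrace mF mH bF bH FH); apply: le_Ex => //; first exact: intg_trM.
by move=> xi; rewrite ler_wpM2r.
Qed.

(** With p = m - d, the traces of the three identities give linear inequalities
    between c = E[tr(V) h], a2 = E[tr(V^2) h] and b2 = E[tr(V)^2 h]; all terms of
    order lam have the sign that allows dropping them.  Eliminating b2 and then c
    bounds a2 independently of lam, because p > 3. *)
Lemma reg_moment_bound :
  s ^+ 4 * ((m%:R - d%:R) * (m%:R - d%:R - 1) * (m%:R - d%:R - 3)) *
    Ex mu (fun xi => w xi * h xi) <= (m%:R - 1) * d%:R * Ex mu h.
Proof.
set c := Ex mu (fun xi => v xi * h xi).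
set a2 := Ex mu (fun xi => w xi * h xi).
set b2 := Ex mu (fun xi => v xi ^+ 2 * h xi).
have s20 : 0 < s ^+ 2 by rewrite exprn_gt0.
have lam0 := ltW lam_gt0.
have v0 := reg_tr_ge0; have w0 := reg_sq_ge0; have t0 := reg_cube_ge0.
have lv xi : 0 <= lam * v xi by rewrite mulr_ge0.
have lw xi : 0 <= lam * w xi by rewrite mulr_ge0.
have lt xi : 0 <= lam * t3 xi by apply: mulr_ge0 => //; exact: t0.
have vw xi : 0 <= lam * (v xi * w xi) by rewrite !mulr_ge0.
have vv xi : 0 <= lam * (v xi * v xi) by rewrite !mulr_ge0.
have vvv xi : 0 <= lam * (v xi * v xi * v xi) by rewrite !mulr_ge0.
pose p : R := m%:R - d%:R.
have p3 : 3 < p.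
  by rewrite /p ltrBrDl -natrD ltr_nat.
have H1 : s ^+ 2 * ((p - 1) * c) <= d%:R * Ex mu h.
  rewrite -(ExZ (p - 1) intg_vh) -(ExZ d%:R ih).
  under Ex_eq do rewrite mulrA.
  apply: (trace_compare (g := fun xi => (p - 1) * v xi) (u := fun=> d%:R)
    mY mD1 bY bD1 stein_id1).
  - by move=> xi; rewrite trD1 -/p mulrDr expr2; have := vv xi; have := lw xi; lra.
  - by move=> xi; rewrite trY; have := lv xi; lra.
  - by apply: (intg_eq _ (intgZ (p - 1) intg_vh)) => xi; rewrite mulrA.
  - exact: intgZ.
have H2 : s ^+ 2 * ((p - 2) * a2 - b2) <= c.
  rewrite -(ExZ (p - 2) intg_reg_sq) -(ExB (intgZ (p - 2) intg_reg_sq) intg_v2h).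
  under Ex_eq do rewrite mulrA -mulrBl.
  apply: (trace_compare (g := fun xi => (p - 2) * w xi - v xi ^+ 2) (u := v)
    _ _ _ _ stein_id2).
  - exact: mx_measurableM.
  - apply: mx_measurableD; last first.
      apply: mx_measurableN; apply: mx_measurableZ; last exact: mV.
      exact: (mx_measurable_mxtrace mVY).
    apply: mx_measurableD; first exact: mx_measurableM.
    by apply: mx_measurableN; exact: mx_measurableM.
  - exact: mx_boundedM.
  - apply: mx_boundedD; last by apply: mx_boundedN; exact: mx_bounded_trZ.
    apply: mx_boundedD; first exact: mx_boundedM.
    by apply: mx_boundedN; exact: mx_boundedM.
  - move=> xi; rewrite 2!raddfB /= mxtraceZ trD1V trVVY trVY -/(v xi).
    by have := vw xi; have := lt xi; rewrite /p; nra.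
  - by move=> xi; rewrite trYV; have := lw xi; lra.
  - apply: (intg_eq _ (intgB (intgZ (p - 2) intg_reg_sq) intg_v2h)) => xi.
    by rewrite mulrA -mulrBl.
  - by [].
have H3 : s ^+ 2 * ((p - 1) * b2 - 2 * a2) <= d%:R * c.
  rewrite -(ExZ (p - 1) intg_v2h) -(ExZ 2 intg_reg_sq) -(ExZ d%:R intg_vh).
  rewrite -(ExB (intgZ (p - 1) intg_v2h) (intgZ 2 intg_reg_sq)).
  rewrite (Ex_eq _ (g := fun xi => ((p - 1) * v xi ^+ 2 - 2 * w xi) * h xi)); last first.
    by move=> xi; ring.
  rewrite [leRHS](Ex_eq _ (g := fun xi => d%:R * v xi * h xi)); last first.
    by move=> xi; rewrite mulrA.
  apply: (trace_compare (g := fun xi => (p - 1) * v xi ^+ 2 - 2 * w xi)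
    (u := fun xi => d%:R * v xi) _ _ _ _ stein_id3).
  - by apply: mx_measurableZ => //; exact: mx_measurable_mxtrace.
  - apply: mx_measurableD.
      by apply: mx_measurableZ => //; exact: mx_measurable_mxtrace.
    by apply: mx_measurableN; apply: mx_measurableZ => //; exact: mx_measurableM.
  - exact: mx_bounded_trZ.
  - apply: mx_boundedD; first exact: mx_bounded_trZ.
    by apply: mx_boundedN; apply: mx_boundedZ; exact: mx_boundedM.
  - move=> xi; rewrite raddfB /= !mxtraceZ trD1 trVVY -/(v xi).
    by have := vw xi; have := lt xi; have := vvv xi; rewrite /p; nra.
  - by move=> xi; rewrite mxtraceZ trY -/(v xi); have := vv xi; nra.
  - apply: (intg_eq _ (intgB (intgZ (p - 1) intg_v2h) (intgZ 2 intg_reg_sq))) => xi.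
    by rewrite !mulrA -mulrBl.
  - by apply: (intg_eq _ (intgZ d%:R intg_vh)) => xi; rewrite mulrA.
have p0 : 0 < p - 1 by lra.
(* (p - 1) times H2, plus H3, eliminates b2; d + p - 1 = m - 1. *)
have H4 : s ^+ 2 * (p * (p - 3)) * a2 <= (m%:R - 1) * c.
  have := ler_wpM2l (ltW p0) H2.
  by rewrite /p in H3 *; nra.
have H5 := ler_wpM2l (ltW (mulr_gt0 s20 p0)) H4.
have m1 : 0 <= m%:R - 1 :> R by rewrite subr_ge0 ler1n (leq_ltn_trans _ md).
have H6 := ler_wpM2l m1 H1.
rewrite -/p (_ : s ^+ 4 = s ^+ 2 * s ^+ 2); last by ring.
apply: le_trans (_ : (m%:R - 1) * (s ^+ 2 * ((p - 1) * c)) <= _); last first.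
  by rewrite -mulrA.
apply: le_trans (le_trans _ H5) _; last by rewrite le_eqVlt; apply/orP; left; apply/eqP; ring.
by rewrite le_eqVlt; apply/orP; left; apply/eqP; ring.
Qed.

End Identities.
End InverseWishartIdentities.

(** * Moments of the inverse Gram matrix *)

Section Limits.
Context d (T : measurableType d) (R : realType) (P : probability T R).
Implicit Types f g : T -> R.

(** By Fatou's lemma the expectation of the limit is at most [K]. *)
Lemma intg_fatou (f : nat -> T -> R) g K :
  (forall k t, 0 <= f k t) -> (forall k, intg P (f k)) ->
  (forall k, Ex P (f k) <= K) ->
  measurable_fun setT g -> (forall t, 0 <= g t) ->
  {ae P, forall t, f ^~ t @ \oo --> g t} -> intg P g.
Proof.
move=> f0 fi fK mg g0 fg.
apply/integrableP; split; first exact/measurable_EFinP.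
have mf k : measurable_fun setT (fun t => (f k t)%:E).
  exact/measurable_EFinP/(intg_measurable (fi k)).
have := @fatou _ _ _ P setT measurableT (fun k t => (f k t)%:E) mf
  (fun k t _ => f0 k t).
have -> : (\int[P]_t limn_einf (fun k => (f k t)%:E) = \int[P]_t `|(EFin \o g) t|)%E.
  apply: ae_eq_integral => //.
  - rewrite [X in measurable_fun _ X](_ : _ = fun t =>
        - limn_esup (fun k => (- (f k t)%:E)%E))%E; last first.
      apply/funext => t; rewrite -limn_einfN; congr (limn_einf _).
      by apply/funext => k; rewrite /= ?oppeK ?opprK.
    apply: measurableT_comp => //; apply: measurable_fun_limn_esup => k.
    exact: measurableT_comp.
  - by apply: measurableT_comp => //; exact/measurable_EFinP.
  - apply: filterS fg => t fgt _ /=.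
    have c : (fun k => (f k t)%:E) @ \oo --> (g t)%:E.
      by apply: cvg_EFin; [exact: nearW|exact: fgt].
    have [-> _] := cvg_limn_einf_sup c.
    by rewrite ger0_norm.
move=> h; apply: (le_lt_trans h).
rewrite limn_einf_lim.
apply: (@le_lt_trans _ _ K%:E); last exact: ltry.
apply: lime_le; first exact: is_cvg_einfs.
apply: nearW => k; apply: (@le_trans _ _ (\int[P]_t (f k t)%:E)%E).
  by apply: ereal_inf_lbound; exists k => /=.
rewrite -[leLHS]fineK; last exact: integrable_fin_num (fi k).
by rewrite lee_fin; exact: fK.
Qed.

Lemma Ex_dct (f : nat -> T -> R) g D :
  (forall k, measurable_fun setT (f k)) -> measurable_fun setT g ->
  {ae P, forall t, f ^~ t @ \oo --> g t} -> intg P D ->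
  {ae P, forall t, forall k, `|f k t| <= D t} ->
  intg P g /\ Ex P (f k) @[k --> \oo] --> Ex P g.
Proof.
move=> mf mg fg iD fD.
have [|||||ig _ c] := @dominated_convergence _ _ _ P setT measurableT
  (fun k t => (f k t)%:E) (EFin \o g) (EFin \o D).
- by move=> k; exact/measurable_EFinP.
- exact/measurable_EFinP.
- by apply: filterS fg => t fgt _; apply: cvg_EFin; [exact: nearW|exact: fgt].
- exact: iD.
- by apply: filterS fD => t fDt k _; rewrite /= lee_fin.
split=> //; apply: fine_cvg; rewrite fineK; last exact: integrable_fin_num ig.
exact: c.
Qed.

End Limits.

Section InverseMoments.
Context (R : realType) (I : choiceType) (s : R).
Hypothesis s_gt0 : 0 < s.
Variable mu : probability (conf R I) R.
Hypothesis mu_iid :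
  iid_law (normal_prob 0 s : probability (measurableTypeR R) R) mu.
Context (m n d : nat) (a : 'I_m -> 'I_n -> I) (U : 'M[R]_(n, d)).
Hypothesis a_inj : forall i j i' j', a i j = a i' j' -> i = i' /\ j = j'.
Hypothesis U_orth : U^T *m U = 1%:M.
Hypothesis md : (d + 3 < m)%N.

Let G xi := blk a xi *m U.
Let mG : mx_measurable G. Proof. exact: mx_measurable_G. Qed.

Let Winv (X : 'M[R]_(m, d)) := invmx (X^T *m X).
(** The Frobenius norm of the inverse Gram matrix dominates the entries of V. *)
Let r (X : 'M[R]_(m, d)) := Num.sqrt (\tr ((Winv X)^T *m Winv X)).

Let r_ge0 X : 0 <= r X. Proof. exact: sqrtr_ge0. Qed.

Let r_sq X : r X ^+ 2 = \tr ((Winv X)^T *m Winv X).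
Proof. by rewrite sqr_sqrtr// gram_tr_ge0. Qed.

(** Matrix functions assembled from V at lam = |t|, with a degree j of domination
    by the inverse Gram matrix.  For G of full rank, the absolute value makes
    t = 0 an interior point at which V is continuous in t, with the inverse Gram
    matrix as its value. *)
Definition tame p q (j : nat) (F : R -> 'M[R]_(m, d) -> 'M[R]_(p, q)) :=
  [/\ forall t, mx_measurable (fun xi => F t (G xi)),
      forall X, X^T *m X \in unitmx -> mx_continuous (fun t => F t X) &
      exists2 C, 0 <= C & forall t X i k, t != 0 -> X^T *m X \in unitmx ->
        `|F t X i k| <= C * r X ^+ j].

Lemma tameM p q l j1 j2 (F : R -> 'M[R]_(m, d) -> 'M[R]_(p, q))
    (H : R -> 'M[R]_(m, d) -> 'M[R]_(q, l)) :
  tame j1 F -> tame j2 H -> tame (j1 + j2) (fun t X => F t X *m H t X).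
Proof.
move=> [mF cF [C C0 bF]] [mH cH [D D0 bH]]; split.
- by move=> t; exact: mx_measurableM.
- by move=> X uX; apply: mx_continuousM; [exact: cF|exact: cH].
- exists (\sum_(k < q) C * D); first by rewrite sumr_ge0// => k _; rewrite mulr_ge0.
  move=> t X i k t0 uX; rewrite mxE (le_trans (ler_norm_sum _ _ _))// mulr_suml.
  apply: ler_sum => l' _; rewrite normrM exprD mulrACA.
  by apply: ler_pM => //; [exact: bF|exact: bH].
Qed.

Lemma tameD p q j (F H : R -> 'M[R]_(m, d) -> 'M[R]_(p, q)) :
  tame j F -> tame j H -> tame j (fun t X => F t X + H t X).
Proof.
move=> [mF cF [C C0 bF]] [mH cH [D D0 bH]]; split.
- by move=> t; exact: mx_measurableD.
- by move=> X uX; apply: mx_continuousD; [exact: cF|exact: cH].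
- exists (C + D); first exact: addr_ge0.
  move=> t X i k t0 uX; rewrite mxE (le_trans (ler_normD _ _))// mulrDl.
  by apply: lerD; [exact: bF|exact: bH].
Qed.

Lemma tameZ p q j c (F : R -> 'M[R]_(m, d) -> 'M[R]_(p, q)) :
  tame j F -> tame j (fun t X => c *: F t X).
Proof.
move=> [mF cF [C C0 bF]]; split.
- by move=> t; exact: mx_measurableZ.
- move=> X uX; apply: mx_continuousZ; last exact: cF.
  by move=> x; exact: cvg_cst.
- exists (`|c| * C); first exact: mulr_ge0.
  move=> t X i k t0 uX; rewrite mxE normrM -mulrA ler_wpM2l//; exact: bF.
Qed.

Lemma tameB p q j (F H : R -> 'M[R]_(m, d) -> 'M[R]_(p, q)) :
  tame j F -> tame j H -> tame j (fun t X => F t X - H t X).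
Proof.
move=> tF tH.
have -> : (fun t X => F t X - H t X) = fun t X => F t X + (-1) *: H t X.
  by apply/funext => t; apply/funext => X; rewrite scaleN1r.
by apply: tameD => //; exact: tameZ.
Qed.

Lemma tame_trZ l p q j1 j2 (F : R -> 'M[R]_(m, d) -> 'M[R]_l)
    (H : R -> 'M[R]_(m, d) -> 'M[R]_(p, q)) :
  tame j1 F -> tame j2 H -> tame (j1 + j2) (fun t X => \tr (F t X) *: H t X).
Proof.
move=> [mF cF [C C0 bF]] [mH cH [D D0 bH]]; split.
- by move=> t; apply: mx_measurableZ => //; exact: mx_measurable_mxtrace.
- move=> X uX; apply: mx_continuousZ; last exact: cH.
  by apply: continuous_mxtrace; exact: cF.
- exists ((\sum_(k < l) C) * D); first by rewrite mulr_ge0// sumr_ge0.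
  move=> t X i k t0 uX; rewrite mxE normrM exprD mulrACA; apply: ler_pM => //.
    rewrite (le_trans (ler_norm_sum _ _ _))// mulr_suml.
    by apply: ler_sum => l' _; exact: bF.
  exact: bH.
Qed.

Let V (t : R) (X : 'M[R]_(m, d)) := reg `|t| X.
Let Y (t : R) (X : 'M[R]_(m, d)) : 'M[R]_d := 1%:M - `|t| *: V t X.

Lemma tame_V : tame 1 V.
Proof.
split.
- by move=> t; exact: mx_measurable_reg.
- move=> X uX; apply: mx_continuous_invmx.
    apply: mx_continuousD; first exact: mx_continuous_cst.
    have -> : (fun t : R => `|t|%:M) = fun t : R => `|t| *: 1%:M :> 'M[R]_d.
      by apply/funext => t; rewrite scalemx1.
    apply: mx_continuousZ; last exact: mx_continuous_cst.
    by move=> x; exact: norm_continuous.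
  move=> t; have [->|t0] := eqVneq t 0.
    by rewrite normr0 raddf0 addr0.
  by apply: reg_unit; rewrite normr_gt0.
- exists 1 => // t X i k t0 uX; rewrite expr1 mul1r.
  have t0' : 0 < `|t| by rewrite normr_gt0.
  have [h Ws _] := reg_limit_bound t0' uX.
  rewrite -sqrtr_sqr; apply: ler_wsqrtr; rewrite -/(Winv X) in Ws.
  by rewrite Ws; exact: h.
Qed.

Lemma tame_Y : tame 0 Y.
Proof.
have [mV cV _] := tame_V; split.
- move=> t; apply: mx_measurableD; first exact: mx_measurable_cst.
  have -> : (fun xi => - (`|t| *: V t (G xi))) = fun xi => (- `|t|) *: V t (G xi).
    by apply/funext => xi; rewrite scaleNr.
  exact: mx_measurableZ.
- move=> X uX; apply: mx_continuousD; first exact: mx_continuous_cst.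
  have -> : (fun t => - (`|t| *: V t X)) = fun t => (- `|t|) *: V t X.
    by apply/funext => xi; rewrite scaleNr.
  apply: mx_continuousZ; last exact: cV.
  by move=> x; apply: cvgN; exact: norm_continuous.
- exists 2 => // t X i k t0 uX; rewrite expr0 mulr1 !mxE.
  have t0' : 0 < `|t| by rewrite normr_gt0.
  rewrite (le_trans (ler_normB _ _))// (_ : 2 = 1 + 1)//; apply: lerD.
    by case: eqP; rewrite ?normr1 ?normr0.
  rewrite normrM normr_id -(@divff _ `|t|) ?gt_eqF// ler_wpM2l//.
  exact: reg_bound.
Qed.

Let D1 (t : R) (X : 'M[R]_(m, d)) := div1 `|t| X.

Lemma tame_D1 : tame 1 D1.
Proof.
apply: tameB; [apply: tameB|].
- exact: tameZ tame_V.
- exact: tameM tame_V tame_Y.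
- exact: (tame_trZ tame_Y tame_V).
Qed.

(** Markov's inequality for lam^2 tr(V^2), which is at least 1 on singular
    matrices, bounds their probability by lam^2 K for every lam > 0. *)
Lemma singular_null : {ae mu, forall xi, (G xi)^T *m G xi \in unitmx}.
Proof.
pose N := [set xi : conf R I | \det ((G xi)^T *m G xi) = 0].
have mdet : measurable_fun setT (fun xi => \det ((G xi)^T *m G xi)).
  apply: mx_measurable_det; apply: mx_measurableM => //.
  exact: mx_measurable_tr.
have mN : measurable N.
  have -> : N = (fun xi => \det ((G xi)^T *m G xi)) @^-1` [set 0] by [].
  by rewrite -[X in measurable X]setTI; apply: mdet => //; exact: measurable_set1.
suff N0 : mu N = 0%E.
  exists N; split=> // xi /=; rewrite unitmxE unitfE => /negP.
  by rewrite negbK => /eqP.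
pose p : R := m%:R - d%:R.
have p3 : 3 < p by rewrite /p ltrBrDl -natrD ltr_nat.
pose K := (m%:R - 1) * d%:R / (s ^+ 4 * (p * (p - 1) * (p - 3))).
have den : 0 < s ^+ 4 * (p * (p - 1) * (p - 3)).
  by rewrite mulr_gt0 ?exprn_gt0// !mulr_gt0//; lra.
have m1 : 0 <= m%:R - 1 :> R by rewrite subr_ge0 ler1n (leq_ltn_trans _ md).
have K0 : 0 <= K by apply: divr_ge0; [exact: mulr_ge0|exact: ltW].
have bound lam : 0 < lam -> fine (mu N) <= lam ^+ 2 * K.
  move=> lam0.
  have ih := @intg_cst _ _ _ mu 1.
  have := reg_moment_bound s_gt0 mu_iid a_inj U_orth lam0 (h := fun=> 1) ih.
  rewrite Ex_cst mulr1 => /(_ (fun _ _ _ _ => erefl) (fun _ => ler01) md).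
  rewrite -/p -ler_pdivlMl// mulrC -/K.
  under Ex_eq do rewrite mulr1.
  move=> /(ler_wpM2l (sqr_ge0 lam)); apply: le_trans.
  have iw : intg mu (fun xi => \tr (reg lam (G xi) *m reg lam (G xi))).
    by apply: (intg_eq _ (intg_reg_sq a U lam0 ih)) => xi; rewrite mulr1.
  have -> : fine (mu N) = Ex mu (\1_N : conf R I -> R).
    by rewrite /Ex /Rintegral integral_indic// setIT.
  rewrite -ExZ//; apply: le_Ex; [|exact: intgZ|].
    exact: integrable_indic.
  move=> xi; rewrite indicE; case: (boolP (xi \in N)) => [|_].
    rewrite inE /N /= => h; apply: reg_singular => //.
    by rewrite unitmxE unitfE h eqxx.
  by rewrite mulr_ge0 ?sqr_ge0//; exact: reg_sq_ge0.
have fin : mu N \is a fin_num by exact: fin_num_measure.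
rewrite -(fineK fin); congr (_%:E); apply/eqP; rewrite eq_le fine_ge0 ?andbT//.
rewrite leNgt; apply/negP => x0; set x := fine (mu N) in x0 bound.
have den' : 0 < x + K + 1 by lra.
(* lam = x / (x + K + 1) is less than 1 and satisfies lam^2 K < x. *)
set q := x / (x + K + 1).
have q0 : 0 < q by exact: divr_gt0.
have qE : q * (x + K + 1) = x by rewrite divfK// gt_eqF.
have q1 : q < 1 by rewrite ltr_pdivrMr// mul1r; lra.
have := bound q q0.
have : q ^+ 2 * K <= q * K by rewrite ler_wpM2r// expr2 ger_pMl// ltW.
have : 0 < q * x by exact: mulr_gt0.
rewrite !mulrDr mulr1 in qE; lra.
Qed.

Section WithWeight.
Variable h : conf R I -> R.
Hypotheses (ih : intg mu h) (off : off_block a h).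

Let mh : measurable_fun setT h. Proof. exact: (intg_measurable ih). Qed.

Let rG_measurable : measurable_fun setT (fun xi => r (G xi) ^+ 2).
Proof.
have -> : (fun xi => r (G xi) ^+ 2) =
    fun xi => \tr ((Winv (G xi))^T *m Winv (G xi)).
  by apply/funext => xi; rewrite r_sq.
have mW : mx_measurable (fun xi => Winv (G xi)).
  apply: mx_measurable_invmx; apply: mx_measurableM => //.
  exact: mx_measurable_tr.
apply: mx_measurable_mxtrace; apply: mx_measurableM => //.
exact: mx_measurable_tr.
Qed.

Let V0E X : V 0 X = Winv X.
Proof. by rewrite /V /reg normr0 raddf0 addr0. Qed.

Let cvg_tame p q j (F : R -> 'M[R]_(m, d) -> 'M[R]_(p, q)) X i k :
  tame j F -> X^T *m X \in unitmx ->
  F (harmonic l) X i k @[l --> \oo] --> F 0 X i k.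
Proof.
move=> [_ cF _] uX; have c := cF X uX i k 0.
exact: (cvg_comp _ _ cvg_harmonic c).
Qed.

(** Fatou's lemma along lam = 1 / (l + 1), with the uniform moment bound. *)
Lemma intg_inverse_sq : intg mu (fun xi => r (G xi) ^+ 2 * `|h xi|).
Proof.
pose p : R := m%:R - d%:R.
pose K := ((m%:R - 1) * d%:R * Ex mu (fun xi => `|h xi|)) /
  (s ^+ 4 * (p * (p - 1) * (p - 3))).
have p3 : 3 < p by rewrite /p ltrBrDl -natrD ltr_nat.
have den : 0 < s ^+ 4 * (p * (p - 1) * (p - 3)).
  by rewrite mulr_gt0 ?exprn_gt0// !mulr_gt0//; lra.
have iah := intg_norm ih.
have tVV : tame 2 (fun t X => V t X *m V t X) by exact: tameM tame_V tame_V.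
apply: (@intg_fatou _ _ _ mu
  (fun l xi => \tr (V (harmonic l) (G xi) *m V (harmonic l) (G xi)) * `|h xi|) _ K).
- move=> l xi; rewrite mulr_ge0//.
  have := gram_tr_ge0 (V (harmonic l) (G xi)); by rewrite reg_sym.
- move=> l; rewrite /V gtr0_norm ?harmonic_gt0//.
  exact: (intg_reg_sq a U (harmonic_gt0 l) iah).
- move=> l; rewrite /V gtr0_norm ?harmonic_gt0// /K ler_pdivlMr// mulrC.
  apply: (reg_moment_bound s_gt0 mu_iid a_inj U_orth (harmonic_gt0 l) iah _ _ md).
    by move=> i j xi x; rewrite off.
  by [].
- by apply: measurable_funM => //; exact: measurableT_comp.
- by move=> xi; rewrite mulr_ge0// sqr_ge0.
- apply: filterS singular_null => xi uX; apply: cvgM; last exact: cvg_cst.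
  have Ws : (Winv (G xi))^T = Winv (G xi).
    by rewrite trmx_inv trmx_mul trmxK.
  rewrite r_sq Ws -V0E; apply: cvg_sumr => k.
  exact: (cvg_tame tVV uX).
Qed.

(** Dominated convergence: r^j <= 1 + r^2 for j <= 2. *)
Lemma tame_cvg p q j (F : R -> 'M[R]_(m, d) -> 'M[R]_(p, q)) k b :
  (j <= 2)%N -> tame j F ->
  intg mu (fun xi => F 0 (G xi) k b * h xi) /\
  Ex mu (fun xi => F (harmonic l) (G xi) k b * h xi) @[l --> \oo] -->
  Ex mu (fun xi => F 0 (G xi) k b * h xi).
Proof.
move=> j2 tF; have [mF cF [C C0 bF]] := tF.
apply: (@Ex_dct _ _ _ mu (fun l xi => F (harmonic l) (G xi) k b * h xi) _
   (fun xi => C * (`|h xi| + r (G xi) ^+ 2 * `|h xi|))).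
- by move=> l; apply: measurable_funM => //; exact: mF.
- by apply: measurable_funM => //; exact: mF.
- apply: filterS singular_null => xi uX; apply: cvgM; last exact: cvg_cst.
  exact: cvg_tame tF uX.
- by apply: intgZ; apply: intgD; [exact: intg_norm|exact: intg_inverse_sq].
- apply: filterS singular_null => xi uX l.
  rewrite normrM -[X in X + _]mul1r -mulrDl mulrA ler_wpM2r//.
  have h0 : harmonic l != 0 :> R by rewrite gt_eqF// harmonic_gt0.
  apply: (le_trans (bF _ _ k b h0 uX)); rewrite ler_wpM2l//.
  have := r_ge0 (G xi); case: j j2 {tF bF mF cF} => [|[|[|//]]] _; rewrite ?expr0 ?expr1.
  + by move=> _; rewrite lerDl sqr_ge0.
  + by move=> _; have := sqr_ge0 (r (G xi) - 2^-1); nra.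
  + by move=> _; rewrite lerDr.
Qed.

(** Both sides converge along lam = 1 / (l + 1). *)
Lemma tame_identity p q j1 j2 (F H : R -> 'M[R]_(m, d) -> 'M[R]_(p, q)) c k b :
  (j1 <= 2)%N -> (j2 <= 2)%N -> tame j1 F -> tame j2 H ->
  (forall t, 0 < t -> Ex mu (fun xi => F t (G xi) k b * h xi) =
      c * Ex mu (fun xi => H t (G xi) k b * h xi)) ->
  Ex mu (fun xi => F 0 (G xi) k b * h xi) =
  c * Ex mu (fun xi => H 0 (G xi) k b * h xi).
Proof.
move=> j12 j22 tF tH FH.
have [_ cF] := tame_cvg k b j12 tF; have [_ cH] := tame_cvg k b j22 tH.
apply: (cvg_unique _ cF) => //.
have -> : (fun l => Ex mu (fun xi => F (harmonic l) (G xi) k b * h xi)) =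
    fun l => c * Ex mu (fun xi => H (harmonic l) (G xi) k b * h xi).
  by apply/funext => l; rewrite FH ?harmonic_gt0.
by apply: cvgM => //; exact: cvg_cst.
Qed.

Let M xi := Winv (G xi).

Let D10 X : D1 0 X = (m%:R - 1 - d%:R) *: Winv X.
Proof.
rewrite /D1 /div1 -[reg _ _]/(V 0 X) V0E normr0 scale0r subr0 mulmx1 mxtrace1.
by rewrite !scalerBl scale1r.
Qed.

Let Y0 X : Y 0 X = 1%:M. Proof. by rewrite /Y normr0 scale0r subr0. Qed.

Let p : R := m%:R - d%:R.

(** At lam = 0 the three identities read, with delta the identity matrix,
      delta E[h] = s^2 (p - 1) E[M h],
      E[M h] = s^2 ((p - 2) E[M^2 h] - E[tr(M) M h]),
      delta E[tr(M) h] = s^2 ((p - 1) E[tr(M) M h] - 2 E[M^2 h]),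
    a linear system for the moments.  For s^2 = 1/m the solutions are theta1 and
    theta2 times E[h]. *)
Lemma inverse_moments k b :
  [/\ intg mu (fun xi => M xi k b * h xi),
      intg mu (fun xi => (M xi *m M xi) k b * h xi),
      Ex mu (fun xi => M xi k b * h xi) =
        (k == b)%:R * (s ^+ 2 * (p - 1))^-1 * Ex mu h &
      Ex mu (fun xi => (M xi *m M xi) k b * h xi) = (k == b)%:R *
        ((m%:R - 1) / (s ^+ 4 * (p * (p - 1) * (p - 3)))) * Ex mu h].
Proof.
have tV := tame_V; have tY := tame_Y; have tD := tame_D1.
have tVY : tame 1 (fun t X => V t X *m Y t X) by exact: tameM tV tY.
have tVV : tame 2 (fun t X => V t X *m V t X) by exact: (tameM tV tV).
have tYV : tame 1 (fun t X => Y t X *m V t X) by exact: tameM tY tV.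
have ttV : tame 2 (fun t X => \tr (V t X) *: V t X) by exact: (tame_trZ tV tV).
have tF2 : tame 2 (fun t X => D1 t X *m V t X - V t X *m (V t X *m Y t X)
    - \tr (V t X *m Y t X) *: V t X).
  apply: tameB; [apply: tameB|].
  - exact: tameM tD tV.
  - exact: tameM tV tVY.
  - exact: tame_trZ tVY tV.
have tF3 : tame 2 (fun t X => \tr (V t X) *: D1 t X
    - 2 *: (V t X *m (V t X *m Y t X))).
  by apply: tameB; [exact: tame_trZ tV tD|apply: tameZ; exact: tameM tV tVY].
have ttY : tame 1 (fun t X => \tr (V t X) *: Y t X) by exact: tame_trZ tV tY.
have iM i j : intg mu (fun xi => M xi i j * h xi).
  have [iM _] := tame_cvg i j (isT : (1 <= 2)%N) tV.
  by apply: (intg_eq _ iM) => xi; rewrite V0E.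
have iMM i j : intg mu (fun xi => (M xi *m M xi) i j * h xi).
  have [iMM _] := tame_cvg i j (isT : (2 <= 2)%N) tVV.
  by apply: (intg_eq _ iMM) => xi; rewrite V0E.
have itM i j : intg mu (fun xi => \tr (M xi) * M xi i j * h xi).
  have [itM _] := tame_cvg i j (isT : (2 <= 2)%N) ttV.
  by apply: (intg_eq _ itM) => xi; rewrite V0E mxZE.
pose e (i j : 'I_d) : R := (i == j)%:R * Ex mu h.
pose x i j := Ex mu (fun xi => (M xi *m M xi) i j * h xi).
pose y i j := Ex mu (fun xi => \tr (M xi) * M xi i j * h xi).
pose z i j := Ex mu (fun xi => M xi i j * h xi).
have pE : (m%:R - 1 - d%:R : R) = p - 1 by rewrite /p addrAC.
have L1 i j : e i j = s ^+ 2 * ((p - 1) * z i j).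
  have := tame_identity (c := s ^+ 2) (k := i) (b := j) _ _ tY tD.
  move=> /(_ isT isT) L; rewrite /e /z -!ExZ//; last first.
    by have := intgZ (p - 1) (iM i j).
  rewrite -[LHS](Ex_eq _ (f := fun xi => Y 0 (G xi) i j * h xi)); last first.
    by move=> xi; rewrite Y0 mxE.
  rewrite L; last first.
    move=> t t0; rewrite /Y /D1 /V gtr0_norm//.
    exact: (stein_id1 s_gt0 mu_iid a_inj U_orth t0 ih off i j).
  rewrite -ExZ.
    by apply: Ex_eq => xi; rewrite D10 pE mxZE !mulrA.
  apply: (intg_eq _ (intgZ (p - 1) (iM i j))) => xi.
  by rewrite D10 pE mxZE !mulrA.
have L2 i j : z i j = s ^+ 2 * ((p - 2) * x i j - y i j).
  have := tame_identity (c := s ^+ 2) (k := i) (b := j) _ _ tYV tF2.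
  move=> /(_ isT isT) L.
  rewrite [LHS](Ex_eq _ (g := fun xi => (Y 0 (G xi) *m V 0 (G xi)) i j * h xi)); last first.
    by move=> xi; rewrite Y0 mul1mx V0E.
  rewrite L; last first.
    move=> t t0; rewrite /Y /D1 /V gtr0_norm//.
    exact: (stein_id2 s_gt0 mu_iid a_inj U_orth t0 ih off i j).
  congr (_ * _); rewrite /x /y -ExZ// -ExB//; last exact: intgZ.
  apply: Ex_eq => xi; rewrite D10 Y0 V0E mulmx1 -/(M xi) pE -scalemxAl.
  by rewrite !mxBE !mxZE; ring.
have L3 i j : (i == j)%:R * (\sum_l z l l) =
    s ^+ 2 * ((p - 1) * y i j - 2 * x i j).
  have := tame_identity (c := s ^+ 2) (k := i) (b := j) _ _ ttY tF3.
  move=> /(_ isT isT) L.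
  have -> : (i == j)%:R * (\sum_l z l l) =
      Ex mu (fun xi => (\tr (V 0 (G xi)) *: Y 0 (G xi)) i j * h xi).
    rewrite /z -Ex_sum// -ExZ; last exact: intg_sum.
    apply: Ex_eq => xi; rewrite mxZE V0E Y0 mxE /mxtrace -mulr_suml.
    by rewrite -/(M xi); ring.
  rewrite L; last first.
    move=> t t0; rewrite /Y /D1 /V gtr0_norm//.
    exact: (stein_id3 s_gt0 mu_iid a_inj U_orth t0 ih off i j).
  congr (_ * _); rewrite /x /y -!ExZ// -ExB//; [|exact: intgZ..].
  apply: Ex_eq => xi; rewrite D10 Y0 V0E mulmx1 -/(M xi) pE.
  by rewrite mxBE !mxZE; ring.
have p3 : 3 < p by rewrite /p ltrBrDl -natrD ltr_nat.
have s0 : s != 0 by rewrite gt_eqF.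
have p0 : p != 0 by rewrite gt_eqF//; lra.
have p1 : p - 1 != 0 by rewrite gt_eqF//; lra.
have p30 : p - 3 != 0 by rewrite gt_eqF//; lra.
have zE i j : z i j = (i == j)%:R * (s ^+ 2 * (p - 1))^-1 * Ex mu h.
  have := L1 i j; rewrite /e => e1.
  by rewrite mulrAC e1; field; rewrite s0 p1.
split=> //; first exact: zE.
have tr : \sum_l z l l = d%:R * (s ^+ 2 * (p - 1))^-1 * Ex mu h.
  under eq_bigr do rewrite zE eqxx mul1r.
  by rewrite sumr_const card_ord; ring.
have := L2 k b; have := L3 k b; rewrite tr zE -/(x k b).
set dl := (k == b)%:R; set E := Ex mu h; set X := x k b; set YY := y k b.
have mE : m%:R = p + d%:R :> R by rewrite /p subrK.
rewrite mE => e3 e2.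
have s20 : s ^+ 2 != 0 by rewrite expf_neq0.
have e2' : YY = (p - 2) * X - dl * E / (s ^+ 4 * (p - 1)).
  apply: (mulfI s20).
  transitivity (s ^+ 2 * ((p - 2) * X) - dl * (s ^+ 2 * (p - 1))^-1 * E).
    by rewrite e2; ring.
  by field; rewrite s0 p1.
have e3' : (p - 1) * YY - 2 * X = dl * d%:R * E / (s ^+ 4 * (p - 1)).
  apply: (mulfI s20); rewrite -e3.
  by field; rewrite s0 p1.
have key : p * (p - 3) * X = dl * (d%:R + p - 1) * E / (s ^+ 4 * (p - 1)).
  transitivity ((p - 1) * YY - 2 * X + (p - 1) * (dl * E / (s ^+ 4 * (p - 1)))).
    by rewrite e2'; ring.
  by rewrite e3'; field; rewrite s0 p1.
apply: (mulfI (mulf_neq0 p0 p30)); rewrite key.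
by field; rewrite s0 p0 p1 p30.
Qed.

End WithWeight.
End InverseMoments.

(** * Positive definite matrices and least squares *)

Section LinearAlgebra.
Context (R : realType).

Definition posdef n (B : 'M[R]_n) :=
  B^T = B /\ forall u : 'rV_n, u != 0 -> 0 < (u *m B *m u^T) 0 0.

Lemma posdef_gram m n (X : 'M[R]_(m, n)) :
  (forall u : 'rV_n, u *m X^T = 0 -> u = 0) -> posdef (X^T *m X).
Proof.
move=> inj; split; first by rewrite trmx_mul trmxK.
move=> u u0.
have E : u *m (X^T *m X) *m u^T = (X *m u^T)^T *m (X *m u^T).
  by rewrite trmx_mul trmxK !mulmxA.
rewrite E lt_neqAle gram_diag_ge0 andbT eq_sym.
apply: contra u0 => /eqP h.
have : X *m u^T = 0.
  by apply: gram_eq0; apply/matrixP => i j; rewrite !ord1 h mxE.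
by move/(congr1 trmx); rewrite trmx_mul trmxK trmx0 => /inj ->.
Qed.

Lemma posdef_gram_unit m n (X : 'M[R]_(m, n)) :
  X^T *m X \in unitmx -> posdef (X^T *m X).
Proof.
move=> Xu; apply: posdef_gram => u uX.
have : u *m (X^T *m X) = 0 by rewrite mulmxA uX mul0mx.
by move/(congr1 (mulmx^~ (invmx (X^T *m X)))); rewrite mul0mx mulmxK.
Qed.

Section Schur.
Context (n : nat) (B : 'M[R]_(1 + n)).
Hypothesis pdB : posdef B.

Let p := B 0 0.
Let c : 'cV[R]_n := dlsubmx B.
Let D : 'M[R]_n := drsubmx B.

Lemma posdef_pivot : 0 < p.
Proof.
pose e : 'rV[R]_(1 + n) := delta_mx 0 0.
have [_ /(_ e)] := pdB.
have -> : (e *m B *m e^T) 0 0 = p.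
  by rewrite -rowE trmx_delta -colE !mxE.
apply; apply/eqP => /matrixP/(_ 0 0); rewrite !mxE eqxx /=.
by move/eqP; rewrite oner_eq0.
Qed.

Definition schur : 'M[R]_n := D - c *m (p^-1 *: ursubmx B).

Lemma posdef_block : B = block_mx p%:M c^T c D.
Proof.
rewrite -[LHS]submxK; congr block_mx.
  by apply/matrixP => i j; rewrite !ord1 !mxE /= mulr1n;
     congr (B _ _); apply/val_inj.
rewrite /c trmx_dlsub; have [-> _] := pdB; by [].
Qed.

(** The quadratic form of the Schur complement at v is that of B at the vector
    (- v c / p, v). *)
Lemma posdef_schur : posdef schur.
Proof.
have p0 := posdef_pivot; have [Bs Bp] := pdB.
have uE : ursubmx B = c^T by rewrite /c trmx_dlsub Bs.
have Ds : D^T = D by rewrite /D trmx_drsub Bs.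
split.
  by rewrite /schur uE linearB /= trmx_mul linearZ /= trmxK Ds -scalemxAl -scalemxAr.
move=> v v0; pose u : 'rV_(1 + n) := row_mx (- p^-1 *: (v *m c)) v.
have u0 : u != 0.
  by apply: contra v0 => /eqP h; apply/eqP; rewrite -[v](row_mxKr (- p^-1 *: (v *m c))) -/u h linear0.
have := Bp u u0.
suff -> : u *m B *m u^T = v *m schur *m v^T by [].
rewrite posdef_block /u /schur uE.
rewrite mul_row_block tr_row_mx mul_row_col.
rewrite mul_mx_scalar scalerA mulrN divff ?gt_eqF// scaleN1r addNr mul0mx add0r.
rewrite !mulmxDl mulmxBr mulmxBl addrC; congr (_ + _).
by rewrite -!scalemxAl -!scalemxAr -scalemxAl !mulmxA scaleNr.
Qed.

End Schur.

(** A Cholesky factorization, as a congruence with the identity: one step clears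
    the first row and column and leaves the Schur complement. *)
Lemma posdef_factor n (B : 'M[R]_n) : posdef B ->
  exists2 Q : 'M[R]_n, Q \in unitmx & Q^T *m B *m Q = 1%:M.
Proof.
elim: n => [|n IHn] in B *; first by move=> _; exists 1%:M; rewrite ?unitmx1//; apply/matrixP => -[].
move=> pdB; have p0 := posdef_pivot (n := n) pdB.
have [Q Qu QE] := IHn _ (posdef_schur (n := n) pdB).
have BE := posdef_block (n := n) pdB.
have uE : ursubmx (B : 'M[R]_(1 + n)) = (dlsubmx (B : 'M[R]_(1 + n)))^T.
  by rewrite trmx_dlsub; have [-> _] := pdB.
move: BE QE; rewrite /schur uE.
set p := B 0 0 in p0 *; set c := dlsubmx _; set D := drsubmx _ => BE QE.
pose Z : 'M[R]_(1 + n) :=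
  block_mx (Num.sqrt p)^-1%:M (- p^-1 *: (c^T *m Q)) 0 Q.
have sp : Num.sqrt p * Num.sqrt p = p by rewrite -expr2 sqr_sqrtr// ltW.
have sp0 : Num.sqrt p != 0 by rewrite gt_eqF// sqrtr_gt0.
have spE : p^-1 * Num.sqrt p = (Num.sqrt p)^-1.
  by rewrite -{1}sp invfM mulfVK.
have BZ : (B : 'M[R]_(1 + n)) *m Z =
    block_mx (Num.sqrt p)%:M 0 ((Num.sqrt p)^-1 *: c) ((D - c *m (p^-1 *: c^T)) *m Q).
  rewrite BE /Z mulmx_block !mulmx0 !addr0; congr block_mx.
  - by rewrite -scalar_mxM -{1}sp -mulrA divff// mulr1.
  - by rewrite mul_scalar_mx scalerA mulrN divff ?gt_eqF// scaleN1r addNr.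
  - by rewrite mul_mx_scalar.
  - rewrite mulmxBl addrC; congr (_ + _).
    by rewrite -scalemxAr scaleNr -!scalemxAr -scalemxAl mulmxA.
have E : Z^T *m B *m Z = 1%:M.
  rewrite -mulmxA BZ /Z tr_block_mx mulmx_block trmx0 !mulmx0 !mul0mx !addr0 !add0r.
  rewrite tr_scalar_mx -scalar_mxM mulVf// mulmxA QE.
  rewrite linearZ /= trmx_mul trmxK mul_mx_scalar scalerA mulrN mulrC spE.
  by rewrite -scalemxAr scaleNr addNr -scalar_mx_block.
exists Z => //.
by move: E => /mulmx1_unit[].
Qed.

Lemma orthonormal_factor m n (A : 'M[R]_(m, n)) : \rank A = n ->
  exists2 Q : 'M[R]_n, Q \in unitmx & (A *m Q)^T *m (A *m Q) = 1%:M.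
Proof.
move=> rA; have free : row_free A^T by rewrite /row_free mxrank_tr rA.
have pd : posdef (A^T *m A).
  apply: posdef_gram => u uA; apply: (row_free_inj free).
  by rewrite /= uA mul0mx.
have [Q Qu QE] := posdef_factor pd.
by exists Q => //; rewrite trmx_mul !mulmxA in QE *.
Qed.

Definition sqnorm (n : nat) (v : 'cV[R]_n) : R := \sum_i v i 0 ^+ 2.

Lemma sqnormE n (v : 'cV[R]_n) : sqnorm v = (v^T *m v) 0 0.
Proof. by rewrite gram_diag. Qed.

Lemma sqnorm_ge0 n (v : 'cV[R]_n) : 0 <= sqnorm v.
Proof. by rewrite sqnormE gram_diag_ge0. Qed.

Lemma sqnorm_eq0 n (v : 'cV[R]_n) : sqnorm v = 0 -> v = 0.
Proof.
rewrite sqnormE => v0; apply: gram_eq0.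
by apply/matrixP => i j; rewrite !ord1 v0 mxE.
Qed.

Lemma norm2_sq n (v : 'cV[R]_n) : norm2 v ^+ 2 = sqnorm v.
Proof. by rewrite /norm2 sqr_sqrtr// sqnorm_ge0. Qed.

Lemma sqnormBZ n (v w : 'cV[R]_n) t :
  sqnorm (v - t *: w) = sqnorm v - 2 * t * (v^T *m w) 0 0 + t ^+ 2 * sqnorm w.
Proof.
rewrite mxE /sqnorm !mulr_sumr -sumrB -big_split /=.
by apply: eq_bigr => i _; rewrite !mxE; ring.
Qed.

(** Otherwise moving from xs by - t g, for g = A^T (A xs - b) and
    t = |g|^2 / (|A g|^2 + 1), would decrease the residual. *)
Lemma normal_equation m n (A : 'M[R]_(m, n)) b xs :
  is_least_squares A b xs -> A^T *m (A *m xs - b) = 0.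
Proof.
move=> ls; set r := A *m xs - b; set g := A^T *m r.
apply: sqnorm_eq0; apply/eqP; rewrite eq_le sqnorm_ge0 andbT leNgt.
apply/negP => g0; set gam := sqnorm g in g0.
set al := sqnorm (A *m g); have al0 : 0 <= al by exact: sqnorm_ge0.
pose t := gam / (al + 1).
have := ls (xs - t *: g); rewrite !norm2_sq.
have -> : A *m (xs - t *: g) - b = r - t *: (A *m g).
  by rewrite mulmxBr -scalemxAr addrAC.
rewrite sqnormBZ -/al.
have -> : (r^T *m (A *m g)) 0 0 = gam.
  by rewrite /gam sqnormE mulmxA [X in _ = (X *m _) _ _]trmx_mul trmxK.
have tE : t * (al + 1) = gam by rewrite divfK// gt_eqF//; lra.
have t0 : 0 < t by rewrite divr_gt0//; lra.
nra.
Qed.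

End LinearAlgebra.

(** * The error after averaging *)

(** One averaged step, for symmetric random matrices [M k] of which only the
    moments against independent weights are known: E[M_k h] = c1 E[h] and
    E[M_k^2 h] = c2 E[h].  Independence enters as an abstract predicate, closed
    under products, that holds for the entries of the other matrices and of the
    current error [z]. *)
Section AveragingStep.
Context disp (T : measurableType disp) (R : realType) (P : probability T R).
Context (q d : nat) (M : 'I_q -> T -> 'M[R]_d) (c1 c2 : R).
Variable indep : 'I_q -> (T -> R) -> Prop.
Hypothesis indepM : forall k f g, indep k f -> indep k g ->
  indep k (fun t => f t * g t).
Hypothesis indep_M : forall k l i j, k != l -> indep k (fun t => M l t i j).
Hypothesis M_measurable : forall k, mx_measurable (M k).
Hypothesis M_moments : forall k h i j, intg P h -> indep k h ->
  [/\ intg P (fun t => M k t i j * h t),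
      intg P (fun t => (M k t *m M k t) i j * h t),
      Ex P (fun t => M k t i j * h t) = (i == j)%:R * c1 * Ex P h &
      Ex P (fun t => (M k t *m M k t) i j * h t) = (i == j)%:R * c2 * Ex P h].

Variable z : T -> 'cV[R]_d.
Hypothesis z_measurable : mx_measurable z.
Hypothesis z_indep : forall k i, indep k (fun t => z t i 0).
Hypothesis z_intg : forall i j, intg P (fun t => z t i 0 * z t j 0).
Hypothesis M_sym : forall k t, (M k t)^T = M k t.

Let zz i j t := z t i 0 * z t j 0.

Let zz_indep k i j : indep k (zz i j). Proof. exact: indepM. Qed.

Let N := Ex P (fun t => sqnorm (z t)).

Let NE : N = \sum_i Ex P (zz i i).
Proof.
rewrite -Ex_sum; last by move=> i; exact: z_intg.
by apply: Ex_eq => t; apply: eq_bigr => i _; rewrite expr2.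
Qed.

Let form (Q : T -> 'M[R]_d) t := \sum_i \sum_j Q t i j * zz i j t.

Let formE Q t : form Q t = ((z t)^T *m Q t *m z t) 0 0.
Proof.
rewrite /form mxE exchange_big; apply: eq_bigr => j _ /=.
rewrite mxE mulr_suml; apply: eq_bigr => i _.
by rewrite mxE /zz; ring.
Qed.

Lemma form_moment (Q : T -> 'M[R]_d) c :
  (forall i j, intg P (fun t => Q t i j * zz i j t) /\
     Ex P (fun t => Q t i j * zz i j t) = (i == j)%:R * c * Ex P (zz i j)) ->
  intg P (form Q) /\ Ex P (form Q) = c * N.
Proof.
move=> hQ; have iQ i j : intg P (fun t => Q t i j * zz i j t) by have [] := hQ i j.
split; first by apply: intg_sum => i; exact: intg_sum.
rewrite /form Ex_sum; last by move=> i; exact: intg_sum.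
rewrite NE mulr_sumr; apply: eq_bigr => i _.
rewrite Ex_sum// (bigD1 i)//= big1 ?addr0; last first.
  by move=> j ji; have [_ ->] := hQ i j; rewrite eq_sym (negbTE ji) !mul0r.
by have [_ ->] := hQ i i; rewrite eqxx mul1r.
Qed.

Lemma form_moment1 k : intg P (form (M k)) /\ Ex P (form (M k)) = c1 * N.
Proof.
apply: form_moment => i j.
by have [] := M_moments i j (z_intg i j) (zz_indep k i j).
Qed.

(** For k <> l, the entries of M_l z z^T are weights for M_k, and those of z z^T
    are weights for M_l, so that the expectation factorizes in two steps. *)
Lemma form_moment2 k l : let Q t := M k t *m M l t in
  intg P (form Q) /\
  Ex P (form Q) = (if k == l then c2 else c1 ^+ 2) * N.
Proof.
move=> Q; apply: form_moment => i j; rewrite /Q {Q}; case: (eqVneq k l) => [->|kl].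
  have [_ h1 _ h2] := M_moments i j (z_intg i j) (zz_indep l i j).
  by split.
have iM a : intg P (fun t => M l t a j * zz i j t) /\
    Ex P (fun t => M l t a j * zz i j t) = (a == j)%:R * c1 * Ex P (zz i j).
  by have [] := M_moments a j (z_intg i j) (zz_indep l i j).
have inda a : indep k (fun t => M l t a j * zz i j t).
  by apply: indepM => //; exact: indep_M.
have iMM a : intg P (fun t => M k t i a * (M l t a j * zz i j t)) /\
    Ex P (fun t => M k t i a * (M l t a j * zz i j t)) =
    (i == a)%:R * c1 * ((a == j)%:R * c1 * Ex P (zz i j)).
  have [iMa <-] := iM a.
  by have [] := M_moments i a iMa (inda a).
have E t : (M k t *m M l t) i j * zz i j t =
    \sum_a M k t i a * (M l t a j * zz i j t).
  by rewrite mxE mulr_suml; apply: eq_bigr => a _; rewrite mulrA.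
have iS : intg P (fun t => \sum_a M k t i a * (M l t a j * zz i j t)).
  by apply: intg_sum => a; have [] := iMM a.
split; first by apply: (intg_eq _ iS) => t; rewrite E.
rewrite (Ex_eq _ E) Ex_sum; last by move=> a; have [] := iMM a.
rewrite (bigD1 i)//= big1 ?addr0; last first.
  by move=> a ai; have [_ ->] := iMM a; rewrite eq_sym (negbTE ai) !mul0r.
by have [_ ->] := iMM i; rewrite eqxx /=; ring.
Qed.

Variable c : R.
Definition averaged t : 'cV[R]_d := z t - c *: \sum_k M k t *m z t.

Lemma averaged_measurable : mx_measurable averaged.
Proof.
apply: mx_measurableD => //.
have -> : (fun t => - (c *: \sum_k M k t *m z t)) =
    fun t => (- c) *: \sum_k M k t *m z t.
  by apply/funext => t; rewrite scaleNr.
apply: mx_measurableZ => //; apply: mx_measurable_sum => k.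
exact: mx_measurableM.
Qed.

(** The square of the sum of the M_k has q diagonal terms, with moment c2, and
    q (q - 1) cross terms, with moment c1^2. *)
Lemma averaged_moment :
  intg P (fun t => sqnorm (averaged t)) /\
  Ex P (fun t => sqnorm (averaged t)) =
  (1 - 2 * c * (q%:R * c1) + c ^+ 2 * (q%:R * c2 + (q%:R * (q%:R - 1)) * c1 ^+ 2)) * N.
Proof.
have sqE t : sqnorm (averaged t) = sqnorm (z t) - 2 * c * (\sum_k form (M k) t)
    + c ^+ 2 * (\sum_k \sum_l form (fun t => M k t *m M l t) t).
  have sq n (v : 'cV[R]_n) : sqnorm v = (v^T *m v) 0 0.
    by rewrite gram_diag.
  pose S := \sum_k M k t.
  have Ssym : S^T = S.
    by rewrite raddf_sum /=; apply: eq_bigr => k _; rewrite M_sym.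
  have avE : averaged t = z t - c *: (S *m z t).
    by rewrite /averaged /S mulmx_suml.
  have -> : \sum_k form (M k) t = ((z t)^T *m S *m z t) 0 0.
    rewrite /S mulmx_sumr mulmx_suml summxE.
    by apply: eq_bigr => k _; rewrite formE.
  have -> : \sum_k \sum_l form (fun t => M k t *m M l t) t =
      ((z t)^T *m (S *m S) *m z t) 0 0.
    have -> : S *m S = \sum_k \sum_l M k t *m M l t.
      rewrite {1}/S mulmx_suml; apply: eq_bigr => k _.
      by rewrite /S mulmx_sumr.
    rewrite mulmx_sumr mulmx_suml summxE; apply: eq_bigr => k _.
    rewrite mulmx_sumr mulmx_suml summxE; apply: eq_bigr => l _.
    by rewrite formE.
  rewrite !sq avE.
  have -> : (z t - c *: (S *m z t))^T = (z t)^T - c *: ((z t)^T *m S).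
    by rewrite linearB linearZ /= trmx_mul Ssym.
  rewrite mulmxBl !mulmxBr -!scalemxAl -!scalemxAr !mulmxA !mxBE !mxZE.
  by rewrite ?mxBE ?mxZE; ring.
have i0 : intg P (fun t => sqnorm (z t)).
  apply: intg_sum => i; apply: (intg_eq _ (z_intg i i)) => t.
  by rewrite expr2.
have i1 : intg P (fun t => \sum_k form (M k) t).
  by apply: intg_sum => k; have [] := form_moment1 k.
have i2 : intg P (fun t => \sum_k \sum_l form (fun t => M k t *m M l t) t).
  by apply: intg_sum => k; apply: intg_sum => l; have [] := form_moment2 k l.
split.
  apply: (intg_eq _ (intgD (intgB i0 (intgZ (2 * c) i1)) (intgZ (c ^+ 2) i2))).
  by move=> t; rewrite sqE.
rewrite (Ex_eq _ sqE) ExD; [|by apply: intgB => //; exact: intgZ|exact: intgZ].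
rewrite ExB//; last exact: intgZ.
rewrite !ExZ// -/N Ex_sum; last by move=> k; have [] := form_moment1 k.
rewrite Ex_sum; last by move=> k; apply: intg_sum => l; have [] := form_moment2 k l.
rewrite (eq_bigr (fun=> c1 * N)); last by move=> k _; have [_ ->] := form_moment1 k.
rewrite [X in _ + _ * X](eq_bigr (fun=> c2 * N + (q%:R - 1) * (c1 ^+ 2 * N))); last first.
  move=> k _; rewrite Ex_sum; last by move=> l; have [] := form_moment2 k l.
  rewrite (bigD1 k)//=; have [_ ->] := form_moment2 k k.
  rewrite eqxx; congr (_ + _).
  rewrite (eq_bigr (fun=> c1 ^+ 2 * N)); last first.
    by move=> l lk; have [_ ->] := form_moment2 k l; rewrite eq_sym (negbTE lk).
  rewrite sumr_const cardC1 card_ord -[LHS]mulr_natl -subn1 natrB//.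
  exact: leq_ltn_trans (ltn_ord k).
rewrite !sumr_const card_ord.
by ring.
Qed.

(** Through this the products of entries of the new error become weights for the
    next step. *)
Lemma averaged_intg i j : intg P (fun t => averaged t i 0 * averaged t j 0).
Proof.
have [iN _] := averaged_moment.
apply: (intg_le _ _ (intgZ 2 iN)).
  by apply: measurable_funM; exact: averaged_measurable.
move=> t; have sq0 : 0 <= sqnorm (averaged t).
  by rewrite sumr_ge0// => k _; exact: sqr_ge0.
have hk k : averaged t k 0 ^+ 2 <= sqnorm (averaged t).
  by rewrite /sqnorm (bigD1 k)//= lerDl sumr_ge0// => l _; exact: sqr_ge0.
rewrite [leRHS]ger0_norm ?mulr_ge0// ler_norml.
have := hk i; have := hk j.
set x := averaged t i 0; set y := averaged t j 0 => hx hy.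
by have := sqr_ge0 (x + y); have := sqr_ge0 (x - y); rewrite sqrrB sqrrD; lra.
Qed.

End AveragingStep.

(** * The law of the sketches *)

Section SketchLaw.
Context disp (Omega : measurableType disp) (R : realType).
Context (P : probability Omega R) (I : choiceType) (s : R).
Variable X : I -> {RV P >-> R}.

Definition sample (w : Omega) : conf R I := fun i => X i w.

Lemma measurable_sample : measurable_fun setT sample.
Proof.
apply: measurable_to_conf => i.
exact: measurable_funP (X i).
Qed.

HB.instance Definition _ := isMeasurableFun.Build _ _ _ _ _ measurable_sample.

Definition sample_law : probability (conf R I) R := distribution P sample.

Lemma sample_law_iid :
  (forall i B, measurable B -> distribution P (X i) B = normal_prob 0 s B) ->
  mutually_independent X ->
  iid_law (normal_prob 0 s : probability (measurableTypeR R) R) sample_law.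
Proof.
move=> norm ind J B mB.
transitivity (P (\bigcap_(i in [set` J]) (X i @^-1` B i))).
  by congr (P _); apply/seteqP; split=> w.
rewrite ind//; apply: eq_bigr => i _.
exact: (norm i (B i) (mB i)).
Qed.

Lemma ge0_integral_sample (F : conf R I -> R) : measurable_fun setT F ->
  (forall xi, 0 <= F xi) ->
  (\int[P]_w (F (sample w))%:E = \int[sample_law]_xi (F xi)%:E)%E.
Proof.
move=> mF F0; rewrite [RHS]ge0_integral_distribution//.
exact/measurable_EFinP.
Qed.

Lemma ae_sample (Q : conf R I -> Prop) :
  {ae sample_law, forall xi, Q xi} -> {ae P, forall w, Q (sample w)}.
Proof.
move=> [N [mN N0 QN]]; exists (sample @^-1` N); split=> //.
- by rewrite -[X in measurable X]setTI; exact: measurable_sample.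
- by move=> w /= h; apply: QN.
Qed.

End SketchLaw.

(** * The error after several iterations *)

Section RandomIteration.
Context (R : realType) (q m n d : nat) (s : R).
Hypothesis s_gt0 : 0 < s.
Hypothesis md : (d + 3 < m)%N.
Let I : choiceType := (nat * 'I_q * 'I_m * 'I_n)%type.
Variable mu : probability (conf R I) R.
Hypothesis mu_iid :
  iid_law (normal_prob 0 s : probability (measurableTypeR R) R) mu.
Variable U : 'M[R]_(n, d).
Hypothesis U_orth : U^T *m U = 1%:M.

Definition entry_index (t : nat) (k : 'I_q) (i : 'I_m) (j : 'I_n) : I := (t, k, i, j).

Definition gram_inv t k (xi : conf R I) : 'M[R]_d :=
  invmx ((blk (entry_index t k) xi *m U)^T *m (blk (entry_index t k) xi *m U)).

Variables (c : R) (z0 : 'cV[R]_d).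

(** The coordinates R0 (x_t - xs) of the error, as a function of the entries of
    all sketches. *)
Fixpoint error_iter t : conf R I -> 'cV[R]_d :=
  if t is t'.+1 then averaged (gram_inv t') (error_iter t') c else fun=> z0.

Lemma entry_index_inj t k i j i' j' :
  entry_index t k i j = entry_index t k i' j' -> i = i' /\ j = j'.
Proof. by case=> -> ->. Qed.

Lemma blk_upd_other (t t' : nat) (k k' : 'I_q) i j (xi : conf R I) x : (t, k) != (t', k') ->
  blk (entry_index t k) (upd xi (entry_index t' k' i j) x) =
  blk (entry_index t k) xi.
Proof.
move=> tk; apply/matrixP => i' j'; rewrite !mxE /upd.
by case: eqP => // -[tt kk _ _]; rewrite tt kk eqxx in tk.
Qed.

Lemma gram_inv_upd (t t' : nat) (k k' : 'I_q) i j (xi : conf R I) x : (t, k) != (t', k') ->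
  gram_inv t k (upd xi (entry_index t' k' i j) x) = gram_inv t k xi.
Proof. by move=> tk; rewrite /gram_inv blk_upd_other. Qed.

(** The error after t iterations depends on earlier sketches only. *)
Lemma error_iter_upd t t' k i j xi x : (t <= t')%N ->
  error_iter t (upd xi (entry_index t' k i j) x) = error_iter t xi.
Proof.
elim: t => //= t IHt tt; rewrite /averaged IHt ?(ltnW tt)//; congr (_ - _ *: _).
apply: eq_bigr => l _; rewrite gram_inv_upd//.
by rewrite xpair_eqE (ltn_eqF tt).
Qed.

Let p : R := m%:R - d%:R.
Definition mean_factor : R :=
  1 - 2 * c * (q%:R * (s ^+ 2 * (p - 1))^-1) + c ^+ 2 *
    (q%:R * ((m%:R - 1) / (s ^+ 4 * (p * (p - 1) * (p - 3)))) +
     (q%:R * (q%:R - 1)) * (s ^+ 2 * (p - 1))^-1 ^+ 2).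

(** Products of entries of the error at time t, possibly times entries of the
    matrices of other workers, ignore the sketch of worker k at time t: they are
    the weights with which [inverse_moments] is applied. *)
Lemma error_iter_moment t :
  [/\ mx_measurable (error_iter t),
      forall i j, intg mu (fun xi => error_iter t xi i 0 * error_iter t xi j 0) &
      Ex mu (fun xi => sqnorm (error_iter t xi)) = mean_factor ^+ t * sqnorm z0].
Proof.
elim: t => [|t [mz iz Ez]].
  split; [exact: mx_measurable_cst|by move=> i j; exact: (intg_cst mu (z0 i 0 * z0 j 0))|].
  by rewrite /= Ex_cst mul1r.
have minv k : mx_measurable (gram_inv t k).
  apply: mx_measurable_invmx.
  apply: mx_measurableM; last exact: mx_measurable_G.
  by apply: mx_measurable_tr; exact: mx_measurable_G.
pose indep (k : 'I_q) (f : conf R I -> R) := off_block (entry_index t k) f.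
have iM k f g : indep k f -> indep k g -> indep k (fun t => f t * g t).
  by move=> hf hg i j xi x; rewrite hf hg.
have indM k l i j : k != l -> indep k (fun xi => gram_inv t l xi i j).
  move=> kl i' j' xi x; rewrite gram_inv_upd//.
  by rewrite xpair_eqE eqxx /= eq_sym.
have indz k i : indep k (fun xi => error_iter t xi i 0).
  by move=> i' j' xi x; rewrite error_iter_upd.
have sym k xi : (gram_inv t k xi)^T = gram_inv t k xi.
  by rewrite /gram_inv trmx_inv trmx_mul trmxK.
have mom k h i j : intg mu h -> indep k h ->
  [/\ intg mu (fun t' => gram_inv t k t' i j * h t'),
      intg mu (fun t' => (gram_inv t k t' *m gram_inv t k t') i j * h t'),
      Ex mu (fun t' => gram_inv t k t' i j * h t') =
        (i == j)%:R * (s ^+ 2 * (p - 1))^-1 * Ex mu h &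
      Ex mu (fun t' => (gram_inv t k t' *m gram_inv t k t') i j * h t') =
        (i == j)%:R * ((m%:R - 1) / (s ^+ 4 * (p * (p - 1) * (p - 3)))) * Ex mu h].
  move=> ih off.
  exact: (inverse_moments s_gt0 mu_iid (entry_index_inj (t := t) (k := k)) U_orth md ih off).
split.
- exact: averaged_measurable.
- exact: (averaged_intg iM indM minv mom mz indz iz sym).
- have [_ /= ->] := averaged_moment iM indM mom indz iz sym c.
  by rewrite Ez [X in _ = X * _]exprS -[RHS]mulrA.
Qed.

End RandomIteration.

(** * Straight-line programs *)

Section CodeGeneration.

Definition instr := (arith_op * nat * nat)%type.

(** A generator receives the current size of the memory, that is, the address of
    the next result; it returns code together with a value, typically the
    addresses of the cells that the code fills. *)
Definition gen (X : Type) := nat -> seq instr * X.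

Definition ret (X : Type) (x : X) : gen X := fun=> ([::], x).

Definition emit (o : arith_op) (i j : nat) : gen nat := fun N => ([:: (o, i, j)], N).

Definition bind (X Y : Type) (g : gen X) (f : X -> gen Y) : gen Y := fun N =>
  let r1 := g N in let r2 := f r1.2 (N + size r1.1)%N in (r1.1 ++ r2.1, r2.2).

Fixpoint tabs (T : eqType) (s : seq T) (g : T -> gen nat) : gen (T -> nat) :=
  if s is t :: s' then
    bind (g t) (fun a => bind (tabs s' g) (fun f =>
      ret (fun u => if u == t then a else f u)))
  else ret (fun=> 0%N).

Definition tab (T : finType) (g : T -> gen nat) : gen (T -> nat) :=
  tabs (enum T) g.

Definition tab2 m n (g : 'I_m -> 'I_n -> gen nat) : gen ('I_m -> 'I_n -> nat) :=
  bind (tab (fun ij : 'I_m * 'I_n => g ij.1 ij.2)) (fun h =>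
    ret (fun i j => h (i, j))).

(** The instruction set has no constants; 0 is a cell minus itself. *)
Definition zero_cell : gen nat := emit Defs.Sub 0 0.

Fixpoint add_up (T : Type) (s : seq T) (f : T -> nat) (z : nat) : gen nat :=
  if s is t :: s' then bind (emit Add z (f t)) (add_up s' f) else ret z.

Definition dot n (f g : 'I_n -> nat) : gen nat :=
  bind (tab (fun i => emit Mul (f i) (g i))) (fun h =>
  bind zero_cell (add_up (enum 'I_n) h)).

(** Elimination without pivoting, followed by back substitution.  On positive
    definite systems the pivots are positive, because Schur complements of
    positive definite matrices are positive definite. *)
Fixpoint solve d : ('I_d -> 'I_d -> nat) -> ('I_d -> nat) -> gen ('I_d -> nat) :=
  match d with
  | 0 => fun _ g => ret g
  | n.+1 => fun W g =>
    let up := lift ord0 in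
    bind (tab (fun i : 'I_n => emit Div (W (up i) ord0) (W ord0 ord0))) (fun l =>
    bind (tab (fun i : 'I_n => emit Mul (l i) (g ord0))) (fun lg =>
    bind (tab (fun i : 'I_n => emit Defs.Sub (g (up i)) (lg i))) (fun g' =>
    bind (tab2 (fun i j : 'I_n => emit Mul (l i) (W ord0 (up j)))) (fun lW =>
    bind (tab2 (fun i j : 'I_n => emit Defs.Sub (W (up i) (up j)) (lW i j))) (fun W' =>
    bind (solve W' g') (fun y =>
    bind (dot (fun j => W ord0 (up j)) y) (fun sm =>
    bind (emit Defs.Sub (g ord0) sm) (fun r =>
    bind (emit Div r (W ord0 ord0)) (fun y0 =>
    ret (fun i => if unlift ord0 i is Some j then y j else y0))))))))))
  end.

Definition cost (X : Type) (g : gen X) (L : nat) := forall N, (size (g N).1 <= L)%N.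

Lemma cost_ret X (x : X) : cost (ret x) 0.
Proof. by []. Qed.

Lemma cost_emit o i j : cost (emit o i j) 1.
Proof. by []. Qed.

Lemma cost_bind X Y (g : gen X) (f : X -> gen Y) L1 L2 :
  cost g L1 -> (forall x, cost (f x) L2) -> cost (bind g f) (L1 + L2).
Proof.
by move=> c1 c2 N; rewrite /bind /= size_cat leq_add//; exact: c2.
Qed.

Lemma cost_le X (g : gen X) L1 L2 : (L1 <= L2)%N -> cost g L1 -> cost g L2.
Proof. by move=> L c N; exact: leq_trans (c N) L. Qed.

Lemma cost_tabs (T : eqType) (s : seq T) g L :
  (forall t, cost (g t) L) -> cost (tabs s g) (size s * L).
Proof.
move=> cg; elim: s => [|t s IHs] /=; first exact: cost_ret.
rewrite mulSn; apply: cost_bind => // a; rewrite -[(size s * L)%N]addn0.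
by apply: cost_bind => // f; exact: cost_ret.
Qed.

Lemma cost_tab (T : finType) (g : T -> gen nat) L :
  (forall t, cost (g t) L) -> cost (tab g) (#|T| * L).
Proof. by move=> cg; rewrite cardT; exact: cost_tabs. Qed.

Lemma cost_tab2 m n (g : 'I_m -> 'I_n -> gen nat) L :
  (forall i j, cost (g i j) L) -> cost (tab2 g) (m * n * L).
Proof.
move=> cg; rewrite -[(m * n * L)%N]addn0; apply: cost_bind => [|h].
  by rewrite -[X in (X * n)%N]card_ord -[X in (_ * X * L)%N]card_ord -card_prod; exact: cost_tab.
exact: cost_ret.
Qed.

Lemma cost_add_up (T : Type) (s : seq T) f z : cost (add_up s f z) (size s).
Proof.
elim: s z => [|t s IHs] z /=; first exact: cost_ret.
by rewrite -add1n; apply: cost_bind.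
Qed.

Lemma cost_dot n (f g : 'I_n -> nat) : cost (dot f g) (2 * n + 1).
Proof.
rewrite (_ : 2 * n + 1 = n * 1 + (1 + n))%N; last by lia.
apply: cost_bind => [|h].
  by rewrite -[X in (X * 1)%N]card_ord; exact: cost_tab.
apply: cost_bind => // z; rewrite -[n in cost _ n]size_enum_ord.
exact: cost_add_up.
Qed.

(** Passing from size n + 1 to size n takes 2 n^2 + 5 n + 3 operations, which is
    less than 10 ((n + 1)^3 - n^3). *)
Lemma cost_solve d W g : cost (@solve d W g) (10 * d ^ 3).
Proof.
elim: d W g => [|n IHn] W g; first exact: cost_ret.
have ct (h : 'I_n -> gen nat) : (forall i, cost (h i) 1) -> cost (tab h) n.
  by move=> ch; rewrite -[n in cost _ n]muln1 -[X in (X * 1)%N]card_ord; exact: cost_tab.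
have ct2 (h : 'I_n -> 'I_n -> gen nat) : (forall i j, cost (h i j) 1) ->
    cost (tab2 h) (n * n).
  by move=> ch; rewrite -[(n * n)%N]muln1; exact: cost_tab2.
apply: (@cost_le _ _ (n + (n + (n + (n * n + (n * n + (10 * n ^ 3 +
  ((2 * n + 1) + (1 + (1 + 0))))))))))%N.
  rewrite !expnS expn0 !muln1; nia.
do 5 (apply: cost_bind => [|?]; first by [exact: ct|exact: ct2]).
apply: cost_bind => [|y]; first exact: IHn.
apply: cost_bind => [|sm]; first exact: cost_dot.
apply: cost_bind => // r; apply: cost_bind => // y0; exact: cost_ret.
Qed.

End CodeGeneration.

Section Semantics.
Context (R : realType).
Implicit Types mem : seq R.

Definition exec (code : seq instr) mem : seq R := foldl (@slp_step R) mem code.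

Lemma size_exec code mem : size (exec code mem) = (size mem + size code)%N.
Proof.
elim: code mem => [|c code IHc] mem /=; first by rewrite addn0.
by rewrite IHc size_rcons addSnnS.
Qed.

(** The bound on the address matters: a cell beyond the end reads as 0 only until
    something is appended. *)
Definition reads mem (i : nat) (v : R) := (i < size mem)%N /\ mem`_i = v.

Definition extends mem mem' := forall i v, reads mem i v -> reads mem' i v.

Lemma extends_refl mem : extends mem mem. Proof. by []. Qed.

Lemma extends_trans mem2 mem1 mem3 :
  extends mem1 mem2 -> extends mem2 mem3 -> extends mem1 mem3.
Proof. by move=> h1 h2 i v /h1 /h2. Qed.

Lemma extends_rcons mem v : extends mem (rcons mem v).
Proof.
move=> i w [im <-]; split; first by rewrite size_rcons ltnW.
by rewrite nth_rcons im.
Qed.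

(** A Hoare triple: the code generated at [mem] preserves the cells of [mem] and
    reaches a memory that satisfies [Q]. *)
Definition computes (X : Type) (g : gen X) mem (Q : seq R -> X -> Prop) :=
  let r := g (size mem) in
  extends mem (exec r.1 mem) /\ Q (exec r.1 mem) r.2.

Lemma computes_ret X (x : X) mem (Q : seq R -> X -> Prop) :
  Q mem x -> computes (ret x) mem Q.
Proof. by move=> Qx; split. Qed.

Lemma computes_bind X Y (g : gen X) (f : X -> gen Y) mem Q Q' :
  computes g mem Q ->
  (forall mem' x, extends mem mem' -> Q mem' x -> computes (f x) mem' Q') ->
  computes (bind g f) mem Q'.
Proof.
move=> [e1 h1] h2; have [e2 h3] := h2 _ _ e1 h1.
rewrite /computes /bind /= /exec foldl_cat -!/(exec _ _).
rewrite size_exec in e2 h3.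
by split=> //; exact: extends_trans e2.
Qed.

Lemma computes_emit o i j mem :
  computes (emit o i j) mem
    (fun mem' a => reads mem' a (eval_op o mem`_i mem`_j)).
Proof.
split=> /=; first exact: extends_rcons.
by split; rewrite ?size_rcons// nth_rcons ltnn eqxx.
Qed.

Lemma computes_op o i j x y mem : reads mem i x -> reads mem j y ->
  computes (emit o i j) mem (fun mem' a => reads mem' a (eval_op o x y)).
Proof.
move=> [_ <-] [_ <-]; exact: computes_emit.
Qed.

Lemma computes_zero mem : computes zero_cell mem (fun mem' a => reads mem' a 0).
Proof. by have := computes_emit Defs.Sub 0 0 mem; rewrite /= subrr. Qed.

Lemma computes_tabs (T : eqType) (s : seq T) (g : T -> gen nat) (v : T -> R) mem :
  (forall t mem', extends mem mem' ->
     computes (g t) mem' (fun mem'' a => reads mem'' a (v t))) ->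
  computes (tabs s g) mem
    (fun mem' f => forall t, t \in s -> reads mem' (f t) (v t)).
Proof.
elim: s mem => [|t s IHs] mem hg /=; first exact: computes_ret.
apply: (computes_bind (hg t mem (@extends_refl mem))) => mem1 a e1 ha.
apply: computes_bind.
  by apply: IHs => u mem' e'; apply: hg; exact: extends_trans e'.
move=> mem2 f e2 hf; apply: computes_ret => u.
rewrite inE; case: eqP => [->|_] /=; first by move=> _; exact: e2.
exact: hf.
Qed.

Lemma computes_tab (T : finType) (g : T -> gen nat) (v : T -> R) mem :
  (forall t mem', extends mem mem' ->
     computes (g t) mem' (fun mem'' a => reads mem'' a (v t))) ->
  computes (tab g) mem (fun mem' f => forall t, reads mem' (f t) (v t)).
Proof.
move=> hg; have [e h] := computes_tabs (enum T) hg.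
by split=> // t; apply: h; rewrite mem_enum.
Qed.

Definition holds mem m n (f : 'I_m -> 'I_n -> nat) (M : 'M[R]_(m, n)) :=
  forall i j, reads mem (f i j) (M i j).

Lemma computes_tab2 m n (g : 'I_m -> 'I_n -> gen nat) (M : 'M[R]_(m, n)) mem :
  (forall i j mem', extends mem mem' ->
     computes (g i j) mem' (fun mem'' a => reads mem'' a (M i j))) ->
  computes (tab2 g) mem (fun mem' f => holds mem' f M).
Proof.
move=> hg; apply: computes_bind.
  by apply: (@computes_tab _ _ (fun ij => M ij.1 ij.2)) => ij mem'; exact: hg.
by move=> mem' h e hh; apply: computes_ret => i j; exact: (hh (i, j)).
Qed.

Lemma computes_add_up (T : Type) (s : seq T) f (v : T -> R) z x mem :
  reads mem z x -> (forall t, reads mem (f t) (v t)) ->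
  computes (add_up s f z) mem
    (fun mem' a => reads mem' a (x + \sum_(t <- s) v t)).
Proof.
elim: s z x mem => [|t s IHs] z x mem hz hf /=.
  by apply: computes_ret; rewrite big_nil addr0.
apply: (computes_bind (computes_op Add hz (hf t))) => mem1 a e1 ha.
have := IHs a _ mem1 ha (fun u => e1 _ _ (hf u)).
by rewrite big_cons addrA.
Qed.

Lemma computes_dot n (f g : 'I_n -> nat) (u v : 'I_n -> R) mem :
  (forall i, reads mem (f i) (u i)) -> (forall i, reads mem (g i) (v i)) ->
  computes (dot f g) mem (fun mem' a => reads mem' a (\sum_i u i * v i)).
Proof.
move=> hf hg; apply: computes_bind.
  apply: (@computes_tab _ _ (fun i => u i * v i)) => i mem' e.
  by apply: (@computes_op Mul _ _ (u i) (v i)); [exact/e/hf|exact/e/hg].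
move=> mem1 h e1 hh; apply: (computes_bind (computes_zero mem1)).
move=> mem2 z e2 hz.
have := computes_add_up (enum 'I_n) hz (fun i => e2 _ _ (hh i)).
by rewrite add0r big_enum.
Qed.

(** Back substitution: a solution of the system of the Schur complement extends to
    the whole system. *)
Lemma eliminate n (B : 'M[R]_n.+1) (v : 'cV[R]_n.+1) (y : 'cV[R]_n) (y0 : R) :
  let up := lift ord0 in
  B ord0 ord0 != 0 ->
  (\matrix_(i, j) (B (up i) (up j) - B (up i) ord0 / B ord0 ord0 * B ord0 (up j)))
    *m y = \col_i (v (up i) 0 - B (up i) ord0 / B ord0 ord0 * v ord0 0) ->
  y0 = (v ord0 0 - \sum_j B ord0 (up j) * y j 0) / B ord0 ord0 ->
  B *m (\col_i (if unlift ord0 i is Some j then y j 0 else y0)) = v.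
Proof.
move=> up p0 Sy y0E; apply/matrixP => i k; rewrite ord1 mxE big_ord_recl.
rewrite mxE unlift_none (eq_bigr (fun j => B i (up j) * y j 0)); last first.
  by move=> j _; rewrite mxE liftK.
rewrite y0E.
case: (unliftP ord0 i) => [i'|] ->; last first.
  by rewrite mulrC divfK// subrK.
have := congr1 (fun M : 'cV[R]_n => M i' 0) Sy.
rewrite [LHS]mxE [RHS]mxE (eq_bigr (fun j => B (up i') (up j) * y j 0 -
    B (up i') ord0 / B ord0 ord0 * (B ord0 (up j) * y j 0))); last first.
  by move=> j _; rewrite mxE; ring.
rewrite sumrB -mulr_sumr -/up; set S1 := \sum_j B (up i') (up j) * _.
set S0 := \sum_j B ord0 (up j) * _ => /eqP; rewrite subr_eq => /eqP ->.
by field.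
Qed.

Lemma posdef_eliminate n (B : 'M[R]_n.+1) : posdef B ->
  0 < B ord0 ord0 /\
  posdef (\matrix_(i < n, j < n) (B (lift ord0 i) (lift ord0 j) -
    B (lift ord0 i) ord0 / B ord0 ord0 * B ord0 (lift ord0 j))).
Proof.
move=> pdB; have p0 := posdef_pivot (n := n) pdB.
have zE : (0 : 'I_n.+1) = ord0 by apply/val_inj.
rewrite zE in p0; split=> //.
have := posdef_schur (n := n) pdB; congr posdef.
apply/matrixP => i j; rewrite /schur !mxE big_ord1 !mxE !rshift1 zE.
have lE : lshift n 0 = ord0 :> 'I_(1 + n) by apply/val_inj.
by rewrite lE mulrA.
Qed.

Lemma computes_solve d W g (B : 'M[R]_d) (v : 'cV[R]_d) mem : posdef B ->
  holds mem W B -> (forall i, reads mem (g i) (v i 0)) ->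
  computes (solve W g) mem (fun mem' y => exists2 x : 'cV[R]_d,
    B *m x = v & forall i, reads mem' (y i) (x i 0)).
Proof.
elim: d W g B v mem => [|n IHn] W g B v mem pdB hW hg.
  by apply: computes_ret; exists v => //; apply/matrixP => -[].
have [p0 pdS] := posdef_eliminate pdB.
pose up := lift (@ord0 n).
apply: computes_bind.
  apply: (@computes_tab _ _ (fun i => B (up i) ord0 / B ord0 ord0)) => i m' e.
  by apply: (@computes_op Div); exact/e/hW.
move=> m1 l e1 hl; apply: computes_bind.
  apply: (@computes_tab _ _
    (fun i => B (up i) ord0 / B ord0 ord0 * v ord0 0)) => i m' e.
  by apply: (@computes_op Mul); [exact/e/hl|exact/e/e1/hg].
move=> m2 lg e2 hlg; apply: computes_bind.
  apply: (@computes_tab _ _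
    (fun i => v (up i) 0 - B (up i) ord0 / B ord0 ord0 * v ord0 0)) => i m' e.
  by apply: (@computes_op Defs.Sub); [exact/e/e2/e1/hg|exact/e/hlg].
move=> m3 g' e3 hg'; apply: computes_bind.
  apply: (@computes_tab2 _ _ _ (\matrix_(i, j)
    (B (up i) ord0 / B ord0 ord0 * B ord0 (up j)))) => i j m' e.
  rewrite mxE; apply: (@computes_op Mul); first exact/e/e3/e2/hl.
  exact/e/e3/e2/e1/hW.
move=> m4 lW e4 hlW; apply: computes_bind.
  apply: (@computes_tab2 _ _ _ (\matrix_(i, j) (B (up i) (up j) -
    B (up i) ord0 / B ord0 ord0 * B ord0 (up j)))) => i j m' e.
  rewrite mxE; apply: (@computes_op Defs.Sub); first exact/e/e4/e3/e2/e1/hW.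
  by have := hlW i j; rewrite mxE => h; exact: e.
move=> m5 W' e5 hW'; apply: computes_bind.
  apply: (IHn _ _ _ (\col_i (v (up i) 0 - B (up i) ord0 / B ord0 ord0 * v ord0 0))
    _ pdS hW') => i.
  by rewrite mxE; exact/e5/e4/hg'.
move=> m6 y e6 [x Sx hx].
have e06 : extends mem m6.
  by move=> ? ? h; exact/e6/e5/e4/e3/e2/e1/h.
apply: computes_bind.
  apply: (computes_dot (u := fun j => B ord0 (up j)) (v := fun j => x j 0)) => //.
  by move=> j; exact/e06/hW.
move=> m7 sm e7 hsm; apply: computes_bind.
  by apply: (computes_op Defs.Sub _ hsm); exact/e7/e06/hg.
move=> m8 r e8 hr; apply: computes_bind.
  by apply: (computes_op Div hr); exact/e8/e7/e06/hW.
move=> m9 y0 e9 hy0; apply: computes_ret.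
eexists; first by apply: (eliminate _ Sx (erefl _)); rewrite gt_eqF.
move=> i; rewrite mxE; case: unliftP => [j _|_]; last exact: hy0.
exact/e9/e8/e7/hx.
Qed.

End Semantics.

(** * The program of a worker *)

Section Worker.

(** The address of an entry of a matrix listed row by row from [offset] on. *)
Definition input m n (offset : nat) (i : 'I_m) (j : 'I_n) : nat :=
  (offset + (i * n + j))%N.

Definition out m n (f : 'I_m -> 'I_n -> nat) : seq nat :=
  [seq f i j | i <- enum 'I_m, j <- enum 'I_n].

Definition compile m n (size_in : nat) (g : gen ('I_m -> 'I_n -> nat)) : slp :=
  Slp (g size_in).1 (out (g size_in).2).

Definition matmul m n p (f : 'I_m -> 'I_n -> nat) (g : 'I_n -> 'I_p -> nat) :
    gen ('I_m -> 'I_p -> nat) :=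
  tab2 (fun i j => dot (f i) (g^~ j)).

Definition matsub m n (f g : 'I_m -> 'I_n -> nat) : gen ('I_m -> 'I_n -> nat) :=
  tab2 (fun i j => emit Defs.Sub (f i j) (g i j)).

Definition sketch_gen m n d : gen ('I_m -> 'I_d -> nat) :=
  matmul (@input m n 0) (@input n d (m * n)).

Definition gradient_gen n d : gen ('I_d -> 'I_1 -> nat) :=
  bind (matmul (@input n d 0) (@input d 1 (n * d + n * 1))) (fun Ax =>
  bind (matsub Ax (@input n 1 (n * d))) (fun r =>
  matmul (fun i j => @input n d 0 j i) r)).

Definition direction_gen m d : gen ('I_d -> 'I_1 -> nat) :=
  bind (matmul (fun i j => @input m d 0 j i) (@input m d 0)) (fun W =>
  bind (solve W (fun i => @input d 1 (m * d) i ord0)) (fun y =>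
  bind zero_cell (fun z =>
  tab2 (fun i (j : 'I_1) => emit Defs.Sub z (y i))))).

Definition worker_prog m n d : worker := Worker
  (compile (m * n + n * d) (sketch_gen m n d))
  (compile (n * d + (n * 1 + d * 1)) (gradient_gen n d))
  (compile (m * d + d * 1) (direction_gen m d)).

Lemma cost_matmul m n p f g : cost (@matmul m n p f g) (m * p * (2 * n + 1)).
Proof. by apply: cost_tab2 => i j; exact: cost_dot. Qed.

(** Sketching takes O(mnd) operations, the gradient O(nd), the Gram matrix O(md^2)
    and the solution of the system O(d^3); positive dimensions let the leading
    terms absorb the others. *)
Lemma worker_prog_ops m n d : (0 < m)%N -> (0 < n)%N -> (0 < d)%N ->
  (worker_ops (worker_prog m n d) <= 12 * (m * n * d + m * d ^ 2 + d ^ 3))%N.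
Proof.
move=> m0 n0 d0.
have cs : (slp_ops (sketch_prog (worker_prog m n d)) <= m * d * (2 * n + 1))%N.
  exact: cost_matmul.
have cg : (slp_ops (gradient_prog (worker_prog m n d)) <=
    n * 1 * (2 * d + 1) + (n * 1 * 1 + d * 1 * (2 * n + 1)))%N.
  have H : cost (gradient_gen n d)
      (n * 1 * (2 * d + 1) + (n * 1 * 1 + d * 1 * (2 * n + 1))).
    apply: cost_bind => [|Ax]; first exact: cost_matmul.
    apply: cost_bind => [|r]; last exact: cost_matmul.
    by apply: cost_tab2 => i j; exact: cost_emit.
  exact: H.
have cd : (slp_ops (direction_prog (worker_prog m n d)) <=
    d * d * (2 * m + 1) + (10 * d ^ 3 + (1 + d * 1 * 1)))%N.
  have H : cost (direction_gen m d)
      (d * d * (2 * m + 1) + (10 * d ^ 3 + (1 + d * 1 * 1))).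
    apply: cost_bind => [|W]; first exact: cost_matmul.
    apply: cost_bind => [|y]; first exact: cost_solve.
    apply: cost_bind => [|z]; first exact: cost_emit.
    by apply: cost_tab2 => i j; exact: cost_emit.
  exact: H.
rewrite /worker_ops; apply: (leq_trans (leq_add (leq_add cs cg) cd)).
have h1 : (n * d <= m * n * d)%N by rewrite -mulnA leq_pmull.
have h2 : (m * d <= m * n * d)%N by rewrite mulnAC leq_pmulr.
have h3 : (n <= n * d)%N by rewrite leq_pmulr.
have h4 : (d <= n * d)%N by rewrite leq_pmull.
have h5 : (d * d <= m * (d * d))%N by rewrite leq_pmull.
have h6 : (d ^ 2 = d * d)%N by rewrite expnS expn1.
have h7 : (d <= d * d)%N by rewrite leq_pmulr.
have h8 : (d * d <= d ^ 3)%N by rewrite -h6 leq_pexp2l.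
have h9 : (0 < d ^ 3)%N by rewrite expn_gt0 d0.
have -> : (m * d * (2 * n + 1) +
    (n * 1 * (2 * d + 1) + (n * 1 * 1 + d * 1 * (2 * n + 1))) +
    (d * d * (2 * m + 1) + (10 * d ^ 3 + (1 + d * 1 * 1))) =
    2 * (m * n * d) + m * d + 4 * (n * d) + 2 * n + 2 * d +
    (2 * (m * (d * d)) + d * d + 10 * d ^ 3 + 1))%N by ring.
rewrite h6 !mulnDr.
move: (m * n * d)%N (n * d)%N (m * d)%N (m * (d * d))%N (d * d)%N (d ^ 3)%N
  h1 h2 h3 h4 h5 h7 h8 h9 => x1 x2 x3 x4 x5 x6; clear; lia.
Qed.

Context (R : realType).

Lemma nth_allpairs (T1 T2 T3 : Type) x1 x2 x3 (f : T1 -> T2 -> T3) s t i j :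
  (i < size s)%N -> (j < size t)%N ->
  nth x3 [seq f x y | x <- s, y <- t] (i * size t + j) =
  f (nth x1 s i) (nth x2 t j).
Proof.
elim: s i => [//|x s IHs] [|i] /= si tj; rewrite nth_cat size_map.
  by rewrite mul0n add0n tj (nth_map x2).
rewrite mulSn -addnA ltnNge leq_addr /= addKn.
exact: IHs.
Qed.

Lemma size_entries m n (M : 'M[R]_(m, n)) : size (entries M) = (m * n)%N.
Proof. by rewrite size_allpairs !size_enum_ord. Qed.

Lemma nth_entries m n (M : 'M[R]_(m, n)) (i : 'I_m) (j : 'I_n) :
  nth 0 (entries M) (i * n + j) = M i j.
Proof.
have := nth_allpairs i j 0 (fun i j => M i j) (s := enum 'I_m) (t := enum 'I_n)
  (i := i) (j := j).
by rewrite !size_enum_ord !nth_ord_enum; apply.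
Qed.

Lemma reads_input m n (M : 'M[R]_(m, n)) l r offset : size l = offset ->
  holds (l ++ entries M ++ r) (input offset) M.
Proof.
move=> <- i j.
have lt : (i * n + j < m * n)%N.
  apply: (@leq_trans (i * n + n)); first by rewrite ltn_add2l.
  by rewrite -mulSnr leq_mul2r ltn_ord orbT.
split.
  by rewrite !size_cat ltn_add2l size_entries (leq_trans lt) ?leq_addr.
rewrite /input nth_cat ltnNge leq_addr /= addKn nth_cat size_entries lt.
exact: nth_entries.
Qed.

Lemma compile_correct m n (g : gen ('I_m -> 'I_n -> nat)) inputs (M : 'M[R]_(m, n)) N :
  size inputs = N -> computes g inputs (fun mem f => holds mem f M) ->
  slp_run (compile N g) inputs = entries M.
Proof.
move=> <- [_ h]; rewrite /slp_run /compile /= /out map_allpairs.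
by apply: eq_allpairs => i j; have [_] := h i j.
Qed.

Lemma holds_extends m n mem mem' f (M : 'M[R]_(m, n)) :
  extends mem mem' -> holds mem f M -> holds mem' f M.
Proof. by move=> e h i j; exact: e. Qed.

Lemma computes_matmul m n p f g (A : 'M[R]_(m, n)) (B : 'M[R]_(n, p)) mem :
  holds mem f A -> holds mem g B ->
  computes (matmul f g) mem (fun mem' h => holds mem' h (A *m B)).
Proof.
move=> hA hB; apply: computes_tab2 => i j mem' e; rewrite mxE.
by apply: computes_dot => k; [exact/e/hA|exact/e/hB].
Qed.

Lemma computes_matsub m n f g (A B : 'M[R]_(m, n)) mem :
  holds mem f A -> holds mem g B ->
  computes (matsub f g) mem (fun mem' h => holds mem' h (A - B)).
Proof.
move=> hA hB; apply: computes_tab2 => i j mem' e; rewrite !mxE.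
by apply: (computes_op Defs.Sub); [exact/e/hA|exact/e/hB].
Qed.

Lemma holds_tr m n mem f (A : 'M[R]_(m, n)) :
  holds mem f A -> holds mem (fun i j => f j i) A^T.
Proof. by move=> hA i j; rewrite mxE; exact: hA. Qed.

Lemma worker_prog_correct m n d : worker_correct R m n d (worker_prog m n d).
Proof.
split.
- move=> S A; apply: compile_correct; first by rewrite size_cat !size_entries.
  apply: computes_matmul.
    exact: (@reads_input _ _ S [::] (entries A) 0).
  by rewrite -[entries A]cats0; apply: reads_input; rewrite size_entries.
- move=> A b x; apply: compile_correct.
    by rewrite !size_cat !size_entries.
  have hA : holds (entries A ++ entries b ++ entries x) (input 0) A.
    exact: (@reads_input _ _ A [::] _ 0).
  have hb : holds (entries A ++ entries b ++ entries x) (input (n * d)) b.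
    by apply: reads_input; rewrite size_entries.
  have hx : holds (entries A ++ entries b ++ entries x) (input (n * d + n * 1)) x.
    rewrite catA -[entries x]cats0; apply: reads_input.
    by rewrite size_cat !size_entries.
  apply: (computes_bind (computes_matmul hA hx)) => m1 Ax e1 hAx.
  apply: (computes_bind (computes_matsub hAx (holds_extends e1 hb))) => m2 r e2 hr.
  apply: computes_matmul => //; apply: holds_tr.
  exact: holds_extends (extends_trans e1 e2) hA.
- move=> SA g u; apply: compile_correct; first by rewrite size_cat !size_entries.
  have hS : holds (entries SA ++ entries g) (input 0) SA.
    exact: (@reads_input _ _ SA [::] _ 0).
  have hg : holds (entries SA ++ entries g) (input (m * d)) g.
    by rewrite -[entries g]cats0; apply: reads_input; rewrite size_entries.
  apply: (computes_bind (computes_matmul (holds_tr hS) hS)) => m1 W e1 hW.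
  have hg1 i : reads m1 (@input d 1 (m * d) i ord0) (g i 0).
    have -> : g i 0 = g i ord0 by congr (g i _); apply/val_inj.
    by apply: e1; exact: hg.
  apply: (computes_bind (computes_solve (posdef_gram_unit u) hW hg1)).
  move=> m2 y e2 [x xE hx].
  apply: (computes_bind (computes_zero m2)) => m3 z e3 hz.
  apply: computes_tab2 => i j m4 e4.
  have -> : (- (invmx (SA^T *m SA) *m g)) i j = 0 - x i 0.
    by rewrite -xE mulKmx// mxE ord1 sub0r.
  by apply: (computes_op Defs.Sub); [exact: e4|exact/e4/e3/hx].
Qed.

End Worker.

(** * The distributed iterative Hessian sketch *)

Section Sketch.
Context (R : realType) (m n d q : nat).
Variables (A : 'M[R]_(n, d)) (b : 'cV[R]_n) (xs : 'cV[R]_d) (mu : R).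
Variable sk : nat -> 'I_q -> 'M[R]_(m, n).
Variables (U : 'M[R]_(n, d)) (R0 : 'M[R]_d).
Hypothesis normal : A^T *m (A *m xs - b) = 0.
Hypothesis AE : A = U *m R0.
Hypothesis R0_unit : R0 \in unitmx.
Hypothesis U_orth : U^T *m U = 1%:M.

Let W t k := (sk t k *m U)^T *m (sk t k *m U).
Hypothesis W_unit : forall t k, W t k \in unitmx.

Lemma sketched_gramE t k :
  A^T *m (sk t k)^T *m sk t k *m A = R0^T *m W t k *m R0.
Proof. by rewrite AE /W !trmx_mul !mulmxA. Qed.

Lemma sketched_gram_unit t k : A^T *m (sk t k)^T *m sk t k *m A \in unitmx.
Proof. by rewrite sketched_gramE !unitmx_mul unitmx_tr R0_unit W_unit. Qed.

Lemma gradientE x : A^T *m (A *m x - b) = R0^T *m (R0 *m (x - xs)).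
Proof.
have -> : A *m x - b = A *m (x - xs) + (A *m xs - b).
  by rewrite mulmxBr addrA subrK.
rewrite mulmxDr normal addr0 AE trmx_mul -!mulmxA; congr (_ *m _).
by rewrite !mulmxA U_orth mul1mx.
Qed.

(** In the coordinates R0 (x - xs) the sketched Newton direction is the inverse
    Gram matrix of S U applied to the error. *)
Lemma newton_step t k x :
  R0 *m (invmx (A^T *m (sk t k)^T *m sk t k *m A) *m (A^T *m (A *m x - b))) =
  invmx (W t k) *m (R0 *m (x - xs)).
Proof.
set y := invmx _ *m _.
have : A^T *m (sk t k)^T *m sk t k *m A *m y = A^T *m (A *m x - b).
  by rewrite /y mulKVmx ?sketched_gram_unit.
rewrite gradientE sketched_gramE -(mulmxA (R0^T *m W t k)) -(mulmxA R0^T).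
move/(can_inj (mulKmx _)); rewrite unitmx_tr => /(_ R0_unit) <-.
by rewrite mulKmx.
Qed.

Lemma ihs_step t : let x := ihs A b mu sk in
  R0 *m (x t.+1 - xs) = R0 *m (x t - xs) -
   (mu / q%:R) *: \sum_k invmx (W t k) *m (R0 *m (x t - xs)).
Proof.
move=> x; rewrite /x /= -/(x t) addrAC mulmxBr; congr (_ - _).
rewrite -!scalemxAr scalerA mulmx_sumr; congr (_ *: _).
by apply: eq_bigr => k _; exact: newton_step.
Qed.

Lemma sqnorm_residual (e : 'cV[R]_d) : norm2 (A *m e) ^+ 2 = sqnorm (R0 *m e).
Proof.
rewrite norm2_sq !sqnormE AE -mulmxA trmx_mul -mulmxA.
by rewrite (mulmxA U^T) U_orth mul1mx.
Qed.

Lemma dist_run_iterate t :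
  iterate (dist_run (worker_prog m n d) A b mu sk t) = ihs A b mu sk t.
Proof.
elim: t => //= t ->; congr (_ + _); rewrite -scalerN -scalerN -sumrN.
congr (_ *: (_ *: _)); apply: eq_bigr => k _.
have [c1 c2 c3] := worker_prog_correct R m n d.
rewrite /worker_message c1 c2.
have E : (sk t k *m A)^T *m (sk t k *m A) = A^T *m (sk t k)^T *m sk t k *m A.
  by rewrite trmx_mul !mulmxA.
rewrite c3 E ?sketched_gram_unit//.
apply/matrixP => i j; rewrite mxE ord1.
by rewrite -[RHS](nth_entries _ i (0 : 'I_1)) muln1 addn0.
Qed.

End Sketch.

Section Bookkeeping.
Context (R : realType) (m n d q : nat).
Variables (A : 'M[R]_(n, d)) (b : 'cV[R]_n) (mu : R).
Variable sk : nat -> 'I_q -> 'M[R]_(m, n).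

Lemma size_message (S : 'M[R]_(m, n)) x :
  size (worker_message (worker_prog m n d) A b S x) = d.
Proof.
by rewrite size_map /= size_allpairs !size_enum_ord muln1.
Qed.

Lemma dist_run_communication t :
  communication (dist_run (worker_prog m n d) A b mu sk t) = (t * q * d)%N.
Proof.
elim: t => // t IHt; rewrite /communication /= map_cat sumn_cat.
rewrite [X in (X + _)%N]IHt -map_comp.
under eq_map do rewrite /= size_message.
by rewrite sumnE big_map big_enum sum_nat_const card_ord; lia.
Qed.

Lemma dist_run_ops t k :
  ops_of (dist_run (worker_prog m n d) A b mu sk t) k =
  (t * worker_ops (worker_prog m n d))%N.
Proof. by elim: t => // t IHt /=; rewrite IHt mulSn addnC. Qed.

End Bookkeeping.

Section ContractionFactor.
Context (R : realType) (m d q : nat).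
Hypothesis md : (d + 3 < m)%N.
Hypothesis q0 : (0 < q)%N.

Let p : R := m%:R - d%:R.
Let p3 : 3 < p. Proof. by rewrite /p ltrBrDl -natrD ltr_nat. Qed.
Let m0 : 0 < m%:R :> R. Proof. by rewrite ltr0n (leq_ltn_trans _ md). Qed.

Definition ratio : R := theta2 R m d / theta1 R m d ^+ 2 - 1.

(** So that the logarithm of the ratio is not a default value. *)
Lemma ratio_gt0 : 0 < ratio.
Proof.
have d0 : 0 <= d%:R :> R by exact: ler0n.
have p_gt3 : 3 < p by exact: p3.
have h0 : m%:R != 0 :> R by rewrite gt_eqF.
have h2 : p != 0 by rewrite gt_eqF//; lra.
have h3 : p - 1 != 0 by rewrite gt_eqF//; lra.
have h4 : p - 3 != 0 by rewrite gt_eqF//; lra.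
have -> : ratio = (p + 1 + d%:R * (p - 1)) / (p * (p - 3)).
  rewrite /ratio /theta1 /theta2 -/p.
  have mE : m%:R = p + d%:R :> R by rewrite /p subrK.
  by rewrite mE in h0 *; field; rewrite h0 h2 h3 h4.
apply: divr_gt0; first by nra.
by apply: mulr_gt0; lra.
Qed.

(** With mu = 1/theta1 the factor is 1 - 2 + (theta2/theta1^2 + q - 1) / q. *)
Lemma mean_factorE s : s ^+ 2 = m%:R^-1 ->
  mean_factor q m d s (1 / theta1 R m d / q%:R) = ratio / q%:R.
Proof.
have p_gt3 : 3 < p by exact: p3.
move=> s2; have s4 : s ^+ 4 = m%:R^-1 ^+ 2 by rewrite -s2 -exprM.
have q1 : q%:R != 0 :> R by rewrite pnatr_eq0 -lt0n.
have h0 : m%:R != 0 :> R by rewrite gt_eqF.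
have h2 : p != 0 by rewrite gt_eqF//; lra.
have h3 : p - 1 != 0 by rewrite gt_eqF//; lra.
have h4 : p - 3 != 0 by rewrite gt_eqF//; lra.
rewrite /mean_factor /ratio /theta1 /theta2 s2 s4 -/p.
by field; rewrite q1 h0 h2 h3 h4.
Qed.

Lemma iteration_count T eps : 0 < eps -> (0 < T)%N ->
  T%:R = ln (1 / eps) / (ln q%:R - ln ratio) -> (ratio / q%:R) ^+ T = eps.
Proof.
move=> e0 T0 TE; have r0 := ratio_gt0.
have qr0 : 0 < q%:R :> R by rewrite ltr0n.
(* q = ratio would give T = 0, as a quotient by 0 is 0. *)
have den : ln q%:R - ln ratio != 0.
  apply/eqP => den0; move: TE; rewrite den0 invr0 mulr0 => /eqP.
  by rewrite pnatr_eq0 gtn_eqF.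
have rq0 : 0 < ratio / q%:R by exact: divr_gt0.
apply: ln_inj; rewrite ?posrE ?exprn_gt0//.
rewrite lnXn// ln_div ?posrE// -[_ *+ T]mulr_natl TE div1r lnV ?posrE//.
by field.
Qed.

End ContractionFactor.

Lemma mx_measurable_ihs disp (Omega : measurableType disp) (R : realType)
    (m n d q : nat) (A : 'M[R]_(n, d)) b mu
    (sk : Omega -> nat -> 'I_q -> 'M[R]_(m, n)) t :
  (forall t k, mx_measurable (fun w => sk w t k)) ->
  mx_measurable (fun w => ihs A b mu (sk w) t).
Proof.
move=> msk; elim: t => [|t mx]; first exact: mx_measurable_cst.
have mN p l (F : Omega -> 'M[R]_(p, l)) :
    mx_measurable F -> mx_measurable (fun w => - F w).
  move=> mF; rewrite (_ : (fun w => - F w) = fun w => (-1) *: F w).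
    exact: mx_measurableZ.
  by apply/funext => w; rewrite scaleN1r.
apply: mx_measurableD => //; apply: (mN _ _ (fun w => _ *: _)).
apply: mx_measurableZ => //; apply: mx_measurableZ => //.
have mc p l (M : 'M[R]_(p, l)) : mx_measurable (fun _ : Omega => M).
  exact: mx_measurable_cst.
apply: mx_measurable_sum => k; apply: mx_measurableM.
  apply: mx_measurable_invmx; do 2?[apply: mx_measurableM => //].
  by apply: mx_measurableM => //; exact: mx_measurable_tr.
apply: mx_measurableM => //; apply: mx_measurableD => //.
exact: mx_measurableM.
Qed.

Lemma measurable_sqnorm disp (Omega : measurableType disp) (R : realType) d
    (F : Omega -> 'cV[R]_d) :
  mx_measurable F -> measurable_fun setT (fun w => sqnorm (F w)).
Proof.
by move=> mF; apply: measurable_sum => i; apply: measurable_funX; exact: mF.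
Qed.

Theorem mainTheorem7 (R : realType) :
  exists (C : nat) (W : nat -> nat -> nat -> worker),
    (forall m n d : nat, worker_correct R m n d (W m n d)) /\
    forall (disp : measure_display) (Omega : measurableType disp)
      (P : probability Omega R) (n d m q T : nat)
      (A : 'M[R]_(n, d)) (b : 'cV[R]_n) (xs : 'cV[R]_d)
      (S : nat -> 'I_q -> 'I_m -> 'I_n -> {RV P >-> R}) (eps : R),
    \rank A = d ->
    is_least_squares A b xs ->
    A *m xs != 0 ->
    (1 <= q)%N ->
    (d + 3 < m)%N ->
    iid_gaussian_sketches S ->
    0 < eps ->
    (0 < T)%N ->
    T%:R = ln (1 / eps) /
           (ln q%:R - ln (theta2 R m d / theta1 R m d ^+ 2 - 1)) ->
    let mu := 1 / theta1 R m d in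
    let x (w : Omega) := ihs A b mu (sketch_at S w) in
    let run (w : Omega) := dist_run (W m n d) A b mu (sketch_at S w) in
    [/\ ('E_P[fun w => (norm2 (A *m (x w T - xs)) ^+ 2)%R]
           / ((norm2 (A *m xs) ^+ 2)%R)%:E = eps%:E)%E,
        {ae P, forall w, forall t : nat, iterate (run w t) = x w t},
        forall w, communication (run w T) = (T * q * d)%N
      & forall w (k : 'I_q),
          (ops_of (run w T) k <=
             C * (T * m * n * d + T * m * d ^ 2 + T * d ^ 3))%N].
Proof.
exists 12%N, worker_prog; split; first exact: worker_prog_correct.
move=> disp Omega P n d m q T A b xs S eps rA ls Axs q1 md [gauss ind] e0 T0 TE.
move=> mu x run.
have m_gt0 : (0 < m)%N by exact: leq_ltn_trans md.
(* If d = 0 or n = 0, then A xs = 0. *)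
have d_gt0 : (0 < d)%N.
  case: (posnP d) => // d0; move: Axs; apply: contraNT => _; move: A xs {ls rA x run} .
  by rewrite d0 => A xs; apply/eqP/matrixP => i j; rewrite !mxE big_ord0.
have n_gt0 : (0 < n)%N.
  case: (posnP n) => // n0; move: Axs; apply: contraNT => _; move: A {ls rA x run} b.
  by rewrite n0 => A b; apply/eqP/matrixP => -[].
have [Q Qu QE] := orthonormal_factor rA.
pose U := A *m Q; pose R0 := invmx Q.
have AE : A = U *m R0 by rewrite /U mulmxK.
have R0u : R0 \in unitmx by rewrite unitmx_inv.
have normal := normal_equation ls.
pose I : choiceType := (nat * 'I_q * 'I_m * 'I_n)%type.
pose X (a : I) := S a.1.1.1 a.1.1.2 a.1.2 a.2.
pose s : R := Num.sqrt m%:R^-1.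
have s2 : s ^+ 2 = m%:R^-1 by rewrite sqr_sqrtr// invr_ge0.
have s_gt0 : 0 < s by rewrite sqrtr_gt0 invr_gt0 ltr0n.
have iid : iid_law (normal_prob 0 s : probability (measurableTypeR R) R)
    (sample_law X).
  by apply: sample_law_iid ind => a B mB; exact: gauss.
have blkE w t k : blk (entry_index t k) (sample X w) = sketch_at S w t k.
  by apply/matrixP => i j; rewrite !mxE.
pose W w t k := (sketch_at S w t k *m U)^T *m (sketch_at S w t k *m U).
have good : {ae P, forall w, forall t k, W w t k \in unitmx}.
  apply/ae_foralln => t; apply: filter_forall => k.
  have := singular_null s_gt0 iid (@entry_index_inj q m n t k) QE md.
  by move/ae_sample; apply: filterS => w; rewrite blkE.
pose c := mu / q%:R; pose z0 := R0 *m (0 - xs).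
(* Off a null event all sketched Gram matrices are invertible, and the error
   follows the recursion on families of entries. *)
have errE : {ae P, forall w, forall t,
    R0 *m (x w t - xs) = error_iter U c z0 t (sample X w)}.
  apply: filterS good => w gw; elim=> [|t IHt] //.
  rewrite (ihs_step mu normal AE R0u QE gw) [RHS]/= /averaged -IHt.
  by congr (_ - _ *: _); apply: eq_bigr => k _; rewrite /gram_inv blkE.
split.
- have [mz iz Ez] := error_iter_moment s_gt0 md iid QE c z0 T.
  have norm2E e : norm2 (A *m e) ^+ 2 = sqnorm (R0 *m e).
    exact: sqnorm_residual AE QE _.
  have y_gt0 : 0 < norm2 (A *m xs) ^+ 2.
    rewrite norm2_sq lt_neqAle sqnorm_ge0 andbT eq_sym.
    by apply: contra Axs => /eqP/sqnorm_eq0 ->.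
  have z0E : sqnorm z0 = norm2 (A *m xs) ^+ 2.
    rewrite norm2E /z0 sub0r mulmxN; apply: eq_bigr => i _.
    by rewrite mxE sqrrN.
  have msk t k : mx_measurable (fun w => sketch_at S w t k).
    move=> i j; rewrite (_ : (fun w => _) = S t k i j); first exact: measurable_funP.
    by apply/funext => w; rewrite mxE.
  have merr : measurable_fun setT
      (fun w => sqnorm (error_iter U c z0 T (sample X w))).
    apply: (measurableT_comp (measurable_sqnorm mz)).
    exact: measurable_sample.
  have mx_err : measurable_fun setT (fun w => norm2 (A *m (x w T - xs)) ^+ 2).
    rewrite (_ : (fun w => _) = fun w => sqnorm (R0 *m (x w T - xs))); last first.
      by apply/funext => w; exact: norm2E.
    apply: measurable_sqnorm; apply: mx_measurableM; first exact: mx_measurable_cst.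
    apply: mx_measurableD; last exact: mx_measurable_cst.
    exact: mx_measurable_ihs.
  have -> : ('E_P[fun w => (norm2 (A *m (x w T - xs)) ^+ 2)%R] =
      ((eps * norm2 (A *m xs) ^+ 2)%R)%:E)%E.
    rewrite unlock.
    transitivity (\int[P]_w (sqnorm (error_iter U c z0 T (sample X w)))%:E)%E.
      apply: ge0_ae_eq_integral => //.
      - exact/measurable_EFinP.
      - exact/measurable_EFinP.
      - by move=> w _; rewrite lee_fin sqr_ge0.
      - by move=> w _; rewrite lee_fin sqnorm_ge0.
      - by apply: filterS errE => w /(_ T) xE _; rewrite norm2E xE.
    rewrite (ge0_integral_sample X (measurable_sqnorm mz)); last first.
      by move=> xi; exact: sqnorm_ge0.
    rewrite -[LHS]fineK; last first.
      apply: integrable_fin_num => //; apply: intg_sum => i.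
      by apply: intg_eq (iz i i) => xi; rewrite expr2.
    congr _%:E; rewrite [LHS]Ez z0E /c (mean_factorE md q1 s2).
    by rewrite (iteration_count md q1 e0 T0 TE).
  by rewrite inver gt_eqF// -EFinM mulfK// gt_eqF.
- by apply: filterS good => w gw t; exact: (dist_run_iterate b mu AE R0u gw).
- by move=> w; exact: dist_run_communication.
- move=> w k; rewrite dist_run_ops.
  apply: (leq_trans (leq_mul (leqnn T) (worker_prog_ops m_gt0 n_gt0 d_gt0))).
  by rewrite mulnCA leq_mul// !mulnDr !mulnA.
Qed.
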